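(* Let $\Sigma$ be a closed oriented surface of genus at least $2$, let $\ast \in \Sigma$ be a base point, and let $S \subset \pi_1(\Sigma,\ast)$ be a generating set of $\pi_1(\Sigma,\ast)$ that is contained in the union of finitely many orbits of the action of $\mathrm{Mod}(\Sigma,\ast)$ on $\pi_1(\Sigma,\ast)$. Then the Cayley graph of $\pi_1(\Sigma,\ast)$ with respect to $S$ has infinite diameter.
   Context: The relative mapping class group $\mathrm{Mod}(\Sigma,\ast)$ is the group of isotopy classes of orientation-preserving diffeomorphisms of $\Sigma$ that fix $\ast$ (isotopies are through diffeomorphisms fixing $\ast$). It acts on $\pi_1(\Sigma,\ast)$ by automorphisms, via $[f]\cdot x = f_*(x)$. The generating set $S$ may be infinite. The Cayley graph of a group $G$ with respect to a generating set $S$ has finite diameter if and only if there is a constant $C \ge 0$ such that every element of $G$ is a product of at most $C$ elements of $S \cup S^{-1}$; otherwise it has infinite diameter. *)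

(* Defs.v *)
From HB Require Import structures.
From Stdlib Require Import Relation_Operators.
From mathcomp Require Import all_boot all_order all_algebra generic_quotient.
From mathcomp Require Import all_classical all_reals all_analysis.
From mathcomp Require Import lra.

Set Implicit Arguments.
Unset Strict Implicit.
Unset Printing Implicit Defensive.

Import Order.TTheory GRing.Theory Num.Theory.
Import numFieldNormedType.Exports.

Local Open Scope classical_set_scope.
Local Open Scope ring_scope.

Section continuity.
Context {R : realType}.

Lemma within_comp (T U V : topologicalType) (A : set T) (B : set U)
    (f : T -> U) (g : U -> V) :
  {within A, continuous f} -> (forall x, A x -> B (f x)) ->
  {within B, continuous g} -> {within A, continuous (g \o f)}.
Proof.
move=> /subspace_continuousP cf fAB /subspace_continuousP cg.
apply/subspace_continuousP => x Ax; apply: (@cvg_comp _ _ _ f g).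
  2: exact: (cg _ (fAB _ Ax)).
move=> W /= BW.
have := cf x Ax _ BW; rewrite /nbhs /= /within /=.
by move=> H; near=> z => /[dup] Az /(near H z); apply => //; exact: fAB.
Unshelve. all: by end_near. Qed.

Lemma within_glue (T U : topologicalType) (D : set T) (u : T -> R) (c : R)
    (f g : T -> U) :
  closed D -> continuous u ->
  {within D `&` [set x | u x <= c], continuous f} ->
  {within D `&` [set x | c <= u x], continuous g} ->
  (forall x, D x -> u x = c -> f x = g x) ->
  {within D, continuous (fun x => if u x <= c then f x else g x)}.
Proof.
move=> cD cu cf cg fg.
have -> : D = (D `&` [set x | u x <= c]) `|` (D `&` [set x | c <= u x]).
  rewrite -setIUr; apply/seteqP; split=> [x Dx|x []//]; split=> //=.
  by have [|/ltW] := leP (u x) c; [left|right].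
apply: withinU_continuous.
- apply: closedI => //; apply: (@preimage_closed _ _ u [set y | y <= c]).
    by move=> x _; exact: cu.
  exact: closed_le.
- apply: closedI => //; apply: (@preimage_closed _ _ u [set y | c <= y]).
    by move=> x _; exact: cu.
  exact: closed_ge.
- apply: subspace_eq_continuous cf => x.
  by rewrite inE /from_subspace => -[Dx /= ->].
- apply: subspace_eq_continuous cg => x.
  rewrite inE /from_subspace => -[Dx /= cux]; case: ifPn => // uxc.
  by rewrite fg//; apply/eqP; rewrite eq_le uxc.
Qed.

Lemma continuous_affine (a b : R) : continuous (fun t : R => a * t + b).
Proof.
move=> t; apply: cvgD; last exact: cvg_cst.
by apply: cvgM; [exact: cvg_cst | exact: cvg_id].
Qed.

Lemma continuous_maxr (f g : R -> R) :
  continuous f -> continuous g -> continuous (fun t => Num.max (f t) (g t)).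
Proof. by move=> cf cg t; apply: continuous_max; [exact: cf | exact: cg]. Qed.

Lemma continuous_minr (f g : R -> R) :
  continuous f -> continuous g -> continuous (fun t => Num.min (f t) (g t)).
Proof. by move=> cf cg t; apply: continuous_min; [exact: cf | exact: cg]. Qed.

Lemma continuous_pair (T U V : topologicalType) (f : T -> U) (g : T -> V) :
  continuous f -> continuous g -> continuous (fun t => (f t, g t)).
Proof. by move=> cf cg t; exact: (cvg_pair (cf t) (cg t)). Qed.

Lemma closed_unit_square : closed (`[0, 1]%classic `*` `[0, 1]%classic : set (R * R)).
Proof.
rewrite (_ : _ `*` _ = fst @^-1` `[0, 1]%classic `&` snd @^-1` `[0, 1]%classic).
  apply: closedI; apply: preimage_closed; do ?exact: interval_closed.
    by move=> ? _; exact: cvg_fst.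
  by move=> ? _; exact: cvg_snd.
by apply/seteqP; split.
Qed.
End continuity.

Section fundamental_group.
Context (R : realType) (X : topologicalType) (x0 : X).
Local Notation I := (`[0, 1]%classic : set R).

(* Only the values on [0, 1] matter: two loops that agree there are homotopic
   (homotopic_eq), hence define the same element of pi1. *)
Record loop := Loop {
  loop_fun :> R -> X ;
  loop_continuous : {within I, continuous loop_fun} ;
  loop0 : loop_fun 0 = x0 ;
  loop1 : loop_fun 1 = x0 }.

Definition homotopic (a b : loop) : Prop := exists H : R * R -> X,
  [/\ {within I `*` I, continuous H},
      forall t, I t -> H (t, 0) = a t,
      forall t, I t -> H (t, 1) = b t &
      forall s, I s -> H (0, s) = x0 /\ H (1, s) = x0].

Lemma homotopic_reparam (p q : R -> R) (c a b : loop) :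
  continuous p -> continuous q ->
  (forall t, I t -> I (p t)) -> (forall t, I t -> I (q t)) ->
  p 0 = q 0 -> p 1 = q 1 ->
  (forall t, I t -> a t = c (p t)) -> (forall t, I t -> b t = c (q t)) ->
  homotopic a b.
Proof.
move=> cp cq Ip Iq pq0 pq1 ap bq.
exists (c \o (fun z => (1 - z.2) * p z.1 + z.2 * q z.1)); split.
- apply: (within_comp (B := I)); last exact: loop_continuous.
    apply: continuous_subspaceT => z; apply: cvgD; apply: cvgM.
    + by apply: cvgB; [exact: cvg_cst | exact: cvg_snd].
    + by apply: (@cvg_comp _ _ _ fst p); [exact: cvg_fst | exact: cp].
    + exact: cvg_snd.
    + by apply: (@cvg_comp _ _ _ fst q); [exact: cvg_fst | exact: cq].
  move=> [t s] [/= /[dup] /Ip + /Iq]; rewrite /= !in_itv/=; nra.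
- by move=> t It; rewrite /= subr0 mul1r mul0r addr0 ap.
- by move=> t It; rewrite /= subrr mul0r add0r mul1r bq.
- have I0 : I 0 by rewrite /= in_itv/= lexx ler01.
  have I1 : I 1 by rewrite /= in_itv/= lexx ler01.
  move=> s Is /=; rewrite -pq0 -pq1 -!mulrDl subrK !mul1r.
  by rewrite -!ap// loop0 loop1.
Qed.

Lemma homotopic_eq (a b : loop) : (forall t, I t -> a t = b t) -> homotopic a b.
Proof.
have cid : continuous (id : R -> R) by move=> t; exact: cvg_id.
move=> ab; apply: (@homotopic_reparam id id a a b) => // t It.
by rewrite -ab.
Qed.

Lemma homotopic_refl a : homotopic a a.
Proof. exact: homotopic_eq. Qed.

Lemma homotopic_sym a b : homotopic a b -> homotopic b a.
Proof.
move=> [H [cH Ha Hb He]].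
have rI s : I s -> I (1 - s) by rewrite /= !in_itv/=; lra.
exists (H \o (fun z => (z.1, 1 - z.2))); split => /=.
- apply: (within_comp (B := I `*` I)) => //.
    apply/continuous_subspaceT/continuous_pair => z; first exact: cvg_fst.
    by apply: cvgB; [exact: cvg_cst | exact: cvg_snd].
  by move=> z [? ?]; split=> //=; exact: rI.
- by move=> t It; rewrite subr0 Hb.
- by move=> t It; rewrite subrr Ha.
- by move=> s Is; exact/He/rI.
Qed.

Lemma homotopic_trans a b c : homotopic a b -> homotopic b c -> homotopic a c.
Proof.
move=> [H [cH Ha Hb He]] [K [cK Kb Kc Ke]].
exists (fun z => if z.2 <= 2^-1 then (H \o (fun z => (z.1, 2 * z.2 + 0))) z
  else (K \o (fun z => (z.1, 2 * z.2 + (- 1)))) z).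
have cc (d : R) : continuous (fun z : R * R => (z.1, 2 * z.2 + d)).
  apply: continuous_pair => z; first exact: cvg_fst.
  apply: (@cvg_comp _ _ _ snd (fun t => 2 * t + d)); first exact: cvg_snd.
  exact: continuous_affine.
split => /=.
- apply: (@within_glue _ _ _ _ snd).
  + exact: closed_unit_square.
  + by move=> z; exact: cvg_snd.
  + apply: (within_comp (B := I `*` I)) => //.
      exact: continuous_subspaceT.
    by move=> z [[]]; rewrite /= !in_itv/= => I1 I2 s2; split; lra.
  + apply: (within_comp (B := I `*` I)) => //.
      exact: continuous_subspaceT.
    by move=> z [[]]; rewrite /= !in_itv/= => I1 I2 s2; split; lra.
  + move=> [t s] [/= It Is] ->; rewrite addr0 divff//.
    by rewrite Hb// subrr Kb.
- move=> t It; rewrite ifT; last by rewrite invr_ge0.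
  by rewrite mulr0 addr0 Ha.
- move=> t It; rewrite ifF; last by apply/negbTE; rewrite -ltNge; lra.
  by rewrite (_ : _ + _ = 1) ?Kc//; lra.
- move=> s; rewrite /= in_itv/= => Is; case: ifPn => s2.
    by apply: He; rewrite /= in_itv/=; lra.
  by apply: Ke; move: s2; rewrite /= in_itv/= -ltNge => ?; lra.
Qed.

Definition const_loop : loop := @Loop (cst x0)
  (continuous_subspaceT (fun=> cvg_cst x0)) erefl erefl.

Definition rev_fun (a : R -> X) : R -> X := fun t => a (1 - t).

Definition cat_fun (a b : R -> X) : R -> X :=
  fun t => if t <= 2^-1 then a (2 * t) else b (2 * t - 1).

Lemma rev_loop_subproof (a : loop) :
  [/\ {within I, continuous (rev_fun a)}, rev_fun a 0 = x0 & rev_fun a 1 = x0].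
Proof.
split; rewrite /rev_fun ?subr0 ?subrr ?loop0 ?loop1//.
apply: (within_comp (B := I)) (@loop_continuous a).
  apply: continuous_subspaceT => t.
  by apply: cvgB; [exact: cvg_cst | exact: cvg_id].
by move=> t; rewrite /= !in_itv/=; lra.
Qed.

Definition rev_loop (a : loop) : loop :=
  let: And3 c e0 e1 := rev_loop_subproof a in Loop c e0 e1.

Lemma cat_loop_subproof (a b : loop) :
  [/\ {within I, continuous (cat_fun a b)},
      cat_fun a b 0 = x0 & cat_fun a b 1 = x0].
Proof.
split; rewrite /cat_fun.
- apply: (@within_glue _ _ _ _ id).
  + exact: interval_closed.
  + by move=> t; exact: cvg_id.
  + apply: (@within_comp R R X _ I (fun t => 2 * t) a).
    * apply: continuous_subspaceT => t.
      by apply: cvgM; [exact: cvg_cst | exact: cvg_id].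
    * by move=> t []; rewrite /= !in_itv/=; lra.
    * exact: loop_continuous.
  + apply: (@within_comp R R X _ I (fun t => 2 * t - 1) b).
    * by apply: continuous_subspaceT; exact: continuous_affine.
    * by move=> t []; rewrite /= !in_itv/=; lra.
    * exact: loop_continuous.
  + by move=> t _ ->; rewrite divff// subrr loop0 loop1.
- by rewrite ifT ?invr_ge0// mulr0 loop0.
- rewrite ifF; last by apply/negbTE; rewrite -ltNge; lra.
  by rewrite (_ : _ - _ = 1) ?loop1//; lra.
Qed.

Definition cat_loop (a b : loop) : loop :=
  let: And3 c e0 e1 := cat_loop_subproof a b in Loop c e0 e1.

Lemma rev_loopE a : rev_loop a = rev_fun a :> (R -> X).
Proof. by rewrite /rev_loop; case: rev_loop_subproof. Qed.

Lemma cat_loopE a b : cat_loop a b = cat_fun a b :> (R -> X).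
Proof. by rewrite /cat_loop; case: cat_loop_subproof. Qed.

Lemma homotopic_rev a b : homotopic a b -> homotopic (rev_loop a) (rev_loop b).
Proof.
move=> [H [cH Ha Hb He]].
have rI s : I s -> I (1 - s) by rewrite /= !in_itv/=; lra.
exists (H \o (fun z => (1 - z.1, z.2))); split => /=; rewrite ?rev_loopE.
- apply: (within_comp (B := I `*` I)) => //.
    apply/continuous_subspaceT/continuous_pair => z; last exact: cvg_snd.
    by apply: cvgB; [exact: cvg_cst | exact: cvg_fst].
  by move=> z [? ?]; split=> //=; exact: rI.
- by move=> t It; rewrite Ha//; exact: rI.
- by move=> t It; rewrite Hb//; exact: rI.
- by move=> s Is; rewrite subr0 subrr; have [] := He _ Is.
Qed.

Lemma homotopic_cat a a' b b' : homotopic a a' -> homotopic b b' ->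
  homotopic (cat_loop a b) (cat_loop a' b').
Proof.
move=> [H [cH Ha Ha' He]] [K [cK Kb Kb' Ke]].
exists (fun z => if z.1 <= 2^-1 then (H \o (fun z => (2 * z.1 + 0, z.2))) z
  else (K \o (fun z => (2 * z.1 + (- 1), z.2))) z).
have cc (d : R) : continuous (fun z : R * R => (2 * z.1 + d, z.2)).
  apply: continuous_pair => z; last exact: cvg_snd.
  apply: (@cvg_comp _ _ _ fst (fun t => 2 * t + d)); first exact: cvg_fst.
  exact: continuous_affine.
split => /=.
- apply: (@within_glue _ _ _ _ fst).
  + exact: closed_unit_square.
  + by move=> z; exact: cvg_fst.
  + apply: (within_comp (B := I `*` I)) => //.
      exact: continuous_subspaceT.
    by move=> z [[]]; rewrite /= !in_itv/= => I1 I2 s2; split; lra.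
  + apply: (within_comp (B := I `*` I)) => //.
      exact: continuous_subspaceT.
    by move=> z [[]]; rewrite /= !in_itv/= => I1 I2 s2; split; lra.
  + move=> [t s] [/= It Is] ->; rewrite addr0 divff// subrr.
    by rewrite (He _ Is).2 (Ke _ Is).1.
- move=> t; rewrite cat_loopE /cat_fun /= in_itv/= => It; case: ifPn => [|/negbTE] t2.
    by rewrite addr0 Ha//= in_itv/=; lra.
  by move: t2; rewrite leNgt => /negbFE t2; rewrite Kb//= in_itv/=; lra.
- move=> t; rewrite cat_loopE /cat_fun /= in_itv/= => It; case: ifPn => [|/negbTE] t2.
    by rewrite addr0 Ha'//= in_itv/=; lra.
  by move: t2; rewrite leNgt => /negbFE t2; rewrite Kb'//= in_itv/=; lra.
- move=> s Is; rewrite ifT ?invr_ge0// mulr0 addr0 (He _ Is).1; split=> //.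
  rewrite ifF; last by apply/negbTE; rewrite -ltNge; lra.
  by rewrite (_ : _ + _ = 1) ?(Ke _ Is).2//; lra.
Qed.

Lemma homotopic_catA a b c :
  homotopic (cat_loop a (cat_loop b c)) (cat_loop (cat_loop a b) c).
Proof.
pose p t : R := Num.max (2^-1 * t + 0) (Num.max (1 * t + (- 4^-1)) (2 * t + (-1))).
have pE t : I t -> [\/ (t <= 2^-1 /\ p t = 2^-1 * t),
    (2^-1 < t <= 3 / 4 /\ p t = t - 4^-1) | (3 / 4 < t /\ p t = 2 * t - 1)].
  rewrite /p /= in_itv/= => It.
  have [?|?] := leP t 2^-1.
    apply: Or31; split=> //; rewrite !max_l ?addr0 ?ge_max//; lra.
  have [?|?] := leP t (3 / 4).
    apply: Or32; split; first lra.
    rewrite max_r ?le_max; last by lra.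
    rewrite max_l; lra.
  apply: Or33; split; first lra.
  rewrite max_r ?le_max; last by lra.
  rewrite max_r; lra.
apply: (@homotopic_reparam p id (cat_loop (cat_loop a b) c)) => //.
- by do 2?[apply: continuous_maxr]; exact: continuous_affine.
- by move=> t; exact: cvg_id.
- by move=> t /[dup] /pE [] [? ->]; rewrite /= !in_itv/=; lra.
- by case: (pE 0) => [|[? ->]|[? ->]|[? ->]]; rewrite /= ?in_itv/=; lra.
- by case: (pE 1) => [|[? ->]|[? ->]|[? ->]]; rewrite /= ?in_itv/=; lra.
- move=> t It; rewrite !cat_loopE /cat_fun.
  case: (pE t It) => -[? ->].
  + by do !(case: ifP => [|/negbT]; rewrite -?ltNge => ?);
      first [congr (a _); lra | exfalso; lra].
  + by do !(case: ifP => [|/negbT]; rewrite -?ltNge => ?);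
      first [congr (b _); lra | exfalso; lra].
  + by do !(case: ifP => [|/negbT]; rewrite -?ltNge => ?);
      first [congr (c _); lra | exfalso; lra].
Qed.

Lemma homotopic_cat1 a : homotopic (cat_loop const_loop a) a.
Proof.
pose p t : R := Num.max (0 * t + 0) (2 * t + (-1)).
have pE t : I t -> (t <= 2^-1 /\ p t = 0) \/ (2^-1 < t /\ p t = 2 * t - 1).
  rewrite /p /= in_itv/= mul0r addr0 => It.
  have [?|?] := leP t 2^-1; [left; rewrite max_l//; lra|right; rewrite max_r//; lra].
apply: (@homotopic_reparam p id a) => //.
- by apply: continuous_maxr; exact: continuous_affine.
- by move=> t; exact: cvg_id.
- by move=> t /[dup] /pE [] [? ->]; rewrite /= !in_itv/=; lra.
- by case: (pE 0) => [|[? ->]|[? ->]]; rewrite /= ?in_itv/=; lra.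
- by case: (pE 1) => [|[? ->]|[? ->]]; rewrite /= ?in_itv/=; lra.
- move=> t It; rewrite cat_loopE /cat_fun; case: (pE t It) => -[? ->].
    by rewrite ifT// loop0.
  by rewrite ifF//; apply/negbTE; rewrite -ltNge.
Qed.

Lemma homotopic_cat_const a : homotopic (cat_loop a const_loop) a.
Proof.
pose p t : R := Num.min (2 * t + 0) (0 * t + 1).
have pE t : I t -> (t <= 2^-1 /\ p t = 2 * t) \/ (2^-1 < t /\ p t = 1).
  rewrite /p /= in_itv/= mul0r add0r addr0 => It.
  have [?|?] := leP t 2^-1; [left; rewrite min_l//; lra|right; rewrite min_r//; lra].
apply: (@homotopic_reparam p id a) => //.
- by apply: continuous_minr; exact: continuous_affine.
- by move=> t; exact: cvg_id.
- by move=> t /[dup] /pE [] [? ->]; rewrite /= !in_itv/=; lra.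
- by case: (pE 0) => [|[? ->]|[? ->]]; rewrite /= ?in_itv/=; lra.
- by case: (pE 1) => [|[? ->]|[? ->]]; rewrite /= ?in_itv/=; lra.
- move=> t It; rewrite cat_loopE /cat_fun; case: (pE t It) => -[? ->].
    by rewrite ifT.
  by rewrite ifF ?loop1//; apply/negbTE; rewrite -ltNge.
Qed.

Lemma homotopic_cat_rev a : homotopic (cat_loop a (rev_loop a)) const_loop.
Proof.
pose p t : R := Num.min (2 * t + 0) ((-2) * t + 2).
have pE t : I t -> (t <= 2^-1 /\ p t = 2 * t) \/ (2^-1 < t /\ p t = (-2) * t + 2).
  rewrite /p /= in_itv/= addr0 => It.
  have [?|?] := leP t 2^-1; [left; rewrite min_l//; lra|right; rewrite min_r//; lra].
apply: (@homotopic_reparam p (fun=> 0) a) => //.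
- by apply: continuous_minr; exact: continuous_affine.
- by move=> t; exact: cvg_cst.
- by move=> t /[dup] /pE [] [? ->]; rewrite /= !in_itv/=; lra.
- by move=> t _; rewrite /= in_itv/= lexx ler01.
- by case: (pE 0) => [|[? ->]|[? ->]]; rewrite /= ?in_itv/=; lra.
- by case: (pE 1) => [|[? ->]|[? ->]]; rewrite /= ?in_itv/=; lra.
- move=> t It; rewrite cat_loopE /cat_fun rev_loopE /rev_fun.
  case: (pE t It) => -[? ->]; first by rewrite ifT.
  rewrite ifF; last by apply/negbTE; rewrite -ltNge.
  congr (a _); lra.
- by move=> t _; rewrite loop0.
Qed.

Lemma homotopic_rev_cat a : homotopic (cat_loop (rev_loop a) a) const_loop.
Proof.
apply: homotopic_trans (homotopic_cat_rev (rev_loop a)).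
apply: homotopic_cat; first exact: homotopic_refl.
by apply: homotopic_eq => t _; rewrite !rev_loopE /rev_fun subKr.
Qed.

HB.instance Definition _ := gen_eqMixin loop.
HB.instance Definition _ := gen_choiceMixin loop.

Definition homotopicb (a b : loop) : bool := `[< homotopic a b >].

Let homotopicb_refl : reflexive homotopicb.
Proof. by move=> a; apply/asboolP/homotopic_refl. Qed.

Let homotopicb_sym : symmetric homotopicb.
Proof. by move=> a b; apply/asboolP/asboolP; exact: homotopic_sym. Qed.

Let homotopicb_trans : transitive homotopicb.
Proof.
by move=> b a c /asboolP ab /asboolP bc; apply/asboolP; exact: homotopic_trans bc.
Qed.

Canonical homotopicb_equiv :=
  EquivRel homotopicb homotopicb_refl homotopicb_sym homotopicb_trans.

Local Open Scope quotient_scope.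

Definition pi1 : Type := {eq_quot homotopicb}.
HB.instance Definition _ := Choice.on pi1.
HB.instance Definition _ := EqQuotient.on pi1.

Lemma pi1P (a b : loop) : \pi_pi1 a = \pi_pi1 b <-> homotopic a b.
Proof. by split=> [/eqmodP/asboolP|ab]//; apply/eqmodP/asboolP. Qed.

Lemma pi1_reprP (a : loop) : homotopic (repr (\pi_pi1 a)) a.
Proof. by apply/pi1P; rewrite reprK. Qed.

Definition pi1_one : pi1 := \pi_pi1 const_loop.
Definition pi1_inv (x : pi1) : pi1 := \pi_pi1 (rev_loop (repr x)).
Definition pi1_mul (x y : pi1) : pi1 := \pi_pi1 (cat_loop (repr x) (repr y)).

Lemma pi1_invE a : pi1_inv (\pi_pi1 a) = \pi_pi1 (rev_loop a).
Proof. by apply/pi1P/homotopic_rev/pi1_reprP. Qed.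

Lemma pi1_mulE a b : pi1_mul (\pi_pi1 a) (\pi_pi1 b) = \pi_pi1 (cat_loop a b).
Proof. by apply/pi1P/homotopic_cat; exact: pi1_reprP. Qed.

Lemma pi1_mulA : associative pi1_mul.
Proof.
elim/quotW => a; elim/quotW => b; elim/quotW => c.
rewrite (pi1_mulE b c) (pi1_mulE a b) (pi1_mulE a (cat_loop b c)).
rewrite (pi1_mulE (cat_loop a b) c); apply/pi1P; exact: homotopic_catA.
Qed.

Lemma pi1_mul1 : left_id pi1_one pi1_mul.
Proof. by elim/quotW => a; rewrite pi1_mulE; apply/pi1P; exact: homotopic_cat1. Qed.

Lemma pi1_mulr1 : right_id pi1_one pi1_mul.
Proof. by elim/quotW => a; rewrite pi1_mulE; apply/pi1P; exact: homotopic_cat_const. Qed.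

Lemma pi1_mulV : left_inverse pi1_one pi1_inv pi1_mul.
Proof.
by elim/quotW => a; rewrite pi1_invE pi1_mulE; apply/pi1P; exact: homotopic_rev_cat.
Qed.

Lemma pi1_mulrV : right_inverse pi1_one pi1_inv pi1_mul.
Proof.
by elim/quotW => a; rewrite pi1_invE pi1_mulE; apply/pi1P; exact: homotopic_cat_rev.
Qed.

HB.instance Definition _ := isGroup.Build pi1
  pi1_mulA pi1_mul1 pi1_mulr1 pi1_mulV pi1_mulrV.

End fundamental_group.

Section smooth.
Context {R : realType}.
Local Notation E := 'rV[R]_2.

(* C^n on an open set U: Frechet differentiable with C^(n-1) derivatives in
   every direction. *)
Fixpoint Ck (n : nat) (U : set E) (f : E -> E) : Prop :=
  if n is m.+1 then
    (forall x, U x -> differentiable f x) /\ (forall v, Ck m U ('D_v f))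
  else forall x, U x -> {for x, continuous f}.

Definition smooth_on (U : set E) (f : E -> E) : Prop := forall n, Ck n U f.

Record chart (T : topologicalType) := Chart {
  chart_dom : set T ;
  chart_fun :> T -> E ;
  chart_inv : E -> T ;
  chart_dom_open : open chart_dom ;
  chart_image_open : open (chart_fun @` chart_dom) ;
  chart_funK : {in chart_dom, cancel chart_fun chart_inv} ;
  chart_continuous : {within chart_dom, continuous chart_fun} ;
  chart_inv_continuous :
    {within chart_fun @` chart_dom, continuous chart_inv} }.

Section local_expression.
Context {T : topologicalType}.
Implicit Types (A : set (chart T)) (c d : chart T) (f : T -> T).

(* The coordinate expression d o f o c^-1 of f and the open set where it is
   defined. *)
Definition local_dom c d f : set E :=
  c @` (chart_dom c `&` f @^-1` chart_dom d).

Definition local_fun c d f : E -> E := d \o f \o chart_inv c.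

Definition smooth_map A f : Prop :=
  continuous f /\
  forall c d, A c -> A d -> smooth_on (local_dom c d f) (local_fun c d f).

Definition orientation_preserving A f : Prop :=
  forall c d, A c -> A d -> forall p, local_dom c d f p ->
    0 < \det ('J (local_fun c d f) p).

End local_expression.
End smooth.

(* A connected closed surface with an oriented smooth atlas: for f = id, the
   coordinate expressions are the transition maps. There is no boundary, since
   the chart images are open in the plane, and second countability follows from
   compactness. *)
Record closed_oriented_surface (R : realType) := ClosedOrientedSurface {
  surface_space :> topologicalType ;
  atlas : set (@chart R surface_space) ;
  atlas_cover : forall x, exists2 c, atlas c & chart_dom c x ;
  atlas_smooth : smooth_map atlas id ;
  atlas_oriented : orientation_preserving atlas id ;
  surface_hausdorff : hausdorff_space surface_space ;
  surface_compact : compact [set: surface_space] ;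
  surface_connected : connected [set: surface_space] }.

Section genus.
Context (R : realType).
Local Notation E := 'rV[R]_2.

Definition unit_disk : set E := [set p | p 0 0 ^+ 2 + p 0 1 ^+ 2 <= 1].

(* The boundary circle as a 4g-gon: edge number k is u \in [k, k + 1]. *)
Definition polygon_boundary (g : nat) (u : R) : E :=
  let t := 2 * pi * u / (4 * g)%:R in
  \row_i (if i == 0 then cos t else sin t).

(* The boundary word is the product of a_j b_j a_j^-1 b_j^-1 over j < g. *)
Inductive side_pairing (g : nat) : E -> E -> Prop :=
| side_pairing_a (j : nat) (s : R) of (j < g)%N & 0 <= s <= 1 :
    side_pairing g (polygon_boundary g ((4 * j)%:R + s))
                   (polygon_boundary g ((4 * j + 3)%:R - s))
| side_pairing_b (j : nat) (s : R) of (j < g)%N & 0 <= s <= 1 :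
    side_pairing g (polygon_boundary g ((4 * j + 1)%:R + s))
                   (polygon_boundary g ((4 * j + 4)%:R - s)).

(* T is homeomorphic to the quotient of the disk by the side pairing; this is
   the surface of genus g only for g > 0. *)
Definition has_genus (g : nat) (T : topologicalType) : Prop :=
  exists q : E -> T,
    [/\ q @` unit_disk = setT,
        forall x y, unit_disk x -> unit_disk y ->
          q x = q y <-> clos_refl_sym_trans E (side_pairing g) x y &
        forall V : set T,
          open V <-> open (q @^-1` V : set (subspace unit_disk))].

End genus.

Section mapping_class_group.
Context (R : realType) (M : closed_oriented_surface R) (x0 : M).
Local Notation I := (`[0, 1]%classic : set R).
Local Open Scope quotient_scope.

Record pdiffeo := PDiffeo {
  pdiffeo_fun :> M -> M ;
  pdiffeo_inv : M -> M ;
  pdiffeoK : cancel pdiffeo_fun pdiffeo_inv ;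
  pdiffeoVK : cancel pdiffeo_inv pdiffeo_fun ;
  pdiffeo_smooth : smooth_map (@atlas R M) pdiffeo_fun ;
  pdiffeo_inv_smooth : smooth_map (@atlas R M) pdiffeo_inv ;
  pdiffeo_orientation : orientation_preserving (@atlas R M) pdiffeo_fun ;
  pdiffeo_fix : pdiffeo_fun x0 = x0 }.

Definition isotopic (f g : pdiffeo) : Prop := exists F : R -> pdiffeo,
  [/\ {within I `*` [set: M], continuous (fun z : R * M => F z.1 z.2)},
      F 0 =1 f & F 1 =1 g].

Lemma isotopic_refl f : isotopic f f.
Proof.
exists (fun=> f); split=> //; apply: continuous_subspaceT => z.
apply: (@cvg_comp _ _ _ snd f); first exact: cvg_snd.
by have [] := pdiffeo_smooth f => + _; apply.
Qed.

Lemma isotopic_sym f g : isotopic f g -> isotopic g f.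
Proof.
move=> [F [cF F0 F1]]; exists (fun t => F (1 - t)); split.
- apply: (@within_comp (R * M)%type (R * M)%type M _ (I `*` setT)
    (fun z => (1 - z.1, z.2)) (fun z => F z.1 z.2)) => //.
    apply/continuous_subspaceT/continuous_pair => z; last exact: cvg_snd.
    by apply: cvgB; [exact: cvg_cst | exact: cvg_fst].
  by move=> z [+ _]; rewrite /= !in_itv/= => ?; split=> //; lra.
- by move=> x; rewrite subr0 F1.
- by move=> x; rewrite subrr F0.
Qed.

Lemma isotopic_trans f g h : isotopic f g -> isotopic g h -> isotopic f h.
Proof.
move=> [F [cF F0 F1]] [G [cG G0 G1]].
exists (fun t => if t <= 2^-1 then F (2 * t + 0) else G (2 * t + (- 1))).
have cc (d : R) : continuous (fun z : R * M => (2 * z.1 + d, z.2)).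
  apply: continuous_pair => z; last exact: cvg_snd.
  apply: (@cvg_comp _ _ _ fst (fun t => 2 * t + d)); first exact: cvg_fst.
  exact: continuous_affine.
split.
- rewrite (_ : (fun z : R * M => _) = (fun z => if z.1 <= 2^-1
    then F (2 * z.1 + 0) z.2 else G (2 * z.1 + (- 1)) z.2)); last first.
    by apply/funext => z; case: ifP.
  apply: (@within_glue _ (R * M)%type M _ fst).
  + rewrite (_ : _ `*` _ = fst @^-1` I).
      apply: preimage_closed; last exact: interval_closed.
      by move=> ? _; exact: cvg_fst.
    by apply/seteqP; split=> z //= -[].
  + by move=> z; exact: cvg_fst.
  + apply: (@within_comp (R * M)%type (R * M)%type M _ (I `*` setT)
      (fun z => (2 * z.1 + 0, z.2)) (fun z => F z.1 z.2)) => //.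
      exact: continuous_subspaceT.
    by move=> z [[+ _]]; rewrite /= !in_itv/= => ? ?; split=> //; lra.
  + apply: (@within_comp (R * M)%type (R * M)%type M _ (I `*` setT)
      (fun z => (2 * z.1 + (- 1), z.2)) (fun z => G z.1 z.2)) => //.
      exact: continuous_subspaceT.
    by move=> z [[+ _]]; rewrite /= !in_itv/= => ? ?; split=> //; lra.
  + by move=> [t x] _ /= ->; rewrite addr0 divff// subrr F1 G0.
- by move=> x; rewrite ifT ?invr_ge0// mulr0 addr0 F0.
- move=> x; rewrite ifF; last by apply/negbTE; rewrite -ltNge; lra.
  by rewrite (_ : _ + _ = 1) ?G1//; lra.
Qed.

HB.instance Definition _ := gen_eqMixin pdiffeo.
HB.instance Definition _ := gen_choiceMixin pdiffeo.

Definition isotopicb (f g : pdiffeo) : bool := `[< isotopic f g >].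

Let isotopicb_refl : reflexive isotopicb.
Proof. by move=> a; apply/asboolP/isotopic_refl. Qed.

Let isotopicb_sym : symmetric isotopicb.
Proof. by move=> a b; apply/asboolP/asboolP; exact: isotopic_sym. Qed.

Let isotopicb_trans : transitive isotopicb.
Proof.
by move=> b a c /asboolP ab /asboolP bc; apply/asboolP; exact: isotopic_trans bc.
Qed.

Canonical isotopicb_equiv :=
  EquivRel isotopicb isotopicb_refl isotopicb_sym isotopicb_trans.

(* Only the set of isotopy classes is needed to speak of orbits in pi1; its
   group law is not used. *)
Definition Mod : Type := {eq_quot isotopicb}.
HB.instance Definition _ := Choice.on Mod.
HB.instance Definition _ := EqQuotient.on Mod.

Lemma ModP (f g : pdiffeo) : \pi_Mod f = \pi_Mod g <-> isotopic f g.
Proof. by split=> [/eqmodP/asboolP|ab]//; apply/eqmodP/asboolP. Qed.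

Lemma push_loop_subproof (f : pdiffeo) (a : loop R x0) :
  [/\ {within I, continuous (f \o a)}, (f \o a) 0 = x0 & (f \o a) 1 = x0].
Proof.
split; rewrite /= ?loop0 ?loop1 ?pdiffeo_fix//.
apply: (@within_comp R M M _ setT a f); [exact: loop_continuous|by []|].
by apply: continuous_subspaceT; have [] := pdiffeo_smooth f.
Qed.

Definition push_loop (f : pdiffeo) (a : loop R x0) : loop R x0 :=
  let: And3 c e0 e1 := push_loop_subproof f a in Loop c e0 e1.

Lemma push_loopE f a : push_loop f a = f \o a :> (R -> M).
Proof. by rewrite /push_loop; case: push_loop_subproof. Qed.

Lemma homotopic_push f a b :
  homotopic a b -> homotopic (push_loop f a) (push_loop f b).
Proof.
move=> [H [cH Ha Hb He]]; exists (f \o H); split; rewrite ?push_loopE.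
- apply: (@within_comp (R * R)%type M M _ setT H f) => //.
  by apply: continuous_subspaceT; have [] := pdiffeo_smooth f.
- by move=> t It /=; rewrite Ha.
- by move=> t It /=; rewrite Hb.
- by move=> s /He /= [-> ->]; rewrite pdiffeo_fix.
Qed.

Lemma isotopic_push f g a :
  isotopic f g -> homotopic (push_loop f a) (push_loop g a).
Proof.
move=> [F [cF F0 F1]]; exists (fun z => F z.2 (a z.1)); rewrite !push_loopE.
split=> /=.
- apply: (@within_comp (R * R)%type (R * M)%type M _ (I `*` setT)
    (fun z => (z.2, a z.1)) (fun z => F z.1 z.2)) => //; last first.
    by move=> z [].
  apply: (@continuous_pair (subspace (I `*` I)) R M snd (a \o fst)).
    by apply: continuous_subspaceT => z; exact: cvg_snd.
  apply: (@within_comp (R * R)%type R M _ I fst a); last exact: loop_continuous.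
    by apply: continuous_subspaceT => z; exact: cvg_fst.
  by move=> z [].
- by move=> t _; rewrite F0.
- by move=> t _; rewrite F1.
- by move=> s _; rewrite loop0 loop1 pdiffeo_fix.
Qed.

(* This does not depend on the representatives: see Mod_actE. *)
Definition Mod_act (m : Mod) (x : pi1 R x0) : pi1 R x0 :=
  \pi_(pi1 R x0) (push_loop (repr m) (repr x)).

Lemma Mod_actE f a :
  Mod_act (\pi_Mod f) (\pi_(pi1 R x0) a) = \pi_(pi1 R x0) (push_loop f a).
Proof.
apply/pi1P; apply: homotopic_trans (homotopic_push _ (pi1_reprP a)) _.
by apply/isotopic_push/ModP; rewrite reprK.
Qed.

Definition Mod_orbit (x : pi1 R x0) : set (pi1 R x0) :=
  [set Mod_act m x | m in [set: Mod]].

End mapping_class_group.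

Section cayley_graph.
Local Open Scope group_scope.

Definition generates (G : groupType) (S : set G) : Prop :=
  forall H : set G, group_closed (mem H) -> S `<=` H -> H = setT.

Definition cayley_graph (G : groupType) (S : set G) (g h : G) : Prop :=
  exists2 s, S s & h = g * s \/ g = h * s.

Fixpoint walk (V : Type) (adj : V -> V -> Prop) (n : nat) (x y : V) : Prop :=
  if n is m.+1 then exists2 z, adj x z & walk adj m z y else x = y.

Definition finite_diameter (V : Type) (adj : V -> V -> Prop) : Prop :=
  exists C : nat, forall x y, exists2 n, (n <= C)%N & walk adj n x y.

Lemma finite_diameter_cayleyP (G : groupType) (S : set G) :
  finite_diameter (cayley_graph S) <->
  exists C : nat, forall g : G, exists s : seq G,
    [/\ (size s <= C)%N, forall x, x \in s -> S x \/ S x^-1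
      & g = \prod_(x <- s) x].
Proof.
have walkP n (g h : G) : walk (cayley_graph S) n g h <-> exists s : seq G,
    [/\ size s = n, forall x, x \in s -> S x \/ S x^-1 & h = g * \prod_(x <- s) x].
  elim: n g h => [|n IH] g h /=.
    split=> [->|[[|? ?] [] // _ _ ->]]; last by rewrite big_nil mulg1.
    by exists [::]; rewrite big_nil mulg1.
  split=> [[k [s Ss gk]] /IH [l [ln Sl ->]]|[[|s l] [] // [ln] Sl ->]].
    case: gk => ->.
      exists (s :: l); split; rewrite /= ?ln ?big_cons ?mulgA// => x.
      by rewrite inE => /predU1P[->|/Sl]//; left.
    exists (s^-1 :: l); split; rewrite /= ?ln ?big_cons//.
      by move=> x; rewrite inE => /predU1P[->|/Sl]//; right; rewrite invgK.
    by rewrite mulgA mulgK.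
  exists (g * s).
    have [Ss|Ss] := Sl s (mem_head _ _); first by exists s => //; left.
    by exists s^-1 => //; right; rewrite mulgK.
  apply/IH; exists l; split=> //; last by rewrite big_cons mulgA.
  by move=> x xl; apply: Sl; rewrite inE xl orbT.
split=> -[C HC]; exists C.
  move=> g; have [n nC /walkP[s [sn Ss gE]]] := HC 1 g.
  by exists s; rewrite sn gE mul1g.
move=> x y; have [s [sC Ss xy]] := HC (x^-1 * y); exists (size s) => //.
by apply/walkP; exists s; rewrite -xy mulVKg.
Qed.

Definition infinite_diameter (V : Type) (adj : V -> V -> Prop) : Prop :=
  ~ finite_diameter adj.

End cayley_graph.

(* Main.v *)
From HB Require Import structures.
From Stdlib Require Import Relation_Operators.
Require Import Defs.
From mathcomp Require Import all_boot all_order all_algebra generic_quotient.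
From mathcomp Require Import all_classical all_reals all_analysis.
From mathcomp Require Import lra zify.

Set Implicit Arguments.
Unset Strict Implicit.
Unset Printing Implicit Defensive.

(** The surface is cut along the separating curve [c], the commutator of the first two generators
    [a], [b]. Since the genus is at least 2, the fundamental group becomes an amalgam over the
    cyclic group [<c>]: on one side the free group of a one-holed torus, on the other the free group
    of the remaining handles. The function [turns2] counts, with sign, the syllables of a normal
    form that lie in the double coset of [a^2] (plus) or [a^-2] (minus) modulo [<c>]. It is a
    quasimorphism ([turns2_quasi]), and it is unbounded: on the n-th power of [a^2] times a
    generator of the other side it equals n ([turns2_unbounded]).

    On simple closed curves it is bounded. Such a curve meets the one-holed torus in disjoint simple
    arcs, whereas an arc winding twice around [a] crosses itself, so that no syllable of a
    cyclically reduced simple element counts ([no_square_turn], [simple_turn_free]). Hence [turns2]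
    is at most 7 in absolute value on simple elements ([simple_turns2]), and no number of simple
    factors suffices for all elements ([not_bounded_simple]).

    The polygon generators are simple ([simple_gen]), so every element is a product of finitely many
    simple ones. The number of factors needed is preserved by automorphisms, hence by the mapping
    class group, and is therefore bounded on finitely many orbits. A finite diameter for [S] would
    then bound the number of simple factors on the whole group.

    Simplicity is expressed inside the group ([simple]): an integer function [X] tells the two sides
    of the axis of [s] apart. To exclude [a^2], the values of [X] are followed to the two ends of
    each translate of the line [<c>], called a gate of the adjacent vertex groups. In the cyclic
    order of ends the axis passes through the gates of [1] and [a^2], its translate by [a] through
    those of [a] and [a^3], and these pairs are linked. Invariance of [X] along the translate
    forbids a jump at the first pair; without jumps [X] is almost constant ([not_simple_of_quiet]),
    which simplicity excludes.

    On the topological side, the quotient of the polygon is shown to have the required group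
    ([surface_group]): its edges generate ([edge_generation]), and all permutations that satisfy the
    boundary relation are realized by the monodromy of a covering ([monodromy]). *)

Local Open Scope group_scope.

(** * Powers with integer exponents *)

Section zpower.
Context {G : groupType}.
Implicit Types (x y : G) (m n : int).

Definition zpow x n : G :=
  match n with Posz k => x ^+ k | Negz k => x ^- k.+1 end.

Lemma zpow0 x : zpow x 0 = 1. Proof. by []. Qed.
Lemma zpow1 x : zpow x 1 = x. Proof. by []. Qed.
Lemma zpowN1 x : zpow x (-1)%R = x^-1. Proof. by []. Qed.
Lemma zpow_nat x (k : nat) : zpow x k = x ^+ k. Proof. by []. Qed.
Lemma zpow_natN x (k : nat) : zpow x (- k%:Z)%R = x ^- k.
Proof. by case: k => [|k]; rewrite ?oppr0 /= ?expg0 ?invg1. Qed.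

Lemma zpowS x n : zpow x (n + 1)%R = zpow x n * x.
Proof.
case: n => k.
  by rewrite (_ : (Posz k + 1)%R = Posz k.+1) /= ?expgSr//; lia.
case: k => [|k]; first by rewrite /= expg1 mulVg.
rewrite (_ : (Negz k.+1 + 1)%R = Negz k) /=; last lia.
by rewrite (expgS x k.+1) invgM mulgVK.
Qed.

Lemma zpowB1 x n : zpow x (n - 1)%R = zpow x n * x^-1.
Proof. by rewrite -{2}(GRing.subrK 1%R n) zpowS mulgK. Qed.

Lemma zpowD x m n : zpow x (m + n)%R = zpow x m * zpow x n.
Proof.
elim/int_rect: n => [|n IH|n IH]; first by rewrite GRing.addr0 mulg1.
  by rewrite -addn1 PoszD GRing.addrA !zpowS IH mulgA.
by rewrite -addn1 PoszD GRing.opprD GRing.addrA !zpowB1 IH mulgA.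
Qed.

Lemma zpowN x n : zpow x (- n)%R = (zpow x n)^-1.
Proof. by apply: (mulgI (zpow x n)); rewrite -zpowD GRing.subrr mulgV. Qed.

Lemma zpowV x n : zpow x^-1 n = (zpow x n)^-1.
Proof. by case: n => k /=; rewrite expVgn. Qed.
End zpower.

Lemma zpow_morph (G H : groupType) (f : G -> H) (x : G) n :
  {morph f : x y / x * y} -> f (zpow x n) = zpow (f x) n.
Proof.
move=> fM; have f1 : f 1 = 1 by apply: (mulgI (f 1)); rewrite -fM !mulg1.
elim/int_rect: n => [|n IH|n IH]; first by rewrite f1.
  by rewrite -addn1 PoszD !zpowS fM IH.
rewrite -addn1 PoszD GRing.opprD !zpowB1 fM IH; congr (_ * _).
by apply: (mulIg (f x)); rewrite -fM !mulVg f1.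
Qed.

(* Letter 4j+r stands for a_j, b_j, a_j^-1, b_j^-1 (r = 0, 1, 2, 3), as in the
   boundary word of the polygon. *)
Definition linv (i : nat) : nat := if i %% 4 < 2 then i + 2 else i - 2.

Lemma linvP i : linv i %/ 4 = i %/ 4 /\ linv i %% 4 = (i %% 4 + 2) %% 4.
Proof. by rewrite /linv; case: ifP; lia. Qed.
Lemma linvK : involutive linv.
Proof. by move=> i; have := linvP (linv i); have := linvP i; lia. Qed.
Lemma linv_neq i : linv i <> i. Proof. by have := linvP i; lia. Qed.
Lemma linv_range lo k i : lo %% 4 = 0 ->
  (lo <= linv i < lo + 4 * k) = (lo <= i < lo + 4 * k).
Proof. by have := linvP i; lia. Qed.

(** * Free groups as sets of reduced words *)

Definition reduced : seq nat -> bool := sorted (fun x y => y != linv x).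

Definition push (x : nat) (s : seq nat) : seq nat :=
  if s is y :: s' then if y == linv x then s' else x :: s else [:: x].

Lemma push_reduced x s : reduced s -> reduced (push x s).
Proof.
case: s => //= y s; case: ifP => [_|yx]; last by rewrite /= yx.
exact: path_sorted.
Qed.

(** The letters act on reduced words by permutations. The group law [foldr push] and its
    associativity follow from this action, with no comparison of different orders of
    cancellation. *)
Lemma pushK x s : reduced s -> push x (push (linv x) s) = s.
Proof.
case: s => [|y s] /=; first by rewrite eqxx.
rewrite linvK; case: eqP => [->|_ _] /=; last by rewrite eqxx.
by case: s => //= z s /andP[/negbTE ->].
Qed.

Lemma foldr_push_reduced s t : reduced t -> reduced (foldr push t s).
Proof. by move=> rt; elim: s => //= x s; exact: push_reduced. Qed.

Lemma foldr_push x s t : reduced t -> 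
  foldr push t (push x s) = push x (foldr push t s).
Proof.
move=> rt; case: s => //= y s; case: eqP => //= ->.
by rewrite pushK // foldr_push_reduced.
Qed.

Lemma foldr_pushA s t u : reduced u ->
  foldr push (foldr push u t) s = foldr push u (foldr push t s).
Proof. by move=> ru; elim: s => //= x s ->; rewrite foldr_push. Qed.

Lemma foldr_push_cat s t : reduced (s ++ t) -> foldr push t s = s ++ t.
Proof.
elim: s => //= x s IH rst; rewrite IH; last exact: path_sorted rst.
by case: (s ++ t) rst => //= y u /andP[/negbTE ->].
Qed.

Definition invw (s : seq nat) : seq nat := rev (map linv s).

Lemma invwK : involutive invw.
Proof. by move=> s; rewrite /invw map_rev revK mapK //; exact: linvK. Qed.

Lemma invw_reduced s : reduced s -> reduced (invw s).
Proof.
rewrite /reduced /invw rev_sorted sorted_map; apply: sub_sorted => x y /=.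
by rewrite linvK eq_sym; apply: contraNneq => ->.
Qed.

Lemma foldr_push_invw s : reduced s -> foldr push s (invw s) = [::].
Proof.
elim: s => //= x s IH rs; rewrite /invw /= rev_cons foldr_rcons /= linvK eqxx.
by apply: IH; exact: path_sorted rs.
Qed.

(** One free group of countable rank serves for both sides of the amalgam; each side is singled out
    by a range of letters. *)
Record fg := Fg { fgw :> seq nat ; fg_reduced : reduced fgw }.
HB.instance Definition _ := [isSub for fgw].
HB.instance Definition _ := [Choice of fg by <:].

Definition fg1 := @Fg [::] isT.
Definition fgmul (x y : fg) := Fg (foldr_push_reduced x (fg_reduced y)).
Definition fginv (x : fg) := Fg (invw_reduced (fg_reduced x)).

Lemma fgmulA : associative fgmul.
Proof. by move=> x y z; apply: val_inj; rewrite /= foldr_pushA // fg_reduced. Qed.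
Lemma fgmul1 : left_id fg1 fgmul. Proof. by move=> x; apply: val_inj. Qed.
Lemma fgmulr1 : right_id fg1 fgmul.
Proof.
move=> x; apply: val_inj; rewrite /= foldr_push_cat ?cats0 //.
exact: fg_reduced.
Qed.
Lemma fgmulV : left_inverse fg1 fginv fgmul.
Proof. by move=> x; apply: val_inj; rewrite /= foldr_push_invw // fg_reduced. Qed.
Lemma fgmulrV : right_inverse fg1 fginv fgmul.
Proof.
move=> x; apply: val_inj => /=; have /= := foldr_push_invw (fg_reduced (fginv x)).
by rewrite invwK.
Qed.

HB.instance Definition _ := isGroup.Build fg
  fgmulA fgmul1 fgmulr1 fgmulV fgmulrV.

Definition letter (i : nat) : fg := @Fg [:: i] isT.

Lemma fgM_cat (x y : fg) : reduced (x ++ y) -> (x * y : fg) = x ++ y :> seq nat.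
Proof. exact: foldr_push_cat. Qed.

Lemma letterV i : (letter i)^-1 = letter (linv i).
Proof. exact: val_inj. Qed.

(** A step in the Cayley tree leads away from the root or back towards it. Jumps of functions of
    words are located edge by edge through this dichotomy. *)
Lemma fgM_letter (y : fg) t :
  (reduced (rcons y t) /\ (y * letter t : fg) = rcons y t :> seq nat) \/
  fgw y = rcons (y * letter t : fg) (linv t).
Proof.
have rcE s x u : reduced (rcons (rcons s x) u) = reduced (rcons s x) && (u != linv x).
  by case: s => [|z s] /=; rewrite ?andbT // !rcons_path last_rcons.
case: y; case/lastP => [|s x] rs; first by left.
have [tx|tx] := eqVneq t (linv x); last first.
  have r2 : reduced (rcons (rcons s x) t) by rewrite rcE rs tx.
  by left; split=> //; rewrite fgM_cat /= cats1.
right; rewrite /= foldr_rcons tx /= eqxx linvK foldr_push_cat cats0 //.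
by move: rs; rewrite -cats1; case/cat_sorted2.
Qed.

Lemma size_fgM_letter (y : fg) t :
  size (y * letter t : fg) <= (size y).+1 /\ size y <= (size (y * letter t : fg)).+1.
Proof.
by case: (fgM_letter y t) => [[_ ->]|->]; rewrite size_rcons; lia.
Qed.

Definition wd (s : seq nat) : fg := \prod_(i <- s) letter i.

Lemma wd_cat s t : wd (s ++ t) = wd s * wd t.
Proof. by rewrite /wd big_cat. Qed.
Lemma wd_cons i s : wd (i :: s) = letter i * wd s.
Proof. by rewrite /wd big_cons. Qed.
Lemma wd_rcons i s : wd (rcons s i) = wd s * letter i.
Proof. by rewrite -cats1 wd_cat /wd big_seq1. Qed.

Lemma fgw_wd s : reduced s -> wd s = s :> seq nat.
Proof.
elim: s => [|x s IH] rs; first by rewrite /wd big_nil.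
have ws := IH (path_sorted rs).
by rewrite wd_cons fgM_cat /= ws.
Qed.

Lemma wdK (x : fg) : wd x = x.
Proof. by apply: val_inj; rewrite /= fgw_wd // fg_reduced. Qed.

Lemma wd_invw s : wd (invw s) = (wd s)^-1.
Proof.
elim: s => [|x s IH]; first by rewrite /invw /wd !big_nil invg1.
by rewrite /invw /= rev_cons wd_rcons wd_cons invgM letterV -IH.
Qed.

Section evaluation.
Context (G : groupType) (E : nat -> G) (EV : forall i, E (linv i) = (E i)^-1).

Definition ev (x : fg) : G := \prod_(i <- fgw x) E i.

Lemma evM : {morph ev : x y / x * y}.
Proof.
move=> [s rs] [t rt]; rewrite /ev /=; elim: s {rs} => [|x s IH].
  by rewrite big_nil mul1g.
rewrite big_cons -mulgA -IH /=; case: (foldr push t s) => [|y u] /=.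
  by rewrite big_seq1 big_nil mulg1.
by case: eqP => [->|_]; rewrite !big_cons // EV mulgA mulgV mul1g.
Qed.

Lemma ev1 : ev 1 = 1. Proof. by rewrite /ev big_nil. Qed.
Lemma evV x : ev x^-1 = (ev x)^-1.
Proof. by apply: (mulgI (ev x)); rewrite -evM !mulgV ev1. Qed.
Lemma ev_letter i : ev (letter i) = E i. Proof. by rewrite /ev big_seq1. Qed.
Lemma ev_zpow x n : ev (zpow x n) = zpow (ev x) n.
Proof. by apply: zpow_morph; exact: evM. Qed.
Lemma ev_wd s : ev (wd s) = \prod_(i <- s) E i.
Proof.
elim: s => [|i s IH]; first by rewrite /wd !big_nil ev1.
by rewrite wd_cons evM ev_letter big_cons IH.
Qed.
End evaluation.

(** * The boundary word of a subsurface and the ends of its tree *)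

Definition side (lo hi : nat) (x : fg) : bool := all (fun i => lo <= i < hi) x.

Section boundary_word.
Context (lo k : nat) (lo4 : lo %% 4 = 0) (k0 : 0 < k).
Local Notation hi := (lo + 4 * k).
Local Notation rng i := (lo <= i < hi).

Definition bword : seq nat := iota lo (4 * k).
Definition bdry : fg := wd bword.

(* Cyclic successor in the boundary word; [rot i = scc (linv i)] is then the
   letter following [i] in the cyclic order around a vertex of the tree. *)
Definition scc (i : nat) := if i.+1 == hi then lo else i.+1.
Definition rot (i : nat) := scc (linv i).

Lemma scc_rng i : rng i -> rng (scc i).
Proof. by rewrite /scc; case: eqP; lia. Qed.
Lemma rot_rng i : rng i -> rng (rot i).
Proof. by rewrite -(linv_range k i lo4) => /scc_rng. Qed.
Lemma scc_neq i : rng i -> scc i != linv i.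
Proof. by have := linvP i; rewrite /scc; case: (i.+1 =P hi); lia. Qed.
Lemma scc_last : scc hi.-1 = lo.
Proof. by rewrite /scc ifT //; apply/eqP; lia. Qed.
Lemma scc_inj i j : rng i -> rng j -> scc i = scc j -> i = j.
Proof. by rewrite /scc; case: eqP; case: eqP; lia. Qed.

Lemma all_invw s : all (fun i => rng i) (invw s) = all (fun i => rng i) s.
Proof.
by rewrite /invw all_rev all_map; apply: eq_all => i /=; rewrite linv_range.
Qed.

Lemma all_push i s : rng i -> all (fun i => rng i) s -> all (fun i => rng i) (push i s).
Proof. by move=> ri; case: s => [|j s] /=; [rewrite ri | case: ifP => _ /andP[rj rs] //=; rewrite ri rj]. Qed.

Lemma sideM x y : side lo hi x -> side lo hi y -> side lo hi (x * y).
Proof.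
rewrite /side /=; case: x => s rs /=; elim: s {rs} => //= i s IH /andP[ri rs] ry.
by apply: all_push => //; exact: IH.
Qed.
Lemma side1 : side lo hi 1. Proof. by []. Qed.
Lemma sideV x : side lo hi x -> side lo hi x^-1.
Proof. by rewrite /side /= all_invw. Qed.
Lemma side_letter i : side lo hi (letter i) = rng i.
Proof. by rewrite /side /= andbT. Qed.
Lemma sideX x n : side lo hi x -> side lo hi (x ^+ n).
Proof. by move=> sx; elim: n => [|n IH]; rewrite ?side1 // expgS sideM. Qed.
Lemma side_zpow x n : side lo hi x -> side lo hi (zpow x n).
Proof. by move=> sx; case: n => n /=; [exact: sideX | apply/sideV/sideX]. Qed.
Lemma side_wd s : all (fun i => rng i) s -> side lo hi (wd s).
Proof.
elim: s => [|i s IH]; first by rewrite /wd big_nil.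
by case/andP => ri rs; rewrite wd_cons sideM ?side_letter // IH.
Qed.
Lemma all_bword : all (fun i => rng i) bword.
Proof. by apply/allP => i; rewrite mem_iota. Qed.
Lemma side_bdry : side lo hi bdry.
Proof. exact: side_wd all_bword. Qed.

Definition chain : seq nat -> bool := sorted (fun x y => y == scc x).

(** Successive letters of the boundary word are never inverse to each other, so its powers are
    reduced as they stand and their lengths can be read off. *)
Lemma chain_reduced s : all (fun i => rng i) s -> chain s -> reduced s.
Proof.
case: s => //= x s; elim: s x => //= y s IH x /andP[rx /andP[ry rs]] /andP[/eqP -> ch].
rewrite scc_neq //=; have rsx := scc_rng rx.
by apply: IH => //; rewrite ?rsx ?rs //; move: ch; rewrite ?rsx.
Qed.

Lemma chain_iota p : p <= 4 * k -> chain (iota lo p).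
Proof.
move=> pk; rewrite /chain.
have: forall n m, lo <= m -> m + n < hi -> path (fun x y => y == scc x) m (iota m.+1 n).
  elim=> //= n IH m lm mn; apply/andP; split; last by apply: IH; lia.
  by rewrite /scc; case: (m.+1 =P hi) => ?; apply/eqP; lia.
by case: p pk => //= p pk; apply; lia.
Qed.

(* [m] turns of the boundary word followed by its first [p] letters *)
Definition turns (m p : nat) : seq nat := flatten (nseq m bword) ++ iota lo p.

Lemma all_turns m p : p <= 4 * k -> all (fun i => rng i) (turns m p).
Proof.
move=> pk; rewrite /turns all_cat; apply/andP; split.
  by elim: m => //= m IH; rewrite all_cat all_bword.
by apply/allP => i; rewrite mem_iota; lia.
Qed.

Lemma last_bword x : last x bword = hi.-1.
Proof.
rewrite /bword; have -> : (4 * k = (4 * k).-1.+1)%N by lia.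
by rewrite -addn1 iotaD cats1 last_rcons; lia.
Qed.

Lemma chain_turns m p : p <= 4 * k -> chain (turns m p).
Proof.
move=> pk; rewrite /turns; elim: m => [|m IH]; first exact: chain_iota.
rewrite /= -catA /chain; have bE : bword = lo :: behead bword by rewrite /bword; case: k k0.
have := chain_iota (leqnn (4 * k)); rewrite -/bword /chain.
move: IH; rewrite /chain; set r := _ ++ iota lo p => cr; rewrite bE /= => cb.
rewrite cat_path cb /=.
have rE : r = [::] \/ exists r', r = lo :: r'.
  rewrite /r; case: (m) => [|m'] /=; first by case: (p) => [|p'] /=; [left|right; eexists].
  by rewrite bE; right; eexists.
case: rE cr => [->|[r' ->]] //= ->; rewrite andbT.
have : last lo (behead bword) = hi.-1 by rewrite -(last_bword lo) {2}bE.
by move=> ->; rewrite scc_last.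
Qed.

Lemma turns_reduced m p : p <= 4 * k -> reduced (turns m p).
Proof. by move=> pk; apply: chain_reduced; [exact: all_turns | exact: chain_turns]. Qed.

Lemma wd_turns m p : wd (turns m p) = bdry ^+ m * wd (iota lo p).
Proof.
rewrite wd_cat; congr (_ * _); elim: m => [|m IH] /=; first by rewrite /wd big_nil.
by rewrite wd_cat IH expgS.
Qed.

Lemma size_turns m p : size (turns m p) = (4 * k * m + p)%N.
Proof.
by rewrite size_cat size_iota; congr (_ + _); elim: m => [|m IH]; rewrite /= ?muln0 // size_cat IH size_iota mulnS.
Qed.

Lemma fgw_bdryX m : bdry ^+ m = turns m 0 :> seq nat.
Proof.
have := wd_turns m 0; rewrite /= {2}/wd big_nil mulg1 => <-.
by rewrite fgw_wd // turns_reduced.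
Qed.

Lemma size_bdry_zpow n : size (zpow bdry n) = (4 * k * `|n|)%N.
Proof.
case: n => n; rewrite /= -/(fgw _).
  by rewrite fgw_bdryX size_turns addn0.
by rewrite /invw size_rev size_map fgw_bdryX size_turns addn0.
Qed.

Lemma bdry_zpow_inj m n : zpow bdry m = zpow bdry n -> m = n.
Proof.
move=> mn; have : size (zpow bdry (m - n)%R) = 0 by rewrite zpowD zpowN mn mulgV.
by rewrite size_bdry_zpow; lia.
Qed.

Lemma last_turns x m p : 0 < m -> p <= 4 * k -> rng (last x (turns m p)) /\
  scc (last x (turns m p)) = if p == (4 * k)%N then lo else lo + p.
Proof.
move=> m0 pk; rewrite /turns last_cat; case: p pk => [|p] pk.
  have -> : last x (flatten (nseq m bword)) = hi.-1.
    case: m m0 => // m _; elim: m x => [|m IH] x; first by rewrite /= cats0 last_bword.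
    by rewrite -[m.+2]addn1 nseqD flatten_cat last_cat /= cats0 last_bword.
  rewrite scc_last ifF ?addn0; last by apply/eqP; lia.
  by split=> //=; lia.
rewrite -addn1 iotaD cats1 last_rcons /scc.
by case: ((lo + p).+1 =P hi); case: (p + 1 =P (4 * k)%N); lia.
Qed.

(** At the vertex [v] the line of [u] turns from the edge [w] to the next edge in the cyclic order,
    so its two ends lie in neighbouring branches. The excluded case, [v] empty and [rot w = lo], is
    the line of [1], where [u] would be a power of [bdry]. *)
Lemma corner v w (w' := rot w) : all (fun i => rng i) v -> rng w ->
  reduced (rcons v w) -> reduced (rcons v w') -> (v <> [::] \/ w' <> lo) ->
  exists u, [/\ side lo hi u, forall n, u <> zpow bdry n &
    forall m, 0 < m ->
      (exists2 s, u * bdry ^+ m = v ++ w' :: s :> seq nat & m <= (size s).+1) /\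
      (exists2 s, u * bdry ^- m = v ++ w :: s :> seq nat & m <= (size s).+1)].
Proof.
move=> rv rw vw vw' ex; have rw' : rng w' by exact: rot_rng.
have [p pk w'E] : exists2 p, p < 4 * k & w' = lo + p.
  by exists (w' - lo); lia.
have catE s x t : reduced (rcons v x) -> reduced (x :: t) -> s = x :: t -> reduced (v ++ s).
  move=> r1 r2 ->; move: r1 r2; case: (v) => //= a l; rewrite rcons_path cat_path /=.
  by case/andP => -> ->.
have turnsE m : 0 < m -> exists2 s, turns m p = rcons s (linv w) & (size s = 4 * k * m + p - 1)%N.
  move=> m0; have [rl sl] := last_turns 0 m0 (ltnW pk).
  have := size_turns m p; case: (lastP (turns m p)) rl sl => [|s x].
    by move=> _ _ /=; nia.
  rewrite last_rcons size_rcons => rx sx sz; exists s; last by lia.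
  congr rcons; apply: scc_inj => //; first by rewrite linv_range.
  by rewrite sx -/(rot w) -/w' w'E ifF //; apply/eqP; lia.
have bwE m : 0 < m -> exists2 s, invw (turns m p) = w :: s & m <= (size s).+1.
  move=> m0; have [s -> sz] := turnsE m m0; exists (invw s).
    by rewrite /invw map_rcons rev_rcons linvK.
  by rewrite /invw size_rev size_map sz; nia.
have redv : reduced v by case: (v) vw => //= a l; rewrite rcons_path => /andP[].
(* The boundary line is shifted by a prefix of length [p]: at [v] its next letter forward is then
   [lo + p], which is [w'], and its next letter backward is the inverse of the preceding boundary
   letter, which is [w]. *)
pose u := wd v * (wd (iota lo p))^-1.
have fwE m : 0 < m -> exists2 s, u * bdry ^+ m = v ++ w' :: s :> seq nat & m <= (size s).+1.
  case: m => // m _.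
  have bE : bdry = wd (iota lo p) * wd (iota (lo + p) (4 * k - p)).
    by rewrite -wd_cat -iotaD; congr (wd (iota _ _)); lia.
  pose t := iota (lo + p) (4 * k - p) ++ flatten (nseq m bword).
  have uE : u * bdry ^+ m.+1 = wd v * wd t.
    rewrite expgS {1}bE /u -!mulgA mulKg wd_cat; congr (_ * (_ * _)).
    elim: (m) => [|m' IH] /=; first by rewrite /wd big_nil.
    by rewrite wd_cat expgS IH.
  have rt : reduced t.
    have := turns_reduced m.+1 (leq0n _); rewrite /turns /= cats0.
    rewrite {1}(_ : bword = iota lo p ++ iota (lo + p) (4 * k - p)).
      by rewrite -catA => /cat_sorted2 [_].
    by rewrite -iotaD; congr iota; lia.
  have [t' t'E] : exists t', t = w' :: t'.
    rewrite /t (_ : (4 * k - p = (4 * k - p).-1.+1)%N); last by lia.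
    by rewrite w'E /=; eexists.
  have tsz : size t = (4 * k - p + 4 * k * m)%N.
    rewrite size_cat size_iota; congr addn.
    by have := size_turns m 0; rewrite /turns /= cats0 addn0.
  exists t'; last by have := tsz; rewrite t'E /=; nia.
  rewrite uE fgM_cat fgw_wd // fgw_wd // ?t'E //.
  by apply: (catE _ w' t'); rewrite // -t'E.
have bwE' m : 0 < m -> exists2 s, u * bdry ^- m = v ++ w :: s :> seq nat & m <= (size s).+1.
  move=> m0; have [s sE sz] := bwE m m0; exists s => //.
  rewrite /u -mulgA -invgM -wd_turns -wd_invw sE.
  have rs : reduced (w :: s) by rewrite -sE invw_reduced // turns_reduced // ltnW.
  rewrite fgM_cat fgw_wd // fgw_wd //.
  exact: (catE _ w s).
exists u; split.
- rewrite sideM ?side_wd // sideV // side_wd //; apply/allP => i; rewrite mem_iota; lia.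
- move=> n un.
  have usz m : u * bdry ^+ m <> 1 \/ m = 0.
    case: m => [|m]; [by right|left] => /(congr1 fgw) /(congr1 size).
    by have [s -> _] := fwE m.+1 isT; rewrite size_cat /= addnS.
  have usz' m : u * bdry ^- m <> 1 \/ m = 0.
    case: m => [|m]; [by right|left] => /(congr1 fgw) /(congr1 size).
    by have [s -> _] := bwE' m.+1 isT; rewrite size_cat /= addnS.
  have n0 : n = 0%Z.
    case: n un => n un.
      by have := usz' n; rewrite un /= mulgV => -[|->].
    by have := usz n.+1; rewrite un /= mulVg => -[].
  move: un; rewrite n0 zpow0 => u1.
  have [p0|p0] := posnP p.
    case: ex => [vn|]; last by rewrite w'E p0 addn0.
    move/(congr1 fgw)/(congr1 size): u1.
    by rewrite /u p0 {2}/wd big_nil invg1 mulg1 fgw_wd //; case: (v) vn.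
  have rp : reduced (iota lo p) by have := turns_reduced 0 (ltnW pk); rewrite /turns.
  have iE : invw (iota lo p) = w :: invw (iota lo p.-1).
    rewrite -{1}(prednK p0) -addn1 iotaD cats1 /invw map_rcons rev_rcons; congr cons.
    apply: (can_inj linvK); rewrite linvK; apply: scc_inj; rewrite ?linv_range //; first lia.
    by rewrite -/(rot w) -/w' w'E /scc ifF; [lia | apply/eqP; lia].
  move/(congr1 fgw)/(congr1 size): u1; rewrite /u -wd_invw fgM_cat.
    by rewrite fgw_wd // fgw_wd ?invw_reduced // iE size_cat addnS.
  rewrite fgw_wd // fgw_wd ?invw_reduced //.
  by apply: (catE _ w _ _ _ iE); rewrite // -iE invw_reduced.
- by move=> m m0; split; [exact: fwE | exact: bwE'].
Qed.

(* The letters in their cyclic order around a vertex *)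
Definition around i := lo + 4 * (i %/ 4) + (4 - i %% 4) %% 4.

Lemma around_onto z : rng z -> exists2 i, i < 4 * k & z = around i.
Proof.
move=> rz; exists (4 * ((z - lo) %/ 4) + (4 - (z - lo) %% 4) %% 4);
  rewrite /around; lia.
Qed.
Lemma around_rng i : i < 4 * k -> rng (around i). Proof. by rewrite /around; lia. Qed.
Lemma around_rot i : i.+1 < 4 * k -> rot (around i) = around i.+1.
Proof. by move=> ik; have := linvP (around i); rewrite /rot /scc /around; case: eqP; lia. Qed.
Lemma around_inj i j : around i = around j -> i = j.
Proof. by rewrite /around; lia. Qed.
Lemma around_last : rot (around (4 * k).-1) = around 0.
Proof. by have := linvP (around (4 * k).-1); rewrite /rot /scc /around; case: eqP; lia. Qed.

(** A cycle with one link removed is still connected. *)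
Lemma rot_line (h : nat -> int) :
  (forall z, rng z -> rot z <> lo -> h z = h (rot z)) ->
  forall z z', rng z -> rng z' -> h z = h z'.
Proof.
move=> hrot; suff base i : i < 4 * k -> h (around i) = h (around 0).
  by move=> z z' /around_onto[i ik ->] /around_onto[j jk ->]; rewrite !base.
elim: i => // i IH ik; rewrite -around_rot // -hrot ?IH //; try lia.
  by apply: around_rng; lia.
by rewrite around_rot // /around; lia.
Qed.

(** A cycle with one vertex removed is still connected. The base point of the comparison is
    [around 0], or the last letter when [around 0] is the one removed. *)
Lemma rot_cycle (h : nat -> int) (b : nat) : rng b ->
  (forall z, rng z -> z <> b -> rot z <> b -> h z = h (rot z)) ->
  forall z z', rng z -> rng z' -> z <> b -> z' <> b -> h z = h z'.
Proof.
case/around_onto => p pk -> {b} hrot.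
have around_neq i : i < 4 * k -> i <> p -> around i <> around p.
  by move=> _ ip /around_inj.
suff base z : rng z -> z <> around p -> h z = h (around (if p is 0 then (4 * k).-1 else 0)).
  by move=> z z' rz rz' zp zp'; rewrite !base.
move=> /around_onto[i ik ->] ip.
have {}ip : i <> p by move=> ip'; rewrite ip' in ip.
have step j : j.+1 < 4 * k -> j <> p -> j.+1 <> p -> h (around j) = h (around j.+1).
  move=> jk jp jp'; rewrite -around_rot //; apply: hrot.
  - by apply: around_rng; exact: ltnW.
  - by apply: around_neq => //; exact: ltnW.
  - by rewrite around_rot //; apply: around_neq.
have up j d : j + d < 4 * k -> (p < j) || (j + d < p) -> h (around j) = h (around (j + d)).
  elim: d => [|d IH] jd pj; first by rewrite addn0.
  by rewrite IH ?addnS; [apply: step | | ]; lia.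
have [ip'|pi] := ltnP i p.
  case: (p) ip' up => // p' ip' up; rewrite -(up 0 i) //; lia.
have pi' : p < i by lia.
have -> : h (around i) = h (around (4 * k).-1).
  have iE : (4 * k).-1 = i + ((4 * k).-1 - i) by lia.
  by rewrite iE; apply: up; lia.
case: (p) pi' around_neq hrot => // p' pi' around_neq hrot.
rewrite -around_last; apply: hrot.
- by apply: around_rng; lia.
- by apply: around_neq; lia.
- by rewrite around_last; apply: around_neq; lia.
Qed.

(* The boundary lines join consecutive branches at every vertex of the tree, so
   a function without jumps along them has the same value in all branches. *)
Lemma eventually_const (f : fg -> int) (M : nat) :
  (forall y t, side lo hi y -> rng t -> M <= size y ->
     M <= size (y * letter t : fg) -> f (y * letter t) = f y) ->
  (forall u, side lo hi u -> (forall n, u <> zpow bdry n) ->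
     exists N, forall m, N <= m -> f (u * bdry ^+ m) = f (u * bdry ^- m)) ->
  exists r, forall y, side lo hi y -> M <= size y -> f y = r.
Proof.
move=> fM fu.
have ext v s : reduced (v ++ s) -> all (fun i => rng i) (v ++ s) -> M <= size v ->
    f (wd (v ++ s)) = f (wd v).
  elim/last_ind: s => [|s x IH]; first by rewrite cats0.
  rewrite -rcons_cat -cats1 => rs; rewrite all_cat => /andP[rvs /=]; rewrite andbT => rx Mv.
  have rs' : reduced (v ++ s) by case/cat_sorted2: rs.
  rewrite wd_cat {2}/wd big_seq1 fM ?IH //; first exact: side_wd.
    by rewrite fgw_wd // size_cat (leq_trans Mv) ?leq_addr.
  by rewrite fgM_cat fgw_wd // !size_cat; lia.
have step v : all (fun i => rng i) v -> reduced v ->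
    (forall z, rng z -> reduced (rcons v z) -> exists r, forall s,
       reduced (v ++ z :: s) -> all (fun i => rng i) s -> M <= size (v ++ z :: s) ->
       f (wd (v ++ z :: s)) = r) ->
    exists r, forall s, s <> [::] -> 
       reduced (v ++ s) -> all (fun i => rng i) s -> M <= size (v ++ s) ->
       f (wd (v ++ s)) = r.
  move=> rv redv child.
  have /choice[h hP] : forall z, exists r, rng z -> reduced (rcons v z) -> forall s,
       reduced (v ++ z :: s) -> all (fun i => rng i) s -> M <= size (v ++ z :: s) ->
       f (wd (v ++ z :: s)) = r.
    move=> z; have [rz|] := boolP (rng z); last by exists 0%R.
    have [rvz|] := boolP (reduced (rcons v z)); last by exists 0%R.
    by have [r rP] := child z rz rvz; exists r.
  have hrot z : rng z -> reduced (rcons v z) -> reduced (rcons v (rot z)) ->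
      (v <> [::] \/ rot z <> lo) -> h z = h (rot z).
    move=> rz rvz rvz' ex.
    have [u [su uC uP]] := corner rv rz rvz rvz' ex.
    have [N NP] := fu u su uC; pose m := maxn N (M + 1).
    have [[s sE sM] [s' s'E s'M]] := uP m ltac:(rewrite /m; lia).
    have e1 : h z = f (u * bdry ^- m).
      have red' := fg_reduced (u * bdry ^- m); rewrite s'E in red'.
      rewrite -(hP _ rz rvz s') // -?s'E ?wdK //.
        have := sideM su (sideV (sideX m side_bdry)); rewrite /side s'E all_cat /=.
        by case/and3P.
      by rewrite s'E size_cat /=; move: s'M; rewrite /m; lia.
    have e2 : h (rot z) = f (u * bdry ^+ m).
      have red' := fg_reduced (u * bdry ^+ m); rewrite sE in red'.
      rewrite -(hP _ (rot_rng rz) rvz' s) // -?sE ?wdK //.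
        have := sideM su (sideX m side_bdry); rewrite /side sE all_cat /=.
        by case/and3P.
      by rewrite sE size_cat /=; move: sM; rewrite /m; lia.
    by rewrite e1 e2 NP // /m; lia.
  have redE z : reduced (rcons v z) = if v is x :: v' then z != linv (last x v') else true.
    by case: (v) redv => //= x v' redv; rewrite rcons_path redv.
  (* At a nonempty word the backtracking letter is missing from the cycle. At the empty word every
     letter occurs, but the link into [lo] is missing, as it belongs to the line of [1]. *)
  pose b := if v is x :: v' then linv (last x v') else lo.
  have hE z z' : rng z -> rng z' -> reduced (rcons v z) -> reduced (rcons v z') -> h z = h z'.
    case: v rv redE @b {child hP ext redv} hrot => [|x v'] rv redE b hrot rz rz' vz vz'.
      by apply: rot_line => // y ry yb; apply: hrot => //; right.
    have rb : rng b by rewrite /b linv_range //; apply: (allP rv); rewrite mem_last.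
    rewrite redE in vz; rewrite redE in vz'.
    apply: (rot_cycle rb _ rz rz' (elimN eqP vz) (elimN eqP vz')) => y ry /eqP yb /eqP yb'.
    by apply: hrot => //; rewrite ?redE //; left.
  have redv1 z s : reduced (v ++ z :: s) -> reduced (rcons v z).
    by rewrite -cat_rcons => /cat_sorted2[].
  have [[z0 [s0 [r0 a0 M0]]]|no] := pselect (exists z s, [/\ reduced (v ++ z :: s),
       all (fun i => rng i) (z :: s) & M <= size (v ++ z :: s)]).
    exists (h z0) => -[//|z s] _ rs as' Ms; have [/= /andP[rz als]] := (as').
    move: a0 => /= /andP[rz0 als0].
    by rewrite (hP z) ?(redv1 z s) //; apply: hE; rewrite ?(redv1 z s) ?(redv1 z0 s0).
  exists 0%R => -[//|z s] _ rs als Ms; case: no; by exists z, s.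
(* Descending induction on the depth: beyond length [M] a branch is constant by [ext], and at a
   shorter word the branches are joined by [step]. *)
have rec d v : M <= size v + d -> all (fun i => rng i) v -> reduced v ->
    exists r, forall s, reduced (v ++ s) -> all (fun i => rng i) s -> M <= size (v ++ s) ->
       f (wd (v ++ s)) = r.
  elim: d v => [|d IH] v Mv rv redv.
    rewrite addn0 in Mv; exists (f (wd v)) => s rs als _.
    by apply: ext => //; rewrite all_cat rv.
  have [Mv'|vM] := leqP M (size v); first by apply: IH => //; lia.
  have [z rz vz|r rP] := step v rv redv.
    have [||r rP] := IH (rcons v z) _ _ vz; first by rewrite size_rcons; lia.
      by rewrite all_rcons rz.
    by exists r => s; rewrite -cat_rcons; exact: rP.
  exists r => s rs als Ms; apply: rP => // s0.
  by move: Ms; rewrite s0 cats0; lia.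
have [//|r rP] := @rec M [::] _ isT isT.
exists r => y sy My; rewrite -(wdK y); apply: (rP (fgw y)) => //.
exact: fg_reduced.
Qed.
End boundary_word.

(** * Half-trees bounded by the axis of a generator *)

Section half_tree.
Context (x z : nat) (zx : z != x) (zlx : z != linv x).

Definition on_axis (y : fg) := exists n, y = zpow (letter x) n.

(* The half of the tree beyond the [z]-edges issuing from the axis of [x]; the
   axis of the curve dual to those edges is the boundary of this half. *)
Definition htree (s : seq nat) : bool :=
  ohead (drop (find (fun l => l \notin [:: x; linv x]) s) s) == Some z.

Lemma htree_cons l s : htree (l :: s) = 
  if l \in [:: x; linv x] then htree s else l == z.
Proof. by rewrite /htree [find _ _]/=; case: (l \in _). Qed.

Lemma htree_nil : htree [::] = false. Proof. by []. Qed.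

Lemma htree_push l s : l \in [:: x; linv x] -> htree (push l s) = htree s.
Proof.
move=> lx; case: s => [|y s] /=; first by rewrite htree_cons lx.
case: eqP => [->|_]; rewrite !htree_cons ?lx // ifT //.
by move: lx; rewrite !inE => /orP[] /eqP ->; rewrite ?linvK eqxx ?orbT.
Qed.

Lemma htree_zpowM n (y : fg) : htree (zpow (letter x) n * y) = htree y.
Proof.
have h1 (u : fg) : htree (letter x * u) = htree u by apply: htree_push; rewrite inE eqxx.
elim/int_rect: n => [|n IH|n IH]; first by rewrite mul1g.
  by rewrite zpow_nat expgS -mulgA h1.
by rewrite -(h1 (_ * y)) !zpow_natN expgSr invgM -mulgA mulVKg -zpow_natN.
Qed.

Lemma htree_axisM y : on_axis y -> htree (y * letter z).
Proof.
case=> n ->; rewrite htree_zpowM /= htree_cons ifF ?eqxx //.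
by apply/negbTE; rewrite !inE negb_or zx.
Qed.

Lemma on_axis_letter y l : l \in [:: x; linv x] -> on_axis y -> on_axis (y * letter l).
Proof.
rewrite !inE => /orP[] /eqP -> [n ->].
  by exists (n + 1)%R; rewrite zpowS.
by exists (n - 1)%R; rewrite zpowB1 letterV.
Qed.

Lemma on_axis_letterE y l : l \in [:: x; linv x] -> on_axis (y * letter l) -> on_axis y.
Proof.
move=> lx; rewrite -{2}(mulgK (letter l) y) letterV; apply: on_axis_letter.
by move: lx; rewrite !inE => /orP[] /eqP ->; rewrite ?linvK eqxx ?orbT.
Qed.

Lemma htree_rcons s t : htree (rcons s t) != htree s ->
  on_axis (wd s) /\ t = z.
Proof.
elim: s => [|l s IH].
  rewrite /= htree_cons htree_nil; case: ifP => _ //; case: (t =P z) => [-> _|//].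
  by split=> //; exists 0%R; rewrite /wd big_nil.
rewrite rcons_cons !htree_cons; case: ifP => [lx /IH[[n sn] ->]|_]; last by rewrite eqxx.
split=> //; move: lx; rewrite wd_cons sn !inE => /orP[] /eqP ->.
  by exists (1 + n)%R; rewrite zpowD.
by exists (-1 + n)%R; rewrite zpowD zpowN1 letterV.
Qed.

Lemma htree_letter (y : fg) t : htree (y * letter t) != htree y ->
  (on_axis y /\ t = z) \/ (on_axis (y * letter t) /\ t = linv z).
Proof.
case: (fgM_letter y t) => [[_ ->] /htree_rcons|yE]; first by rewrite wdK; left.
by rewrite yE eq_sym => /htree_rcons; rewrite wdK => -[yx tz]; right; rewrite -tz linvK.
Qed.

Lemma htree_letter_eq (y : fg) t : t != z -> t != linv z -> 
  htree (y * letter t) = htree y.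
Proof.
move=> /eqP tz /eqP tlz; by have [//|/htree_letter[[_ /tz]|[_ /tlz]]] := eqVneq (htree (y * letter t)) (htree y).
Qed.

Lemma htree_wd_eq (y : fg) s : z \notin s -> linv z \notin s ->
  htree (y * wd s) = htree y.
Proof.
elim/last_ind: s => [|s l IH]; first by rewrite /wd big_nil mulg1.
rewrite !mem_rcons !inE !negb_or => /andP[lz zs] /andP[llz lzs].
by rewrite wd_rcons mulgA htree_letter_eq ?IH // eq_sym.
Qed.

(** Either the path leaves the half-tree at the axis, moves one step along the axis and enters
    again, or none of its three edges issues from the axis in direction [z]. *)
Lemma htree_flip (y : fg) l : l \in [:: x; linv x] ->
  htree (y * wd [:: linv z; l; z]) = htree y.
Proof.
move=> lx; rewrite !wd_cons {1}/wd big_nil mulg1 !mulgA.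
have lzx : linv z != x by apply: contraNneq zlx => <-; rewrite linvK.
have lzlx : linv z != linv x by apply: contraNneq zx => /(can_inj linvK) ->.
have lz : l != z by apply/eqP => lz; move: lx; rewrite lz !inE (negbTE zx) (negbTE zlx).
have llz : l != linv z.
  by apply/eqP => lz'; move: lx; rewrite lz' !inE (negbTE lzx) (negbTE lzlx).
have [ax|nax] := pselect (on_axis (y * letter (linv z))).
  rewrite htree_axisM; last exact: on_axis_letter.
  by rewrite -{1}(mulgK (letter (linv z)) y) letterV linvK htree_axisM.
have e1 : htree (y * letter (linv z)) = htree y.
  have [//|/htree_letter[[_ lz']|[/nax//]]] := eqVneq (htree (y * letter (linv z))) (htree y).
  by have := @linv_neq z; rewrite lz'.
have e2 : htree (y * letter (linv z) * letter l) = htree (y * letter (linv z)).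
  exact: htree_letter_eq.
rewrite -e1 -e2; set y' := y * _ * _.
have [//|/htree_letter[[ax _]|[_ zz]]] := eqVneq (htree (y' * letter z)) (htree y').
  by case: nax; exact: on_axis_letterE ax.
by have := @linv_neq z; rewrite -zz.
Qed.
End half_tree.

Section dual_letters.
Context (lo k : nat) (lo4 : lo %% 4 = 0) (k0 : 0 < k).
Local Notation hi := (lo + 4 * k).

(* The axis of [x] is disjoint from the curve dual to the edges labelled [z]. *)
Definition dual_letter (x : nat) : nat := if x %% 4 == 0 then x + 3 else x + 1.

(** The letters [z] and [linv z] occur in the boundary word only within one commutator, where
    [linv z] and [z] enclose [x] or [linv x]. That piece is handled by [htree_flip], and all other
    letters leave [htree] unchanged. *)
Lemma htree_bdry x (y : fg) : lo <= x < hi -> x %% 4 < 2 ->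
  htree x (dual_letter x) (y * bdry lo k) = htree x (dual_letter x) y.
Proof.
move=> rx x2; pose e := (4 * (x %/ 4))%N; set z := dual_letter x.
have eE : (e %% 4 = 0 /\ e %/ 4 = x %/ 4)%N by rewrite /e; lia.
have zE : z = dual_letter x by [].
have [lz4 lzm] := linvP z; have [lx4 lxm] := linvP x.
have zC : (x %% 4 = 0 /\ z = x + 3 \/ x %% 4 = 1 /\ z = x + 1)%N.
  by rewrite zE /dual_letter; case: (x %% 4 =P 0); lia.
have zx : z != x by lia.
have zlx : z != linv x by lia.
have -> : bdry lo k = wd (iota lo (e - lo)) * wd [:: e; e.+1; e.+2; e.+3] * wd (iota (e + 4) (hi - (e + 4))).
  rewrite /bdry /bword (_ : (4 * k = (e - lo) + (4 + (hi - (e + 4))))%N); last by rewrite /e; lia.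
  rewrite !iotaD (_ : (lo + (e - lo) = e)%N); last by rewrite /e; lia.
  by rewrite !wd_cat mulgA; congr (_ * wd (iota _ _)); rewrite /e; lia.
have z4 : z %/ 4 = x %/ 4 by lia.
rewrite !mulgA htree_wd_eq // ?mem_iota; try lia.
rewrite (_ : htree x z (y * _ * _) = htree x z (y * wd (iota lo (e - lo)))); last first.
  set y' := y * _; have [x0|x1] := x %% 4 =P 0.
    have zE' : z = e.+3 by rewrite /e; lia.
    have xE : x = e by rewrite /e; lia.
    rewrite (wd_cat [:: e] [:: e.+1; e.+2; e.+3]) mulgA.
    rewrite (_ : [:: e.+1; e.+2; e.+3] = [:: linv z; linv x; z]); last by congr [:: _; _; _]; lia.
    rewrite htree_flip // ?inE ?eqxx ?orbT //.
    by rewrite htree_wd_eq // inE; lia.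
  have zE' : z = e.+2 by rewrite /e; lia.
  have xE : x = e.+1 by rewrite /e; lia.
  rewrite (wd_cat [:: e; e.+1; e.+2] [:: e.+3]) mulgA htree_wd_eq // ?inE; try lia.
  rewrite (_ : [:: e; e.+1; e.+2] = [:: linv z; x; z]); last by congr [:: _; _; _]; lia.
  by rewrite htree_flip // inE eqxx.
by rewrite htree_wd_eq // mem_iota; lia.
Qed.
End dual_letters.

(** * Arcs of ends in the free group of the one-holed torus *)

Section square_turn.
Local Notation c := (bdry 0 1).
Local Notation a := (letter 0).

(** In the cyclic order of ends, the words beginning with [a b] form the arc from the positive end
    of the line of [1] to the negative end of the line of [a]. *)
Definition corner_ab (y : fg) : bool := prefix [:: 0; 1]%N (fgw y).

Lemma corner_ab_letter y t : corner_ab (y * letter t) != corner_ab y ->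
  (y = a /\ t = 1%N) \/ (y = wd [:: 0; 1]%N /\ t = 3).
Proof.
have pr s : prefix [:: 0; 1]%N (rcons s t) != prefix [:: 0; 1]%N s -> s = [:: 0] /\ t = 1%N.
  case: s => [|x [|x' s]] /=; rewrite ?prefix0s ?eqxx ?andbF ?andbT //.
  by case: (0 =P x) => //= <-; case: (1%N =P t) => // <-.
rewrite /corner_ab; case: (fgM_letter y t) => [[_ ->] /pr[y0 ->]|yE].
  by left; split=> //; exact: val_inj.
rewrite yE eq_sym => H; right.
have : prefix [:: 0; 1]%N (rcons (y * letter t : fg) (linv t)) != prefix [:: 0; 1]%N (y * letter t : fg) by exact: H.
case: (y * letter t : fg) yE {H} => s rs /= yE.
case: s rs yE => [|x [|x' s]] rs yE /=; rewrite ?prefix0s ?eqxx ?andbF ?andbT //.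
case: (0 =P x) => //= x0; case: (1%N =P linv t) => // t1 _; split.
  by rewrite -(wdK y) yE -x0 -t1.
by rewrite -(linvK t) -t1.
Qed.

(** The arc is entered and left only through the edge from [a] to [a b]. Boundary lines run along
    this edge twice: once on the line of [1] and once on the line of [a]. *)
Lemma corner_ab_bdry y : corner_ab (y * c) != corner_ab y -> y = 1 \/ y = a * c^-1.
Proof.
have -> : c = letter 0 * letter 1 * letter 2 * letter 3.
  by rewrite /bdry /bword /= !wd_cons {1}/wd big_nil mulg1 !mulgA.
rewrite !mulgA => H.
have [e1|/corner_ab_letter[[_ //]|[_ //]]] := eqVneq (corner_ab (y * letter 0)) (corner_ab y).
have [e2|/corner_ab_letter[[ya _]|[_ //]]] :=
  eqVneq (corner_ab (y * letter 0 * letter 1)) (corner_ab (y * letter 0)); last first.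
  by left; apply: (mulIg a); rewrite ya mul1g.
have [e3|/corner_ab_letter[[_ //]|[_ //]]] :=
  eqVneq (corner_ab (y * letter 0 * letter 1 * letter 2)) (corner_ab (y * letter 0 * letter 1)).
right; move: H; rewrite -e1 -e2 -e3 => /corner_ab_letter[[_ //]|[yE _]].
apply: (mulIg (letter 0 * letter 1 * letter 2)); rewrite !mulgA yE.
by rewrite !invgM !letterV /wd !big_cons big_nil mulg1; apply: val_inj.
Qed.

Lemma corner_ab_zpow n : corner_ab (zpow c n) = (0 < n)%R.
Proof.
have c_inj := @bdry_zpow_inj 0 1 erefl isT.
have step m : m <> 0%R -> corner_ab (zpow c (m + 1)%R) = corner_ab (zpow c m).
  move=> m0; rewrite zpowS.
  have [//|/corner_ab_bdry[m1|me]] := eqVneq (corner_ab (zpow c m * c)) (corner_ab (zpow c m)).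
    by case: m0; apply: c_inj; rewrite m1.
  have : zpow c (m + 1)%R = a by rewrite zpowS me mulgVK.
  move=> /(congr1 fgw)/(congr1 size); rewrite size_bdry_zpow //=; lia.
elim/int_rect: n => [//|n IH|n IH].
  case: n IH => [|n] IH; first by rewrite zpow1 /corner_ab /bdry fgw_wd.
  by rewrite -[n.+2]addn1 PoszD step // IH; lia.
rewrite -[RHS]/((0 < - (n.+1)%:Z)%R) -(step (- (n.+1)%:Z)%R) //.
  by rewrite (_ : (- (n.+1)%:Z + 1 = - n%:Z)%R) ?IH; lia.
Qed.

Lemma corner_ab_azpow n : corner_ab (a * zpow c n) = (n < 0)%R.
Proof.
have c_inj := @bdry_zpow_inj 0 1 erefl isT.
have step m : m <> (-1)%R -> corner_ab (a * zpow c (m + 1)%R) = corner_ab (a * zpow c m).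
  move=> m0; rewrite zpowS mulgA.
  have [//|/corner_ab_bdry[m1|me]] := eqVneq (corner_ab (a * zpow c m * c)) (corner_ab (a * zpow c m)).
    have : zpow c (- m)%R = a by rewrite zpowN; apply/esym/(mulIg (zpow c m)); rewrite mulVg.
    by move=> /(congr1 fgw)/(congr1 size); rewrite size_bdry_zpow //=; lia.
  by case: m0; apply: c_inj; rewrite zpowN1; apply: (mulgI a).
elim/int_rect: n => [//|n IH|n IH].
  by rewrite -[n.+1]addn1 PoszD step // IH; lia.
have [->|n0] := eqVneq n 0.
  by rewrite zpowN1 -wd_invw -(wdK a) /= -wd_cat /corner_ab fgw_wd.
rewrite -(step (- (n.+1)%:Z)%R); last by lia.
by rewrite (_ : (- (n.+1)%:Z + 1 = - n%:Z)%R) ?IH; lia.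
Qed.

Lemma corner_ab_const u : (forall n, u <> zpow c n) -> (forall n, u <> a * zpow c n) ->
  forall n, corner_ab (u * zpow c n) = corner_ab u.
Proof.
move=> uC uaC.
have step m : corner_ab (u * zpow c (m + 1)%R) = corner_ab (u * zpow c m).
  rewrite zpowS mulgA.
  have [//|/corner_ab_bdry[um|um]] := eqVneq (corner_ab (u * zpow c m * c)) (corner_ab (u * zpow c m)).
    by case: (uC (- m)%R); rewrite zpowN; apply: (mulIg (zpow c m)); rewrite mulVg.
  case: (uaC (-1 - m)%R); rewrite zpowD zpowN1 zpowN mulgA -um.
  by rewrite mulgK.
elim/int_rect => [|n IH|n IH]; first by rewrite mulg1.
  by rewrite -[n.+1]addn1 PoszD step.
by rewrite -IH -(step (- (n.+1)%:Z)%R); congr (corner_ab (_ * zpow _ _)); lia.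
Qed.

(* The indicator of the ends between the gates of 1 and a^2: its only jumps are at
   those two gates, and it separates the gate of a from that of a^3. *)
Definition between (y : fg) : int := ((corner_ab y)%:Z + (corner_ab (a^-1 * y)%g)%:Z)%R.

Lemma apow_notin (i : nat) n : 0 < i < 4 -> a ^+ i <> zpow c n.
Proof.
move=> i4 /(congr1 fgw)/(congr1 size); rewrite size_bdry_zpow //.
by case: i i4 => [//|[|[|[|//]]]] _ /=; lia.
Qed.

Lemma between_letter (y : fg) t : 4 <= size y -> 4 <= size (y * letter t : fg) ->
  between (y * letter t) = between y.
Proof.
move=> y4 yt4; rewrite /between mulgA.
have h (u : fg) : 3 <= size u -> corner_ab (u * letter t) = corner_ab u.
  move=> u3; have [//|/corner_ab_letter[[ua _]|[ua _]]] := eqVneq (corner_ab (u * letter t)) (corner_ab u).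
    by rewrite ua in u3.
  by rewrite ua fgw_wd in u3.
have ay : size y <= (size (a^-1 * y : fg)).+1.
  rewrite -{1}(mulKg a^-1 y) invgK; set u := a^-1 * y.
  by rewrite -[fgw (a * u)]/(push 0 u); case: (fgw u) => //= x s; case: eqP => //= _; lia.
have h1 := h y; have h2 := h (a^-1 * y). by rewrite h1 ?h2 //; lia.
Qed.

Lemma between_aC n : between (a * zpow c n) = if n == 0%R then 0%R else 1%R.
Proof.
rewrite /between mulKg corner_ab_azpow corner_ab_zpow; case: eqP; lia.
Qed.

Lemma fgw_apow i : a ^+ i = nseq i 0 :> seq nat.
Proof.
elim: i => // i IH; rewrite expgS fgM_cat IH //.
by case: (i) => // j; elim: j.
Qed.

Lemma apowK i (u : fg) : a^-1 * (a ^+ i.+1 * u) = a ^+ i * u.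
Proof. by rewrite expgS -mulgA mulKg. Qed.

Lemma between_a2C n : between (a ^+ 2 * zpow c n) = (n < 0)%R.
Proof.
rewrite /between apowK expg1 corner_ab_azpow corner_ab_const => [|m|m].
- by rewrite /corner_ab fgw_apow; case: (n < 0)%R.
- exact: apow_notin.
- by rewrite expg2 => /mulgI; apply: (@apow_notin 1).
Qed.

Lemma between_a3C n : between (a ^+ 3 * zpow c n) = 0%R.
Proof.
rewrite /between apowK !corner_ab_const => [|m|m|m|m].
- by rewrite /corner_ab !fgw_apow.
- exact: (@apow_notin 2).
- by rewrite expg2 => /mulgI; apply: (@apow_notin 1).
- exact: (@apow_notin 3).
- by rewrite expgS => /mulgI; apply: (@apow_notin 2).
Qed.

Lemma between_const u : (forall n, u <> zpow c n) -> (forall n, u <> a ^+ 2 * zpow c n) ->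
  exists N, forall m, N <= m -> between (u * c ^+ m) = between (u * c ^- m).
Proof.
move=> uC ua2C; have [[i ->]|uaC] := pselect (exists i, u = a * zpow c i).
  exists (`|i|.+1)%N => m im.
  rewrite -(zpow_nat c m) -(zpow_natN c m) -!mulgA -!zpowD !between_aC.
  by case: eqP; case: eqP; lia.
exists 0 => m _; rewrite -(zpow_nat c m) -(zpow_natN c m) /between !mulgA.
have uaC' n : u <> a * zpow c n by move=> un; apply: uaC; exists n.
have auC n : a^-1 * u <> zpow c n by move=> un; apply: (uaC' n); rewrite -un mulVKg.
have auaC n : a^-1 * u <> a * zpow c n.
  by move=> un; apply: (ua2C n); rewrite expg2 -mulgA -un mulVKg.
by rewrite !corner_ab_const.
Qed.
End square_turn.

(* The relation [\prod_i E i = 1] together with generation and the last clause,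
   which says that no other relation holds, presents [G] as the fundamental
   group of the closed surface of genus [g]. *)
Definition surface_group (g : nat) (G : groupType) (E : nat -> G) : Prop :=
  [/\ forall i, E (linv i) = (E i)^-1,
      \prod_(i <- iota 0 (4 * g)) E i = 1,
      forall P : G -> Prop, P 1 -> (forall x y, P x -> P y -> P (x * y)) ->
        (forall x, P x -> P x^-1) -> (forall i, i < 4 * g -> P (E i)) -> forall x, P x &
      forall (W : Type) (R : nat -> W -> W),
        (forall i w, i < 4 * g -> R (linv i) (R i w) = w) ->
        (forall w, foldl (fun w i => R i w) w (iota 0 (4 * g)) = w) ->
        exists act : W -> G -> W, [/\ forall w, act w 1 = w,
          forall w x y, act w (x * y) = act (act w x) y &
          forall w i, i < 4 * g -> act w (E i) = R i w] ].

(** * Normal forms of the amalgam and the action of both factors on them *)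

Section normal_forms.
Context (g : nat) (g2 : 1 < g).
Implicit Types (b : bool) (x u : fg) (l : seq (bool * fg)) (n m : int).

Definition slo b : nat := if b then 0 else 4.
Definition srk b : nat := if b then 1%N else g.-1.
Definition sd b : fg -> bool := side (slo b) (slo b + 4 * srk b).
(* The two sides are glued along the common boundary curve, which they induce
   opposite orientations on. *)
Definition cc b : fg := if b then bdry 0 1 else (bdry 4 g.-1)^-1.
Definition inC b x : Prop := exists n, x = zpow (cc b) n.

Lemma slo4 b : slo b %% 4 = 0%N. Proof. by case: b. Qed.
Lemma srk0 b : 0 < srk b. Proof. by case: b => //=; lia. Qed.

Lemma sdM b x u : sd b x -> sd b u -> sd b (x * u).
Proof. exact: sideM. Qed.
Lemma sdV b x : sd b x -> sd b x^-1.
Proof. by apply: sideV; exact: slo4. Qed.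
Lemma sdc b : sd b (cc b).
Proof.
case: b; first exact: (@side_bdry 0 1).
by apply: sdV; exact: (@side_bdry 4 g.-1).
Qed.
Lemma sdcn b n : sd b (zpow (cc b) n).
Proof. by apply: side_zpow; [exact: slo4 | exact: sdc]. Qed.

Lemma zpow_cc b n : zpow (cc b) n = zpow (bdry (slo b) (srk b)) (if b then n else - n)%R.
Proof. by case: b => //=; rewrite /cc zpowV zpowN. Qed.

Lemma cc_inj b m n : zpow (cc b) m = zpow (cc b) n -> m = n.
Proof.
rewrite !zpow_cc => /(bdry_zpow_inj (slo4 b) (srk0 b)).
by case: b => // /GRing.oppr_inj.
Qed.

Lemma inC_bdry b x : inC b x <-> exists n, x = zpow (bdry (slo b) (srk b)) n.
Proof.
split=> -[n ->]; first by rewrite zpow_cc; eexists.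
exists (if b then n else - n)%R; rewrite zpow_cc; case: (b) => //.
by rewrite GRing.opprK.
Qed.

Lemma inCV b x : inC b x -> inC b x^-1.
Proof. by move=> [n ->]; exists (- n)%R; rewrite zpowN. Qed.
Lemma inCM b x u : inC b x -> inC b u -> inC b (x * u).
Proof. by move=> [n ->] [m ->]; exists (n + m)%R; rewrite zpowD. Qed.
Lemma inCMr b x n : inC b (x * zpow (cc b) n) -> inC b x.
Proof.
by move=> h; rewrite -(mulgK (zpow (cc b) n) x); apply: inCM => //; apply: inCV; exists n.
Qed.
Lemma inCMl b x n : inC b (zpow (cc b) n * x) -> inC b x.
Proof.
by move=> h; rewrite -(mulKg (zpow (cc b) n) x); apply: inCM => //; apply: inCV; exists n.
Qed.

(** Equal on a whole left coset of [<cc b>] because it is chosen from the coset as a set; the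
    default [1] never occurs, since the coset contains [x]. *)
Definition rep b x : fg := xget 1 [set y | exists n, y = x * zpow (cc b) n].
Definition expo b x : int := xget 0%R [set n | x = zpow (cc b) n].

Lemma repP b x : exists n, rep b x = x * zpow (cc b) n.
Proof. by apply: (@xgetPex _ 1 [set y | exists n, y = x * zpow (cc b) n]); exists x, 0%R; rewrite mulg1. Qed.

Lemma repMr b x n : rep b (x * zpow (cc b) n) = rep b x.
Proof.
congr (xget 1); apply/seteqP; split=> y [m ->] /=.
  by exists (n + m)%R; rewrite zpowD mulgA.
by exists (m - n)%R; rewrite -mulgA -zpowD GRing.addrC GRing.subrK.
Qed.

Lemma rep_idem b x : rep b (rep b x) = rep b x.
Proof. by have [n xn] := repP b x; rewrite {1}xn repMr. Qed.

Lemma expo_zpow b n : expo b (zpow (cc b) n) = n.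
Proof.
apply: (@cc_inj b); apply/esym; rewrite /expo.
by apply: (@xgetPex _ 0%R [set m | zpow (cc b) n = zpow (cc b) m]); exists n.
Qed.

Lemma rep_expo b x : rep b x * zpow (cc b) (expo b ((rep b x)^-1 * x)) = x.
Proof.
have [n xn] := repP b x.
have -> : (rep b x)^-1 * x = zpow (cc b) (- n)%R by rewrite xn invgM mulgVK zpowN.
by rewrite expo_zpow xn -mulgA -zpowD GRing.subrr mulg1.
Qed.

Lemma rep_inC b x : inC b (rep b x) -> inC b x.
Proof. by have [n ->] := repP b x; exact: inCMr. Qed.

Lemma rep_sd b x : sd b x -> sd b (rep b x).
Proof. by have [n ->] := repP b x => sx; exact: sdM (sdcn b n). Qed.

(** The integer is the exponent of the power of the amalgamated generator that follows the last
    syllable. *)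
Definition wt : Type := (seq (bool * fg) * int)%type.

Definition starts b l : bool := if l is (b', _) :: _ then b' == b else false.

(* Words are stored with their last letter first. *)
Fixpoint wfl l : Prop :=
  if l is (b, x) :: l' then
    [/\ sd b x, ~ inC b x, rep b x = x, ~~ starts b l' & wfl l']
  else True.

(** This is van der Waerden's method: the last syllable is split off as an actual element of the
    factor [b] ([dec]), multiplied there, and stored again ([enc]). As the two operations are
    mutually inverse, each factor acts on normal forms. *)
Definition dec b (w : wt) : seq (bool * fg) * fg :=
  if w.1 is (b', x) :: l' then
    if b' == b then (l', x * zpow (cc b) w.2) else (w.1, zpow (cc b) w.2)
  else ([::], zpow (cc b) w.2).

Definition enc b (p : seq (bool * fg) * fg) : wt :=
  if `[< inC b p.2 >] then (p.1, expo b p.2)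
  else ((b, rep b p.2) :: p.1, expo b ((rep b p.2)^-1 * p.2)).

Definition wact b u (w : wt) : wt := enc b ((dec b w).1, (dec b w).2 * u).

Lemma decP b w : wfl w.1 ->
  [/\ wfl (dec b w).1, ~~ starts b (dec b w).1 & sd b (dec b w).2].
Proof.
case: w => -[|[b' x] l] n /=; first by rewrite /dec /= sdcn.
case=> sx xC xx sl wl; rewrite /dec /=; case: eqP => [<-|/eqP bb] /=.
  by split=> //; exact: sdM (sdcn b' n).
by split=> //; exact: sdcn.
Qed.

Lemma enc_wf b l x : wfl l -> ~~ starts b l -> sd b x -> wfl (enc b (l, x)).1.
Proof.
move=> wl sl sx; rewrite /enc /=; case: asboolP => //= xC; split=> //.
- exact: rep_sd.
- by move/rep_inC.
- exact: rep_idem.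
Qed.

Lemma encK b l x : ~~ starts b l -> dec b (enc b (l, x)) = (l, x).
Proof.
move=> sl; rewrite /enc /=; case: asboolP => [[n ->]|xC].
  rewrite expo_zpow /dec /=; case: l sl => //= -[b' y] l.
  by rewrite /starts => /negbTE ->.
by rewrite /dec /= eqxx rep_expo.
Qed.

Lemma decK b w : wfl w.1 -> enc b (dec b w) = w.
Proof.
case: w => -[|[b' x] l] n /=; rewrite /dec /enc /=.
  by rewrite asboolT ?expo_zpow //; exists n.
case=> sx xC xx sl wl; case: eqP => [bb|bb] /=; last first.
  by rewrite asboolT ?expo_zpow //; exists n.
rewrite -bb asboolF; last by move/inCMr.
by rewrite repMr xx mulKg expo_zpow.
Qed.

Lemma wact_wf b u w : wfl w.1 -> sd b u -> wfl (wact b u w).1.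
Proof.
by move=> ww su; have [h1 h2 h3] := decP b ww; apply: enc_wf => //; exact: sdM.
Qed.

Lemma wactM b u v w : wfl w.1 -> wact b (u * v) w = wact b v (wact b u w).
Proof.
move=> ww; have [h1 h2 h3] := decP b ww.
by rewrite /wact encK //= mulgA.
Qed.

Lemma wact1 b w : wfl w.1 -> wact b 1 w = w.
Proof. by move=> ww; rewrite /wact mulg1 -surjective_pairing decK. Qed.

(** In both factors the amalgamated generator only shifts the exponent. The two actions thus agree
    on it, which is what makes the surface relation hold in [Rw_rel]. *)
Lemma wact_cc b m w : wfl w.1 -> wact b (zpow (cc b) m) w = (w.1, w.2 + m)%R.
Proof.
move=> ww; rewrite -[RHS](@decK b) //; congr enc.
case: w {ww} => -[|[b' x] l] n; rewrite /dec /= ?zpowD //.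
by case: eqP => _ /=; rewrite ?mulgA.
Qed.

Definition nfw : Type := {w : wt | wfl w.1}.

Lemma nfwP (w : nfw) : wfl (sval w).1. Proof. by case: w. Qed.
#[local] Hint Resolve nfwP : core.

Lemma sval_eq (w w' : nfw) : sval w = sval w' -> w = w'.
Proof. by case: w w' => [w ww] [w' ww'] /= e; case: w' / e ww' => ww'; congr exist; exact: Prop_irrelevance. Qed.

Definition side_of (i : nat) : bool := i < 4.

Lemma sd_letter i : i < 4 * g -> sd (side_of i) (letter i).
Proof.
move=> ig; rewrite /sd side_letter /side_of /slo /srk; have [i4|i4] := ltnP i 4; lia.
Qed.

Lemma side_of_linv i : side_of (linv i) = side_of i.
Proof. by have := linvP i; rewrite /side_of; lia. Qed.

Definition Rw (i : nat) (w : nfw) : nfw :=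
  match pselect (i < 4 * g) with
  | left ig => exist (fun w : wt => wfl w.1) _ (wact_wf (proj2_sig w) (sd_letter ig))
  | right _ => w
  end.

Lemma RwE i w : i < 4 * g -> sval (Rw i w) = wact (side_of i) (letter i) (sval w).
Proof. by rewrite /Rw; case: pselect. Qed.

Lemma Rw_linv i w : i < 4 * g -> Rw (linv i) (Rw i w) = w.
Proof.
move=> ig; have ig' : linv i < 4 * g by have := linvP i; lia.
apply: sval_eq; rewrite !RwE // side_of_linv -wactM //.
by rewrite -letterV mulgV wact1 //.
Qed.

Lemma foldl_Rw b s w : all (fun i => (i < 4 * g) && (side_of i == b)) s ->
  sval (foldl (fun w i => Rw i w) w s) = wact b (wd s) (sval w).
Proof.
elim: s w => [|i s IH] w /=; first by rewrite /wd big_nil wact1 //.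
case/andP => /andP[ig /eqP ib] als; rewrite IH // RwE // ib wd_cons -wactM //.
Qed.

(** The first four letters spell [c], and the others spell its inverse as seen from the other
    factor, so the exponent is shifted by 1 and back. *)
Lemma Rw_rel w : foldl (fun w i => Rw i w) w (iota 0 (4 * g)) = w.
Proof.
have -> : (4 * g = 4 + 4 * g.-1)%N by lia.
rewrite iotaD foldl_cat; apply: sval_eq; set w' := foldl _ w _.
rewrite (foldl_Rw (b := false)); last first.
  by apply/allP => i; rewrite mem_iota /side_of; lia.
rewrite (foldl_Rw (b := true)); last by rewrite /= !andbT; lia.
have -> : wd (iota 0 4) = zpow (cc true) 1 by [].
rewrite wact_cc //.
have -> : wd (iota (0 + 4) (4 * g.-1)) = zpow (cc false) (-1)%R.
  by rewrite /= invgK.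
rewrite wact_cc /= // GRing.addrK.
by case: (sval w).
Qed.
End normal_forms.

(** * The surface group as an amalgam: length, reduced words, uniqueness *)

Section amalgam.
Context (g : nat) (g2 : 1 < g) (G : groupType) (E : nat -> G).
Context (sg : surface_group g E).
Local Notation cc := (cc g).
Local Notation sd := (sd g).
Local Notation inC := (inC g).
Local Notation ev := (ev E).
Implicit Types (b : bool) (x u : fg) (l : seq (bool * fg)) (n m : int) (y : G).

Let EV : forall i, E (linv i) = (E i)^-1. Proof. by case: sg. Qed.

Definition cG n : G := zpow (ev (cc true)) n.

Lemma ev_cc b n : ev (zpow (cc b) n) = cG n.
Proof.
rewrite ev_zpow //; congr zpow; case: b => //=.
case: sg => _ + _ _; have {1}-> : (4 * g = 4 + 4 * g.-1)%N by lia.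
rewrite iotaD big_cat /= -!(ev_wd EV) => /mulg1_eq.
by rewrite evV // => <-; rewrite invgK.
Qed.

Definition prodl l : G := \prod_(p <- l) ev p.2.

Lemma prodl_cat l l' : prodl (l ++ l') = prodl l * prodl l'.
Proof. exact: big_cat. Qed.
Lemma prodl_cons p l : prodl (p :: l) = ev p.2 * prodl l.
Proof. exact: big_cons. Qed.
Lemma prodl_rcons p l : prodl (rcons l p) = prodl l * ev p.2.
Proof. by rewrite -cats1 prodl_cat /prodl big_seq1. Qed.

Definition el (w : wt) : G := prodl (rev w.1) * cG w.2.

Lemma el_dec b w : wfl g w.1 -> el w = prodl (rev (dec g b w).1) * ev (dec g b w).2.
Proof.
case: w => -[|[b' x] l] n ww; rewrite /el /dec /= -?(ev_cc b) //.
case: eqP => [->|_] /=; last by rewrite ev_cc.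
by rewrite rev_cons prodl_rcons evM // -mulgA.
Qed.

Lemma el_enc b l x : el (enc g b (l, x)) = prodl (rev l) * ev x.
Proof.
rewrite /enc /=; case: asboolP => [[n ->]|xC]; rewrite /el /=.
  by rewrite expo_zpow // ev_cc.
by rewrite rev_cons prodl_rcons /= -(ev_cc b) -mulgA -evM // rep_expo.
Qed.

Lemma el_wact b u w : wfl g w.1 -> sd b u -> el (wact g b u w) = el w * ev u.
Proof. by move=> ww su; rewrite el_enc evM // mulgA -el_dec. Qed.

Lemma nf_exists : exists nf : G -> wt, [/\ nf 1 = ([::], 0%R),
  forall y, wfl g (nf y).1, forall y, el (nf y) = y &
  forall b u y, sd b u -> nf (y * ev u) = wact g b u (nf y)].
Proof.
case: (sg) => _ _ gen act.
have [a [a1 aM aE]] := act _ (@Rw g g2) (@Rw_linv g g2) (@Rw_rel g g2).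
pose w0 : nfw g := exist (fun w : wt => wfl g w.1) ([::], 0%R) I.
have elE : forall y (w : nfw g), el (sval (a w y)) = el (sval w) * y.
  apply: gen => [w|x y IHx IHy w|x IH w|i ig w].
  - by rewrite a1 mulg1.
  - by rewrite aM IHy IHx mulgA.
  - by apply: (mulIg x); rewrite mulgVK -IH -aM mulVg a1.
  - by rewrite aE // RwE // el_wact ?ev_letter //; [exact: nfwP | exact: sd_letter].
exists (fun y => sval (a w0 y)); split=> [|y|y|b u y su].
- by rewrite a1.
- exact: nfwP.
- by rewrite elE /el /prodl /= big_nil !mul1g.
- rewrite -(wdK u) (ev_wd EV).
  have : all (fun i => (i < 4 * g) && (side_of i == b)) u.
    apply: sub_all su => i; rewrite /slo /srk /side_of; case: b; lia.
  elim: (fgw u) y => [|i s IH] y /=.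
    by rewrite /wd !big_nil mulg1 wact1 //; exact: nfwP.
  case/andP => /andP[ig /eqP ib] als.
  by rewrite big_cons mulgA IH // aM aE // RwE // ib wd_cons -wactM //; exact: nfwP.
Qed.

Definition nf := sval (cid nf_exists).
Lemma nf1 : nf 1 = ([::], 0%R). Proof. by rewrite /nf; case: cid => ? []. Qed.
Lemma nf_wf y : wfl g (nf y).1. Proof. by rewrite /nf; case: cid => ? []. Qed.
Lemma nfK y : el (nf y) = y. Proof. by rewrite /nf; case: cid => ? []. Qed.
Lemma nfM b u y : sd b u -> nf (y * ev u) = wact g b u (nf y).
Proof. by move=> su; rewrite /nf; case: cid => ? [? ? ? h] /=; exact: h. Qed.

Lemma nf_cG y n : nf (y * cG n) = ((nf y).1, (nf y).2 + n)%R.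
Proof. by rewrite -(ev_cc true) (nfM (b := true)) ?wact_cc //; [exact: nf_wf | exact: sdcn]. Qed.

(** Each factor embeds in the amalgam, since an element of it can be recovered from its effect on
    the empty normal form. *)
Lemma ev_inj b u v : sd b u -> sd b v -> ev u = ev v -> u = v.
Proof.
move=> su sv uv; have := nfM 1 su; rewrite uv (nfM _ sv) nf1.
move=> /(congr1 (dec g b)); rewrite /wact !encK //=.
by rewrite !mul1g => -[].
Qed.

Definition len y : nat := size (nf y).1.

Definition goodb (p : bool * fg) : bool := sd p.1 p.2 && `[< ~ inC p.1 p.2 >].
Definition red l : bool := all goodb l && sorted (fun p q => p.1 != q.1) l.

Lemma red_cat l l' : red (l ++ l') -> red l /\ red l'.
Proof. by case/andP; rewrite all_cat => /andP[a a'] /cat_sorted2[s s']; split; apply/andP. Qed.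

Lemma red_catE l p q l' : red (rcons l p ++ q :: l') =
  [&& red (rcons l p), red (q :: l') & p.1 != q.1].
Proof.
rewrite /red all_cat; case: (all goodb (rcons l p)) => //=.
case: (goodb q && all goodb l'); rewrite ?andbF //=.
case: l => [|r l] /=; first by rewrite andbC.
by rewrite cat_path last_rcons /=; congr andb; rewrite andbC.
Qed.

Lemma red_dcos l b x n m l' : 
  red (l ++ (b, x) :: l') -> red (l ++ (b, zpow (cc b) n * x * zpow (cc b) m) :: l').
Proof.
rewrite /red !all_cat /= => /andP[/and3P[-> /andP[sx /asboolP xC] ->] ss].
have gx : goodb (b, zpow (cc b) n * x * zpow (cc b) m).
  apply/andP; split; first by rewrite /= !sdM ?sdcn.
  by apply/asboolP => /= /inCMr/inCMl.
rewrite gx /=; move: ss; case: (l) => [|q l1] /=; first by case: l'.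
by rewrite !cat_path /=; case: l'.
Qed.

Lemma red_rev l : red (rev l) = red l.
Proof.
rewrite /red all_rev rev_sorted; congr andb; apply: eq_sorted => p q /=.
by rewrite eq_sym.
Qed.

(** Powers of [c] can be moved between neighbouring syllables, so a group element determines its
    syllables only up to such powers on both sides. *)
Definition dcos (p q : bool * fg) : Prop :=
  p.1 = q.1 /\ exists n m, q.2 = zpow (cc p.1) n * p.2 * zpow (cc p.1) m.

Fixpoint matched l l' : Prop := match l, l' with
  | [::], [::] => True
  | p :: l0, q :: l0' => dcos p q /\ matched l0 l0'
  | _, _ => False end.

Lemma matched_size l l' : matched l l' -> size l = size l'.
Proof. by elim: l l' => [|p l IH] [|q l'] //= [_ /IH ->]. Qed.

(** A syllable appended to a reduced word absorbs the power of [c] in front of it and is replaced by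
    a coset representative. No power stands in front of the first syllable, which therefore keeps
    its left coset; [first_side] relies on this. *)
Lemma nf_prodl l : red l -> matched (rev l) (nf (prodl l)).1 /\
  (if l is (b, x) :: _ then last (b, x) (nf (prodl l)).1 = (b, rep g b x) else True).
Proof.
elim/last_ind: l => [|l [b x] IH] rl; first by rewrite /prodl big_nil nf1.
have [rl0 rlast] : red l /\ red [:: (b, x)] by apply: red_cat; rewrite cats1.
have [mt hd] := IH rl0; rewrite rev_rcons prodl_rcons /=.
move: (rlast); rewrite /red /= !andbT => /andP[sx /asboolP /= xC].
rewrite (nfM _ sx) /wact.
have ns : ~~ starts b (nf (prodl l)).1.
  case: (lastP l) mt rl => [|l0 p] mt rl; first by case: (nf _).1 mt.
  move: mt; rewrite rev_rcons; case: (nf _).1 => //= -[b' x'] l' [[/= <- _] _].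
  by move: rl; rewrite -cats1 red_catE => /and3P[].
have decE : dec g b (nf (prodl l)) = ((nf (prodl l)).1, zpow (cc b) (nf (prodl l)).2).
  rewrite /dec; case: (nf (prodl l)).1 ns => [|[b' x'] l'] //= /negbTE; rewrite /starts.
  by move=> ->.
rewrite decE /enc /= asboolF /=; last by move/inCMl.
split; first split=> //.
  split=> //=; have [n ->] := repP g b (zpow (cc b) (nf (prodl l)).2 * x).
  by exists (nf (prodl l)).2, n.
case: l {IH rl rl0 decE ns} mt hd => [|[b' x'] l] mt hd.
  by rewrite /= /prodl big_nil nf1 /= mul1g.
move: hd; rewrite /=; case: (nf _).1 mt => [|q l'] //=.
by rewrite rev_cons; case: (rev l).
Qed.

Lemma len_prodl l : red l -> len (prodl l) = size l.
Proof. by move=> rl; have [/matched_size sz _] := nf_prodl rl; rewrite /len -sz size_rev. Qed.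

Lemma last_nf_prodl b x l d : red ((b, x) :: l) ->
  last d (nf (prodl ((b, x) :: l))).1 = (b, rep g b x).
Proof.
move=> rl; have [_] := nf_prodl rl; have := len_prodl rl; rewrite /len.
by case: (nf _).1.
Qed.

Lemma len1 : len 1 = 0%N. Proof. by rewrite /len nf1. Qed.
Lemma cG0 : cG 0 = 1. Proof. by []. Qed.

Lemma wfl_red l : wfl g l -> red l.
Proof.
elim: l => [|[b x] l IH] //= [sx xC _ sl /IH/andP[al sl']].
rewrite /red /= al /= {1}/goodb /= sx asboolT //=.
by case: l sl {IH al} sl' => [|[b' y'] l] //= sl ->; rewrite eq_sym sl.
Qed.

Lemma normal_form y : exists l n, [/\ red l, size l = len y & y = prodl l * cG n].
Proof.
exists (rev (nf y).1), (nf y).2; rewrite size_rev red_rev; split=> //.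
  exact/wfl_red/nf_wf.
by rewrite -[LHS]nfK.
Qed.

Lemma prodl_cG l b x n : prodl (rcons l (b, x)) * cG n = prodl (rcons l (b, x * zpow (cc b) n)).
Proof. by rewrite !prodl_rcons /= evM // ev_cc mulgA. Qed.
Lemma cG_prodl l b x n : cG n * prodl ((b, x) :: l) = prodl ((b, zpow (cc b) n * x) :: l).
Proof. by rewrite !prodl_cons /= evM // ev_cc mulgA. Qed.

Lemma red_rcons_cc l b x n : red (rcons l (b, x)) -> red (rcons l (b, x * zpow (cc b) n)).
Proof. by rewrite -!cats1 => /(red_dcos 0 n); rewrite mul1g. Qed.
Lemma red_cons_cc l b x n : red ((b, x) :: l) -> red ((b, zpow (cc b) n * x) :: l).
Proof. by move=> /(@red_dcos [::] b x n 0); rewrite mulg1. Qed.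

Lemma normal_form_case y : (exists n, y = cG n) \/
  (exists l, [/\ red l, 0 < size l, size l = len y & y = prodl l]).
Proof.
have [l [n [rl sz yE]]] := normal_form y.
case: (lastP l) rl sz yE => [|l0 [b x]] rl sz yE.
  by left; exists n; rewrite yE /prodl big_nil mul1g.
right; exists (rcons l0 (b, x * zpow (cc b) n)); split.
- exact: red_rcons_cc.
- by rewrite size_rcons.
- by rewrite -sz !size_rcons.
- by rewrite yE prodl_cG.
Qed.

Lemma len_cG y n : len (y * cG n) = len y.
Proof. by rewrite /len nf_cG. Qed.

Lemma len_ev b u y : sd b u -> len (y * ev u) <= (len y).+1.
Proof.
move=> su; rewrite /len (nfM _ su) /wact /enc /dec /=.
case: (nf y) => -[|[b' x] l] n /=; first by case: asboolP.
by case: eqP => _ /=; case: asboolP => _ /=; lia.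
Qed.

Lemma lenM y z : len (y * z) <= len y + len z.
Proof.
have [l [n [rl <- ->]]] := normal_form z; rewrite mulgA len_cG.
elim/last_ind: l rl {z} => [|l [b x] IH] rl; first by rewrite /prodl big_nil mulg1 addn0.
have [rl0 rlast] : red l /\ red [:: (b, x)] by apply: red_cat; rewrite cats1.
rewrite prodl_rcons mulgA size_rcons addnS /=.
move: rlast; rewrite /red /= andbT andbT => /andP[sx _].
by apply: leq_trans (len_ev _ sx) _; rewrite ltnS IH.
Qed.

Definition invl l := rev (map (fun p : bool * fg => (p.1, p.2^-1)) l).

Lemma prodl_invl l : prodl (invl l) = (prodl l)^-1.
Proof.
elim: l => [|p l IH]; first by rewrite /prodl !big_nil invg1.
by rewrite /invl /= rev_cons prodl_rcons IH prodl_cons invgM evV.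
Qed.

Lemma red_invl l : red l -> red (invl l).
Proof.
rewrite /invl red_rev /red all_map sorted_map => /andP[al sl]; apply/andP; split=> //.
apply: sub_all al => -[b x] /andP[sx /asboolP xC]; apply/andP; split; first exact: sdV.
by apply/asboolP => /= /inCV; rewrite invgK.
Qed.
End amalgam.

(** * The quasimorphism that counts square turns *)

Section turn_count.
Context (g : nat) (g2 : 1 < g) (G : groupType) (E : nat -> G).
Context (sg : surface_group g E).
Local Notation cc := (cc g).
Local Notation sd := (sd g).
Local Notation inC := (inC g).
Local Notation ev := (ev E).
Local Notation cG := (cG g E).
Local Notation prodl := (prodl E).
Local Notation len := (len g2 sg).
Local Notation red := (red g).
Local Notation a := (letter 0).
Implicit Types (b : bool) (x u : fg) (l : seq (bool * fg)) (n m : int) (y : G).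

Let EV : forall i, E (linv i) = (E i)^-1. Proof. by case: sg. Qed.

Definition esum (z : nat) (s : seq nat) : int :=
  (\sum_(i <- s) (if i == z then 1 else if i == linv z then -1 else 0))%R.

Lemma esum_push z i s : esum z (push i s) = (esum z [:: i] + esum z s)%R.
Proof.
rewrite /esum; case: s => [|j s] /=; first by rewrite big_nil GRing.addr0.
case: eqP => [->|_]; rewrite !big_cons big_nil GRing.addr0 //.
suff -> : forall r : int, ((if i == z then 1 else if i == linv z then -1 else 0) +
   ((if linv i == z then 1 else if linv i == linv z then -1 else 0) + r) = r)%R by [].
move=> r; rewrite (inj_eq (can_inj linvK)) (can2_eq linvK linvK).
have zz : (z == linv z) = false by apply/eqP => e; have := @linv_neq z; rewrite -e.
case: (i =P z) => [->|_]; first by rewrite zz; lia.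
by case: (i =P linv z); lia.
Qed.

Lemma esumM z (x u : fg) : esum z (x * u : fg) = (esum z x + esum z u)%R.
Proof.
case: x => s rs /=; elim: s {rs} => [|i s IH] /=; first by rewrite /esum big_nil GRing.add0r.
by rewrite esum_push IH GRing.addrA; congr (_ + _)%R; rewrite /esum !big_cons big_nil GRing.addr0.
Qed.

Lemma esum_zpow z x n : esum z (zpow x n) = (esum z x * n)%R.
Proof.
elim/int_rect: n => [|n IH|n IH]; first by rewrite /esum big_nil GRing.mulr0.
  by rewrite -[n.+1]addn1 PoszD zpowS esumM IH; lia.
have : esum z (zpow x (- n.+1%:Z)%R * x : fg) = (esum z x * - n%:Z)%R.
  by rewrite -zpowS (_ : (- n.+1%:Z + 1 = - n%:Z)%R) //; lia.
by rewrite esumM; lia.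
Qed.

Lemma esum_c n : esum 0 (zpow (cc true) n) = 0%R.
Proof.
by rewrite esum_zpow /cc /bdry fgw_wd // /esum !big_cons big_nil /=; lia.
Qed.

Definition turn (e : int) x : Prop :=
  exists n m, x = zpow (cc true) n * zpow a e * zpow (cc true) m.

(** The exponent sum of [a] vanishes on [c], so it separates the double cosets of different powers
    of [a]; in particular [turn 2] and [turn (-2)] exclude each other. *)
Lemma turn_esum e x : turn e x -> esum 0 x = e.
Proof.
case=> n [m ->]; rewrite !esumM !esum_c GRing.add0r GRing.addr0 esum_zpow.
by rewrite {1}/esum big_seq1 /= GRing.mul1r.
Qed.

Lemma turnV e x : turn e x -> turn (- e)%R x^-1.
Proof.
case=> n [m ->]; exists (- m)%R, (- n)%R.
by rewrite !invgM !zpowN mulgA.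
Qed.

Lemma turn_cos e x n m : turn e (zpow (cc true) n * x * zpow (cc true) m) <-> turn e x.
Proof.
split=> -[i [j xE]].
  exists (- n + i)%R, (j - m)%R; rewrite !zpowD !zpowN.
  by apply: (mulIg (zpow (cc true) m)); apply: (mulgI (zpow (cc true) n)); rewrite !mulgA mulgVK mulgV mul1g xE.
by exists (n + i)%R, (j + m)%R; rewrite xE !zpowD !mulgA.
Qed.

Definition turn2 x : int :=
  if `[< turn 2 x >] then 1%R else if `[< turn (-2)%R x >] then (-1)%R else 0%R.

Lemma turn2V x : turn2 x^-1 = (- turn2 x)%R.
Proof.
have tV e : turn e x^-1 <-> turn (- e)%R x.
  by split=> /turnV; rewrite ?invgK ?GRing.opprK.
rewrite /turn2 (propext (tV 2)) (propext (tV (-2)%R)) GRing.opprK.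
case: asboolP => [t|t]; case: asboolP => [t'|t'] //.
by have := turn_esum t; have := turn_esum t'; lia.
Qed.

Definition lam (p : bool * fg) : int := if p.1 then turn2 p.2 else 0%R.

Lemma lam_dcos b x n m : lam (b, zpow (cc b) n * x * zpow (cc b) m) = lam (b, x).
Proof.
by rewrite /lam /turn2 /=; case: b => //; rewrite (propext (turn_cos 2 x n m)) (propext (turn_cos (-2)%R x n m)).
Qed.
Lemma lam_cl b x n : lam (b, zpow (cc b) n * x) = lam (b, x).
Proof. by rewrite -(lam_dcos b x n 0) mulg1. Qed.
Lemma lam_cr b x n : lam (b, x * zpow (cc b) n) = lam (b, x).
Proof. by rewrite -(lam_dcos b x 0 n) mul1g. Qed.
Lemma lamV b x : lam (b, x^-1) = (- lam (b, x))%R.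
Proof. by rewrite /lam /=; case: b; rewrite ?turn2V ?GRing.oppr0. Qed.
Lemma lam_le p : `|lam p| <= 1.
Proof. by rewrite /lam /turn2; case: p.1 => //; case: asboolP => // _; case: asboolP. Qed.

Definition suml l : int := (\sum_(p <- l) lam p)%R.

Lemma suml_cat l l' : suml (l ++ l') = (suml l + suml l')%R.
Proof. exact: big_cat. Qed.
Lemma suml_cons p l : suml (p :: l) = (lam p + suml l)%R.
Proof. exact: big_cons. Qed.
Lemma suml_nil : suml [::] = 0%R. Proof. exact: big_nil. Qed.
Lemma suml_rcons p l : suml (rcons l p) = (suml l + lam p)%R.
Proof. by rewrite -cats1 suml_cat suml_cons suml_nil GRing.addr0. Qed.
Lemma suml_rev l : suml (rev l) = suml l.
Proof. by elim: l => // p l IH; rewrite rev_cons suml_rcons IH suml_cons GRing.addrC. Qed.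

Lemma matched_suml l l' : matched g l l' -> suml l = suml l'.
Proof.
elim: l l' => [|[b x] l IH] [|[b' x'] l'] //= [[/= bb [n [m ->]]] /IH e].
by rewrite !suml_cons e -bb lam_dcos.
Qed.

Definition turns2 y : int := suml (nf g2 sg y).1.

Lemma turns2_prodl l : red l -> turns2 (prodl l) = suml l.
Proof.
by move=> rl; have [/matched_suml e _] := nf_prodl g2 sg rl; rewrite /turns2 -e suml_rev.
Qed.

Lemma turns2_cG y n : turns2 (y * cG n) = turns2 y.
Proof. by rewrite /turns2 nf_cG. Qed.

Lemma turns2_cG0 n : turns2 (cG n) = 0%R.
Proof. by rewrite -(mul1g (cG n)) turns2_cG /turns2 nf1 suml_nil. Qed.

(** Syllables that cancel are inverse up to powers of [c], so their contributions cancel too. Where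
    the cancellation stops, at most two syllables merge into one; these three contributions, each at
    most 1 in absolute value, give the constant. *)
Lemma turns2_quasi_red l l' n : red l -> red l' ->
  `|(turns2 (prodl l * cG n * prodl l')%g - suml l - suml l')%R| <= 3.
Proof.
elim/last_ind: l l' n => [|l [b x] IH] l' n rl rl'.
  rewrite {1}/prodl big_nil mul1g suml_nil; case: l' rl' => [|[b x] l'] rl'.
    by rewrite /prodl big_nil mulg1 turns2_cG0 suml_nil.
  rewrite (cG_prodl g2 sg) turns2_prodl; last exact: red_cons_cc.
  by rewrite !suml_cons lam_cl; lia.
have rlc := red_rcons_cc n rl; rewrite (prodl_cG g2 sg).
case: l' rl' => [|[b' x'] l'] rl'.
  rewrite {2}/prodl big_nil mulg1 turns2_prodl // suml_nil !suml_rcons lam_cr.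
  by lia.
have [bb|bb] := eqVneq b b'; last first.
  rewrite -prodl_cat turns2_prodl; last by rewrite red_catE rlc rl'.
  by rewrite suml_cat !suml_rcons lam_cr; lia.
rewrite -bb {b' bb} in rl' *.
rewrite prodl_rcons prodl_cons /= -mulgA [_ * (ev x' * _)]mulgA -evM //.
set v := _ * x'; have [rl0 rlb] : red l /\ red [:: (b, x)] by apply: red_cat; rewrite cats1.
have [rb' rl0'] : red [:: (b, x')] /\ red l' by exact: (@red_cat g [:: (b, x')]).
have [[m vm]|vC] := pselect (inC b v).
  rewrite vm ev_cc // mulgA; have := IH l' m rl0 rl0'.
  rewrite suml_rcons suml_cons.
  have -> : x' = zpow (cc b) (- n)%R * x^-1 * zpow (cc b) m.
    by rewrite -vm /v zpowN !mulgA mulgVK mulVg mul1g.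
  rewrite lam_dcos lamV. move: (turns2 _) (suml l) (suml l') (lam _) => A B C D; lia.
have gv : goodb g (b, v).
  apply/andP; split; last exact/asboolP.
  move: rlb rb'; rewrite /red /= !andbT => /andP[sx _] /andP[sx' _].
  by rewrite /= !sdM // sdcn.
have rv : red (rcons l (b, v) ++ l').
  move: rl rl'; rewrite -!cats1 /red -catA !all_cat /= gv andbT.
  move=> /andP[/andP[-> _] ss] /andP[/andP[_ ->] ss'] /=.
  move: ss ss'; case: (l) => [|q l0] /=; first by case: (l').
  rewrite !cat_path /= andbT => /andP[-> ->] /=.
  by case: (l').
have -> : prodl l * (ev v * prodl l') = prodl (rcons l (b, v) ++ l').
  by rewrite prodl_cat prodl_rcons mulgA.
rewrite turns2_prodl // suml_cat !suml_rcons suml_cons.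
by have := lam_le (b, v); have := lam_le (b, x); have := lam_le (b, x'); lia.
Qed.

Lemma turns2_quasi y z : `|(turns2 (y * z)%g - turns2 y - turns2 z)%R| <= 3.
Proof.
have [l [n [rl _ ->]]] := normal_form g2 sg y.
have [l' [n' [rl' _ ->]]] := normal_form g2 sg z.
by rewrite mulgA !turns2_cG !turns2_prodl // turns2_quasi_red.
Qed.

Lemma suml_invl l : suml (invl l) = (- suml l)%R.
Proof.
rewrite /invl suml_rev; elim: l => [|[b x] l IH] /=; first by rewrite suml_nil GRing.oppr0.
by rewrite !suml_cons IH lamV GRing.opprD.
Qed.

Lemma turns2V y : turns2 y^-1 = (- turns2 y)%R.
Proof.
have [[n ->]|[l [rl _ _ ->]]] := normal_form_case g2 sg y.
  rewrite turns2_cG0 (_ : (cG n)^-1 = cG (- n)%R) ?turns2_cG0 //.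
  by rewrite /cG zpowN.
by rewrite -(prodl_invl sg) !turns2_prodl ?suml_invl //; exact: red_invl.
Qed.

Definition cyc l : bool := (0 < size l) && red (l ++ l).

Lemma cyc_red l : cyc l -> red l.
Proof. by case/andP => _ /red_cat[]. Qed.

(** If the first and last syllables lie in the same factor, conjugation by the first one merges them
    and shortens the word. *)
Lemma cyclic_reduction y : exists p y', y = p * y' * p^-1 /\
  ((exists b u, sd b u /\ y' = ev u) \/ exists2 l, cyc l & y' = prodl l).
Proof.
have ext : forall q y0 y, y = q * y0 * q^-1 -> (exists p y', y0 = p * y' * p^-1 /\
  ((exists b u, sd b u /\ y' = ev u) \/ exists2 l, cyc l & y' = prodl l)) -> 
  exists p y', y = p * y' * p^-1 /\
  ((exists b u, sd b u /\ y' = ev u) \/ exists2 l, cyc l & y' = prodl l).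
  move=> q y0 {}y -> [p [y' [-> yy]]]; exists (q * p), y'; split=> //.
  by rewrite invgM !mulgA.
have [k] := ubnP (len y); elim: k y => // k IH y yk.
have [[n ->]|[l [rl l0 sz yE]]] := normal_form_case g2 sg y.
  exists 1, (cG n); rewrite mul1g invg1 mulg1; split=> //; left.
  by exists true, (zpow (cc true) n); rewrite sdcn ev_cc.
case: l l0 rl sz yE => // -[b x] l _; case: (lastP l) => [|{}l [b' x']] rl sz yE.
  exists 1, y; rewrite mul1g invg1 mulg1; split=> //; left.
  exists b, x; rewrite yE /prodl big_seq1; split=> //.
  by case/andP: rl => /=; rewrite andbT => /andP[].
have [bb|bb] := eqVneq b b'; last first.
  exists 1, y; rewrite mul1g invg1 mulg1; split=> //; right.
  exists ((b, x) :: rcons l (b', x')) => //; apply/andP; split=> //.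
  by rewrite -rcons_cons red_catE rcons_cons rl /= eq_sym bb.
rewrite -{b'}bb in rl yE sz.
have rl1 : red (rcons l (b, x')) by exact: (@red_cat g [:: (b, x)] _ _).2.
have rl0 : red l by move: rl1; rewrite -cats1 => /red_cat[].
apply: (ext (ev x) (prodl l * ev (x' * x))).
  by rewrite yE prodl_cons prodl_rcons /= evM // !mulgA mulgK.
apply: IH; apply: leq_trans (_ : len y <= k); last by rewrite -ltnS.
rewrite -sz /= size_rcons ltnS.
apply: leq_trans (lenM _ _ _ _) _; rewrite len_prodl //.
suff : len (ev (x' * x)) <= 1 by lia.
rewrite -(mul1g (ev _)); have -> : 1%N = (len 1).+1 by rewrite len1.
apply: (@len_ev _ g2 _ _ sg b).
move: rl; rewrite /red /= all_rcons /= => /andP[/andP[/andP[sx _] /andP[/andP[sx' _] _]] _].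
exact: sdM.
Qed.
End turn_count.

(* [X] vanishes on one side of an axis of [s] and is constant on the other up to
   finitely many cosets; invariance on the right expresses that the curve [s]
   has no self-crossings. *)
Definition almost_invariant (G : groupType) (s : G) (X : G -> int) : Prop :=
  (forall y, X (s * y) = X y) /\
  (forall h, exists L : seq G, forall y, X (y * h) <> X y ->
     exists2 x, x \in L & exists p, y = zpow s p * x).

(** The last clause says that [X] is not constant off finitely many cosets of [<s>], so that the
    axis really separates. Only the group structure is mentioned, which makes the notion invariant
    under automorphisms. *)
Definition simple (G : groupType) (s : G) : Prop :=
  exists X, [/\ almost_invariant s X, forall y, X (y * s) = X y &
    forall k (L : seq G), exists2 y, X y <> k &
      forall x p, x \in L -> y <> zpow s p * x].

(** * Behaviour of simple elements under automorphisms and inversion *)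

Lemma simple_morph (G : groupType) (f h : G -> G) (s : G) :
  {morph f : x y / x * y} -> {morph h : x y / x * y} -> cancel f h -> cancel h f ->
  simple s -> simple (f s).
Proof.
move=> fM hM fK hK [X [[Xl Xf] Xr Xn]]; exists (X \o h); split=> /=; first split=> [y|k].
- by rewrite /= hM fK Xl.
- have [L LP] := Xf (h k); exists (map f L) => y /=; rewrite hM => /LP[x xL [p yE]].
  exists (f x); first by apply/mapP; exists x.
  by exists p; rewrite -(zpow_morph _ _ fM) -fM -yE hK.
- by move=> y; rewrite hM fK Xr.
- move=> k L; have [y yk yL] := Xn k (map h L); exists (f y); first by rewrite fK.
  move=> x p xL fyE; apply: (yL (h x) p); first by apply/mapP; exists x.
  by rewrite -(fK y) fyE hM (zpow_morph _ _ hM) fK.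
Qed.

Lemma simpleJ (G : groupType) (p s : G) : simple s -> simple (p * s * p^-1).
Proof.
apply: (@simple_morph _ (fun x => p * x * p^-1) (fun x => p^-1 * x * p)) => x.
- by move=> y; rewrite !mulgA mulgVK.
- by move=> y; rewrite -!mulgA mulVKg.
- by rewrite !mulgA mulVg mul1g mulgVK.
- by rewrite !mulgA mulgV mul1g mulgK.
Qed.

Lemma almost_invariantV (G : groupType) (s : G) X :
  almost_invariant s X -> almost_invariant s^-1 X.
Proof.
case=> Xl Xf; split=> [y|h]; first by rewrite -Xl mulVKg.
have [L LP] := Xf h; exists L => y /LP[x xL [p ->]]; exists x => //.
by exists (- p)%R; rewrite zpowV zpowN invgK.
Qed.

Lemma simpleV (G : groupType) (s : G) : simple s -> simple s^-1.
Proof.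
case=> X [Xa Xr Xn]; exists X; split=> [|y|k L]; first exact: almost_invariantV.
  by rewrite -(Xr (_ / _)) mulgVK.
have [y yk yL] := Xn k L; exists y => // x p /yL yx.
by rewrite zpowV -zpowN.
Qed.

Lemma almost_invariantJ (G : groupType) (s q : G) X :
  almost_invariant s X -> almost_invariant (q^-1 * s * q) (fun y => X (q * y)).
Proof.
case=> Xl Xf; split=> [y|h]; first by rewrite !mulgA mulgV mul1g -mulgA Xl.
have [L LP] := Xf h; exists (map (fun x => q^-1 * x) L) => y.
rewrite mulgA => /LP[x xL [p yE]]; exists (q^-1 * x); first by apply/mapP; exists x.
exists p; have -> : zpow (q^-1 * s * q) p = q^-1 * zpow s p * q.
  rewrite -(@zpow_morph _ _ (fun x => q^-1 * x * q)) // => u v.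
  by rewrite -!mulgA mulVKg.
by rewrite !mulgA mulgK -mulgA -yE mulKg.
Qed.

Lemma zpow_inv_l (G : groupType) (s : G) X p y :
  almost_invariant s X -> X (zpow s p * y) = X y.
Proof.
case=> Xl _; elim/int_rect: p => [|n IH|n IH]; first by rewrite mul1g.
  by rewrite zpow_nat expgS -mulgA Xl.
by rewrite -Xl zpow_natN expgSr invgM -mulgA mulVKg -zpow_natN.
Qed.

(** * Almost invariant functions and the lines translated from the boundary curve *)

Section main.
Context (g : nat) (g2 : 1 < g) (G : groupType) (E : nat -> G).
Context (sg : surface_group g E).
Local Notation cc := (cc g).
Local Notation sd := (sd g).
Local Notation inC := (inC g).
Local Notation ev := (ev E).
Local Notation cG := (cG g E).
Local Notation prodl := (prodl E).
Local Notation len := (len g2 sg).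
Local Notation red := (red g).
Local Notation cyc := (cyc g).
Local Notation a := (letter 0).
Implicit Types (b : bool) (x u : fg) (l : seq (bool * fg)) (n m : int) (y : G).
Implicit Types (X : G -> int).

Let EV : forall i, E (linv i) = (E i)^-1. Proof. by case: sg. Qed.

Lemma cGD n m : cG (n + m)%R = cG n * cG m.
Proof. by rewrite /cG zpowD. Qed.

Lemma red_join p l q l' : red (p :: l) -> red (q :: l') -> (last p l).1 != q.1 ->
  red ((p :: l) ++ q :: l').
Proof. by rewrite lastI red_catE => -> -> ->. Qed.

Lemma cyc_last p l : cyc (p :: l) -> (last p l).1 != p.1.
Proof. by move=> /andP[_]; rewrite {1}lastI red_catE => /and3P[]. Qed.

Lemma cycE p l : red (p :: l) -> (last p l).1 != p.1 -> cyc (p :: l).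
Proof. by move=> rl pl; apply/andP; split=> //; exact: red_join. Qed.

Definition pw k l := flatten (nseq k l).

Lemma red_pw p l q l' k : cyc (p :: l) -> red (q :: l') -> p.1 = q.1 ->
  red (pw k (p :: l) ++ q :: l').
Proof.
move=> cl rl pq; elim: k => [//|k IH]; rewrite /pw /= -catA -/(pw k (p :: l)).
have rl0 := cyc_red cl; have := cyc_last cl.
case rE : (pw k (p :: l) ++ q :: l') IH => [|q' l''] IH; first by rewrite cats0.
have : q'.1 = p.1 by case: (k) rE => [|k'] [<- _].
by move=> <- e; apply: red_join.
Qed.

Lemma prodl_pw k l : prodl (pw k l) = prodl l ^+ k.
Proof.
elim: k => [|k IH]; first by rewrite /prodl big_nil.
by rewrite /pw /= prodl_cat -/(pw k l) IH expgS.
Qed.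

Lemma size_pw k l : size (pw k l) = (k * size l)%N.
Proof. by elim: k => [//|k IH]; rewrite /pw /= size_cat -/(pw k l) IH mulSn. Qed.

Lemma cyc_rot p l : cyc (p :: l) -> cyc (rcons l p).
Proof.
move=> cl; have := cyc_red cl; have := cyc_last cl.
case: l cl => [|q l] cl; first by rewrite /= eqxx.
rewrite /= => lp rl; have rql : red (q :: l) by exact: (@red_cat g [:: p] _ rl).2.
have rp : red [:: p] by exact: (@red_cat g [:: p] (q :: l) rl).1.
have pq : p.1 != q.1 by move: rl => /andP[_ /=] /andP[].
apply: cycE; last by rewrite last_rcons.
by rewrite -rcons_cons -cats1; exact: red_join.
Qed.

Lemma cyc_invl p l : cyc (p :: l) -> exists l', invl (p :: l) = ((last p l).1, (last p l).2^-1) :: l' /\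
  last ((last p l).1, (last p l).2^-1) l' = (p.1, p.2^-1) /\ cyc (invl (p :: l)).
Proof.
move=> cl; have ri := red_invl (cyc_red cl); have pl := cyc_last cl.
move: ri; rewrite /invl lastI map_rcons rev_rcons; set q := (_, _); set l' := rev _ => ri.
have lE : last q l' = (p.1, p.2^-1).
  have := erefl (invl (p :: l)); rewrite {2}/invl /= rev_cons.
  rewrite /invl lastI map_rcons rev_rcons -/q -/l' => e.
  by have := congr1 (last p) e; rewrite /= last_rcons.
exists l'; split=> //; split=> //; apply: cycE => //.
by rewrite lE /= eq_sym.
Qed.

Lemma size_invl l : size (invl l) = size l.
Proof. by rewrite /invl size_rev size_map. Qed.

Lemma len_zpow l k : cyc l -> len (zpow (prodl l) k) = (size l * `|k|)%N.
Proof.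
move=> cl; have h l1 (n : nat) : cyc l1 -> len (prodl l1 ^+ n) = (size l1 * n)%N.
  case: l1 => [//|p l1] cl1; rewrite -prodl_pw len_prodl ?size_pw 1?mulnC //.
  case: n => [//|n]; rewrite -addn1 /pw nseqD flatten_cat /= cats0.
  exact: red_pw (cyc_red cl1) _.
case: k => k /=; first exact: h.
rewrite -expVgn -(prodl_invl sg) h ?size_invl //.
by case: l cl => // p l /cyc_invl[? [? []]].
Qed.

(* Words leaving the axis of [prodl l] do not become shorter by translation. *)
Lemma leave_axis b x u l l' k : cyc ((b, x) :: l) -> red ((b, u) :: l') ->
  ~ inC b (x^-1 * u) ->
  size ((b, u) :: l') <= len (zpow (prodl ((b, x) :: l)) k * prodl ((b, u) :: l')).
Proof.
move=> cl rl xu; case: k => k.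
  rewrite zpow_nat -prodl_pw -prodl_cat len_prodl; last exact: red_pw.
  by rewrite size_cat leq_addl.
have [l1 [iE [lE ci]]] := cyc_invl cl.
rewrite /= -expVgn -(prodl_invl sg) -prodl_pw -prodl_cat.
set i := invl _ in iE ci *.
have iE2 : i = rcons (belast ((last (b, x) l).1, (last (b, x) l).2^-1) l1) (b, x^-1).
  by rewrite iE lastI lE.
set s0 := belast _ _ in iE2.
rewrite -[k.+1]addn1 /pw nseqD flatten_cat /= cats0 -/(pw k i) {2}iE2.
have ru : red [:: (b, u)] by exact: (@red_cat g [:: (b, u)] _ rl).1.
have rx : red [:: (b, x)] by exact: (@red_cat g [:: (b, x)] _ (cyc_red cl)).1.
have gv : red ((b, x^-1 * u) :: l').
  move: rl; rewrite /red /= => /andP[/andP[/andP[su _] ->] sl'].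
  move: rx; rewrite /red /= !andbT => /andP[sx _].
  rewrite {1}/goodb /= sdM ?sdV // asboolT //=.
  by case: (l') sl'.
have -> : prodl ((pw k i ++ rcons s0 (b, x^-1)) ++ (b, u) :: l') =
          prodl ((pw k i ++ s0) ++ (b, x^-1 * u) :: l').
  by rewrite !prodl_cat prodl_rcons !prodl_cons /= evM // !mulgA.
have s0i : pw k i ++ i = rcons (pw k i ++ s0) (b, x^-1) by rewrite {2}iE2 rcons_cat.
have rs : red (rcons (pw k i ++ s0) (b, x^-1)).
  rewrite -s0i iE; apply: red_pw; rewrite -?iE //; exact: cyc_red.
rewrite len_prodl ?size_cat ?leq_addl //=.
case: (lastP (pw k i ++ s0)) rs => [//|s1 r].
rewrite -[rcons (rcons _ _) _]cats1 red_catE => /and3P[rs _ rb].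
by rewrite red_catE rs gv.
Qed.

(** Both ends of the line [y <c>] carry the value [r]. A quiet line is one whose ends are not
    separated by the axis, as far as [X] can tell; the others are called loud. *)
Definition lim X y (r : int) := exists N : nat, forall m, N <= `|m| -> X (y * cG m) = r.
Definition quiet X y := exists r, lim X y r.

Lemma lim_uniq X y r r' : lim X y r -> lim X y r' -> r = r'.
Proof.
move=> [N NP] [N' NP']; rewrite -(NP (Posz (maxn N N'))) ?leq_maxl //.
by rewrite NP' // leq_maxr.
Qed.

Lemma lim_cG X y n r : lim X y r -> lim X (y * cG n) r.
Proof.
move=> [N NP]; exists (N + `|n|)%N => m Nm; rewrite -mulgA -cGD; apply: NP.
by lia.
Qed.

Lemma quiet_cG X y n : quiet X (y * cG n) <-> quiet X y.
Proof.
split=> -[r yr]; exists r; last exact: lim_cG.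
by have := lim_cG (- n)%R yr; rewrite -mulgA -cGD GRing.subrr cG0 mulg1.
Qed.

Lemma steady X y : (forall m, X (y * cG (m + 1)%R) = X (y * cG m)) ->
  forall m, X (y * cG m) = X y.
Proof.
move=> st; elim/int_rect => [|n IH|n IH]; first by rewrite cG0 mulg1.
  by rewrite -[n.+1]addn1 PoszD st.
by rewrite -st -IH; congr (X (_ * cG _)); lia.
Qed.

(** [X] changes along a line only at finitely many cosets [<s> x]. A line that meets one of them has
    a translate by a power of [s] that passes through [x], and [len] is constant on lines, so this
    translate has the length of [x]. *)
Lemma loud_len s X : almost_invariant s X -> exists M, forall y,
  (forall p, M < len (zpow s p * y)) -> forall m, X (y * cG m) = X y.
Proof.
case=> _ /(_ (cG 1)) [L LP]; exists (\max_(x <- L) len x) => y yM.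
apply: steady => m; rewrite cGD mulgA; apply: contrapT => /LP[x xL [p yE]].
have := yM (- p)%R; rewrite ltnNge => /negP; apply.
rewrite -(len_cG g2 sg _ m) -mulgA yE zpowN mulKg.
exact: (leq_bigmax_seq x).
Qed.

Section along_axis.
Context (l : seq (bool * fg)) (cl : cyc l) (X : G -> int).
Local Notation s := (prodl l).
Context (sX : almost_invariant s X).

Lemma bounded_powers (L : seq G) (K : nat) : exists B : nat, forall (x : G) p, x \in L ->
  len (zpow s p * x) <= K -> `|p| <= B.
Proof.
exists (K + \max_(x <- L) len x^-1)%N => x p xL xK.
have := lenM g2 sg (zpow s p * x) x^-1; rewrite mulgK len_zpow //.
have : len x^-1 <= \max_(x <- L) len x^-1 by exact: (leq_bigmax_seq x).
have : 0 < size l by case/andP: cl.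
move: xK; set A := len _; set D := len _; set F := \max_(_ <- _) _; nia.
Qed.

(** The length of [s^p] grows linearly in [p], so a coset [<s> x] contains only finitely many
    elements of bounded length, and an injective family meets it finitely often. *)
Lemma finite_fibers (T : choiceType) (t0 : T) (P : T -> Prop) (f : T -> G) (sz : T -> nat)
    (L : seq G) (K : nat) :
  (forall t t', P t -> P t' -> f t = f t' -> t = t') ->
  (forall t, P t -> len (f t) <= K) ->
  exists M, forall t, P t -> M <= sz t ->
    forall (x : G) p, x \in L -> f t <> zpow s p * x.
Proof.
move=> fI fK; have [B BP] := bounded_powers L K.
pose inv (x : G) p := xget t0 [set t | P t /\ f t = zpow s p * x].
exists (\max_(x <- L) \max_(i <- iota 0 B.+1) maxn (sz (inv x (Posz i))) (sz (inv x (- Posz i)%R))).+1.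
move=> t Pt + x p xL ft; rewrite ltnNge => /negP; apply.
have pB : `|p| <= B by apply: (BP x) => //; rewrite -ft fK.
have <- : inv x p = t.
  rewrite /inv; case: xgetP => [t' _ [Pt' ft']|/(_ t) []//].
  by apply: fI => //; rewrite ft.
apply: leq_trans (leq_bigmax_seq x xL isT).
apply: leq_trans (_ : maxn (sz (inv x (Posz `|p|))) (sz (inv x (- Posz `|p|)%R)) <= _).
  rewrite leq_max; have [<-|<-] : (Posz `|p| = p \/ - Posz `|p| = p)%R by lia.
    by rewrite absz_id leqnn.
  by rewrite abszN absz_id leqnn orbT.
apply: (leq_bigmax_seq `|p|%N) => //.
by rewrite mem_iota; lia.
Qed.

Lemma coboundary_gens : exists L : seq G, forall t y, t < 4 * g -> X (y * E t) <> X y ->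
  exists2 x : G, x \in L & exists p, y = zpow s p * x.
Proof.
case: sX => _ Xf; have /choice[L LP] : forall t, exists L : seq G, forall y, X (y * E t) <> X y ->
  exists2 x : G, x \in L & exists p, y = zpow s p * x by move=> t; exact: Xf.
exists (flatten [seq L t | t <- iota 0 (4 * g)]) => t y tg /LP[x xL yE].
by exists x => //; apply/flatten_mapP; exists t => //; rewrite mem_iota.
Qed.

(** A translate of a vertex group has bounded length in the amalgam. By [finite_fibers] it meets the
    cosets where a generator changes [X] only in finitely many, hence short, words. *)
Lemma locally_constant b y : exists M, forall u t, sd b u ->
  slo b <= t < slo b + 4 * srk g b -> M <= size u ->
  X (y * ev (u * letter t)) = X (y * ev u).
Proof.
have [L LP] := coboundary_gens.
have [||M MP] := @finite_fibers fg 1 (fun u => sd b u) (fun u => y * ev u) (fun u => size u) L (len y).+1.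
- by move=> u v su sv /mulgI; exact: (@ev_inj _ g2 _ _ sg b).
- by move=> u su; apply: (len_ev g2 sg y su).
exists M => u t su tb uM; rewrite evM // ev_letter mulgA; apply: contrapT.
have tg : t < 4 * g by move: tb; rewrite /slo /srk; case: (b); lia.
by move=> /(LP _ _ tg)[x xL [p]]; exact: (MP u su uM x p xL).
Qed.

Lemma two_limits y : exists N r r', forall m : nat, N <= m ->
  X (y * cG m) = r /\ X (y * cG (- m%:Z)%R) = r'.
Proof.
case: (sX) => _ /(_ (cG 1)) [L LP].
have [||N NP] := @finite_fibers int 0%R (fun m => True) (fun m => y * cG m) (fun m => `|m|%N) L (len y).
- move=> n m _ _ /mulgI; rewrite -!(ev_cc g2 sg true) => /(ev_inj g2 sg (sdcn _ true _) (sdcn _ true _)).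
  exact: cc_inj.
- by move=> m _; rewrite len_cG.
have st m : N <= `|m| -> X (y * cG (m + 1)%R) = X (y * cG m).
  move=> Nm; rewrite cGD mulgA; apply: contrapT => /LP[x xL [p]].
  exact: (NP m I Nm x p xL).
exists N.+1, (X (y * cG N)), (X (y * cG (- N.+1%:Z)%R)) => m Nm; split.
  elim: m Nm => // m IH Nm; rewrite -[m.+1]addn1 PoszD st; last by lia.
  have [<-//|ne] := eqVneq N m; first by apply: IH; lia.
elim: m Nm => // m IH Nm; have [<-//|ne] := eqVneq N m.
rewrite -(IH _); last by lia.
rewrite -(st (- m.+1%:Z)%R); last by lia.
by congr (X (_ * cG _)); lia.
Qed.
End along_axis.
Lemma size_fgM (x u : fg) : size (x * u : fg) <= size x + size u.
Proof.
rewrite -{1}(wdK u); elim/last_ind: (fgw u) => [|r t IH].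
  by rewrite /wd big_nil mulg1 addn0.
rewrite wd_rcons mulgA size_rcons addnS; have [h _] := size_fgM_letter (x * wd r) t.
by apply: leq_trans h _; rewrite ltnS.
Qed.

Lemma size_cn b n : `|n| <= size (zpow (cc b) n).
Proof.
rewrite zpow_cc size_bdry_zpow ?slo4 ?srk0 //.
by have := srk0 g2 b; case: b => /= h; nia.
Qed.

(** Quietness of the other lines at the vertex and [locally_constant] are the hypotheses of
    [eventually_const]. The line of [y] itself may be loud a priori, but the circle of ends cut at a
    single line is still connected, so it turns out quiet as well. *)
Lemma vertex_lim l X b y : cyc l -> almost_invariant (prodl l) X ->
  (forall u, sd b u -> ~ inC b u -> quiet X (y * ev u)) ->
  exists r, forall u, sd b u -> lim X (y * ev u) r.
Proof.
move=> cl sX yq; have [M MP] := locally_constant cl sX b y.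
have [||r rP] := @eventually_const (slo b) (srk g b) (slo4 b) (srk0 g2 b) (fun u => X (y * ev u)) M.
- by move=> u t su tb uM _; exact: MP.
- move=> u su uC; have [|r [N NP]] := yq u su.
    by case=> n un; case/(inC_bdry g b u): (ex_intro _ n un : inC b u) => m um; exact: (uC m).
  exists N => m Nm; rewrite -zpow_nat -zpow_natN !evM //.
  have e (k : int) : ev (zpow (bdry (slo b) (srk g b)) k) = cG (if b then k else - k)%R.
    by rewrite -(ev_cc g2 sg b) zpow_cc; case: (b) => //; rewrite GRing.opprK.
  by rewrite !e !mulgA !NP //; case: (b); lia.
exists r => u su; exists (M + size u)%N => m Mm.
rewrite -(ev_cc g2 sg b) -mulgA -evM // rP //; first by apply: sdM => //; exact: sdcn.
have := size_fgM u^-1 (u * zpow (cc b) m); rewrite mulKg.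
have -> : size (u^-1 : fg) = size u by rewrite /= /invw size_rev size_map.
by have := size_cn b m; lia.
Qed.

(** A change of [X] across one line has to be undone across another line at the same vertex. *)
Lemma loud_next l X b y : cyc l -> almost_invariant (prodl l) X -> ~ quiet X y ->
  exists2 u, sd b u /\ ~ inC b u & ~ quiet X (y * ev u).
Proof.
move=> cl sX ny; apply: contrapT => h; apply: ny.
have [|r rP] := @vertex_lim l X b y cl sX.
  move=> u su uC; apply: contrapT => nu; apply: h; by exists u.
by exists r; have := rP 1 isT; rewrite ev1 mulg1.
Qed.

Lemma red1 b u : sd b u -> ~ inC b u -> red [:: (b, u)].
Proof. by move=> su uC; rewrite /red /= !andbT; apply/andP; split=> //; apply/asboolP. Qed.

Lemma loud_ray l X q l' k : cyc l -> almost_invariant (prodl l) X -> red (q :: l') ->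
  ~ quiet X (prodl (q :: l')) ->
  exists l'', [/\ size l'' = k, red (q :: l' ++ l'') & ~ quiet X (prodl (q :: l' ++ l''))].
Proof.
move=> cl sX rq nq; elim: k => [|k [l'' [sz rq' nq']]].
  by exists [::]; rewrite cats0.
have [u [su uC] nu] := loud_next (~~ (last q (l' ++ l'')).1) cl sX nq'.
exists (rcons l'' (~~ (last q (l' ++ l'')).1, u)); rewrite size_rcons sz; split=> //.
  rewrite -rcons_cat -rcons_cons -cats1; apply: red_join => //.
    exact: red1.
  by case: (last _ _).1.
by rewrite -rcons_cat -rcons_cons prodl_rcons.
Qed.

(** A loud line off the axis would start a ray of loud lines ([loud_ray]), all the longer under
    every translation by [leave_axis], and far out this contradicts [loud_len]. *)
Lemma off_axis_quiet l X b x u l' : cyc ((b, x) :: l) ->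
  almost_invariant (prodl ((b, x) :: l)) X -> red ((b, u) :: l') ->
  ~ inC b (x^-1 * u) -> quiet X (prodl ((b, u) :: l')).
Proof.
move=> cl sX rl xu; apply: contrapT => nq.
have [M MP] := loud_len sX.
have [l'' [sz rl' nq']] := loud_ray M cl sX rl nq.
apply: nq'; exists (X (prodl ((b, u) :: l' ++ l''))), 0 => m _; apply: MP => p.
by apply: leq_trans (leave_axis p cl rl' xu); rewrite /= size_cat sz ltnS leq_addl.
Qed.

(** Past a gate off the axis all lines are quiet, so [vertex_lim] passes the same limit from each
    vertex to the next. *)
Lemma off_axis_lim l X b x u l' r : cyc ((b, x) :: l) ->
  almost_invariant (prodl ((b, x) :: l)) X -> red ((b, u) :: l') ->
  ~ inC b (x^-1 * u) -> lim X (ev u) r -> lim X (prodl ((b, u) :: l')) r.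
Proof.
move=> cl sX rl xu ur; elim/last_ind: l' rl => [|l' [b' v] IH] rl.
  by rewrite /prodl big_seq1.
have [rl0 rv] : red ((b, u) :: l') /\ red [:: (b', v)].
  by apply: red_cat; rewrite cats1.
have bb : (last (b, u) l').1 != b'.
  by move: rl; rewrite -rcons_cons -cats1 lastI red_catE => /and3P[].
have [r' r'P] : exists r', forall w, sd b' w -> lim X (prodl ((b, u) :: l') * ev w) r'.
  apply: (vertex_lim cl sX) => w sw wC.
  rewrite -(prodl_rcons E (b', w)); apply: (off_axis_quiet cl sX) => //.
  by rewrite -rcons_cons -cats1; apply: red_join => //; exact: red1.
rewrite -rcons_cons prodl_rcons /=.
have -> : r = r'.
  apply: (lim_uniq (IH rl0)); have := r'P 1 isT; by rewrite ev1 mulg1.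
by apply: r'P; move: rv; rewrite /red /= !andbT => /andP[].
Qed.

(** Far out, [X] is constant on whole lines by [loud_len], so its values there, and not only its
    limits, are those of the gate. *)
Lemma off_axis_value l X b x u : cyc ((b, x) :: l) ->
  almost_invariant (prodl ((b, x) :: l)) X -> exists K : nat, forall l' r,
  red ((b, u) :: l') -> ~ inC b (x^-1 * u) -> K <= size l' -> lim X (ev u) r ->
  X (prodl ((b, u) :: l')) = r.
Proof.
move=> cl sX; have [M MP] := loud_len sX; exists M => l' r rl xu Ml ur.
have [N NP] := off_axis_lim cl sX rl xu ur.
rewrite -(NP N) //; apply/esym/MP => p.
by apply: leq_trans (leave_axis p cl rl xu).
Qed.

(** A vertex on the axis has only two lines that the axis uses. If the first is quiet, so is the
    second by [vertex_lim], since the rest are off the axis; quietness thus travels along the axis.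
    A word either leaves the axis, where [off_axis_quiet] applies, or follows it for one syllable,
    after which the axis is translated. *)
Lemma all_quiet k l X l' : cyc l -> almost_invariant (prodl l) X -> quiet X 1 ->
  red l' -> size l' <= k -> quiet X (prodl l').
Proof.
elim: k l X l' => [|k IH] l X [|[b u] l'] cl sX q1 rl' //=; try by rewrite /prodl big_nil.
rewrite ltnS => szk.
have ru : red [:: (b, u)] by exact: (@red_cat g [:: (b, u)] _ rl').1.
have rl0 : red l' by exact: (@red_cat g [:: (b, u)] _ rl').2.
(* Passing to the inverse of [s] follows the axis in the other direction, which starts in the other
   factor. *)
wlog [x [l0 lE]] : l cl sX / exists x l0, l = (b, x) :: l0.
  move=> wl; case: l cl sX => [//|[b1 x1] l1] cl sX.
  have [bb|bb] := eqVneq b1 b.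
    by apply: wl cl sX _; rewrite bb; eexists; eexists.
  have [l2 [iE [_ ci]]] := cyc_invl cl; have lb := cyc_last cl.
  apply: wl ci _ _; first by rewrite (prodl_invl sg); exact: almost_invariantV.
  rewrite iE; eexists; eexists; congr ((_, _) :: _).
  by move: lb bb; rewrite /=; case: (last _ _).1; case: (b1); case: (b).
rewrite {l}lE in cl sX.
have [xu|xu] := pselect (inC b (x^-1 * u)); last exact: (off_axis_quiet cl sX).
have [n un] := xu; have uE : u = x * zpow (cc b) n by rewrite -un mulVKg.
have sx : sd b x by move: (cyc_red cl) => /andP[/andP[/andP[]]].
(* Seen from the gate of [x], the axis belongs to the cyclic word rotated by one syllable. *)
pose X1 y := X (ev x * y).
have X1inv : almost_invariant (prodl (rcons l0 (b, x))) X1.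
  have := almost_invariantJ (ev x) sX; rewrite prodl_cons /= mulKg.
  by rewrite prodl_rcons.
have X1q : quiet X1 1.
  have [|r rP] := @vertex_lim _ X b (ev x) cl sX.
    move=> v sv vC; have [[m xv]|xvC] := pselect (inC b (x * v)).
      rewrite -evM // xv ev_cc //.
      by have := (@quiet_cG X 1 m).2 q1; rewrite mul1g.
    rewrite -evM //; have := @off_axis_quiet l0 X b x (x * v) [::] cl sX.
    rewrite mulKg /prodl big_seq1; apply=> //; apply: red1 => //; exact: sdM.
  exists r; have [N NP] := rP 1 isT; exists N => m Nm.
  by rewrite /X1 mul1g -(NP m Nm) ev1 mulg1.
have qX y : quiet X1 y -> quiet X (ev x * y).
  by move=> [r [N NP]]; exists r, N => m Nm; rewrite -mulgA; exact: NP.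
rewrite prodl_cons /= uE evM // ev_cc // -mulgA; apply: qX.
case: l' rl0 szk {rl'} => [|[b' v] l'] rl0 szk.
  rewrite /prodl big_nil mulg1.
  by have := (@quiet_cG X1 1 n).2 X1q; rewrite mul1g.
rewrite (cG_prodl g2 sg); apply: (IH (rcons l0 (b, x))) => //.
  exact: cyc_rot.
exact: red_cons_cc.
Qed.

(** All lines being quiet, a common limit [r] spreads to every line through the generators. A line
    containing a value other than [r] also contains a jump, so it passes through a coset [<s> x]
    with [x] from a finite list; the convergence along the line of [x] bounds how far from [x] such
    a jump can be. *)
Lemma not_simple_of_quiet l X : cyc l -> almost_invariant (prodl l) X -> quiet X 1 ->
  exists k (L : seq G), forall y, X y <> k ->
    exists2 x : G, x \in L & exists p, y = zpow (prodl l) p * x.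
Proof.
move=> cl sX q1.
have qt y : quiet X y.
  have [l' [n [rl' _ ->]]] := normal_form g2 sg y.
  exact/quiet_cG/(all_quiet cl sX q1 rl' (leqnn _)).
have [r rP] := q1; exists r.
have limr y : lim X y r.
  have step y' i : i < 4 * g -> lim X y' r -> lim X (y' * E i) r.
    move=> ig yr; have [|r' r'P] := @vertex_lim l X (side_of i) y' cl sX; first by [].
    have -> : r = r' by apply: (lim_uniq yr); have := r'P 1 isT; rewrite ev1 mulg1.
    by rewrite -(ev_letter E i); apply: r'P; exact: sd_letter.
  have [_ _ gen _] := sg.
  suff : forall z y', lim X y' r <-> lim X (y' * z) r.
    by move=> /(_ y 1)[h _]; rewrite -(mul1g y); exact: h.
  apply: gen => [y'|x z IHx IHz y'|x IH y'|i ig y'].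
  - by rewrite mulg1.
  - by rewrite IHx IHz mulgA.
  - by rewrite (IH (y' * x^-1)) mulgVK.
  - split; first exact: step.
    move=> h; rewrite -(mulgK (E i) y') -EV; apply: step => //.
    by have := linvP i; lia.
case: (sX) => _ /(_ (cG 1)) [L LP].
have /choice[N NP] : forall y, exists N : nat, forall m, N <= `|m| -> X (y * cG m) = r.
  by move=> y; exact: limr.
exists (flatten [seq [seq z * cG (Posz i) | i <- iota 0 (N z)] ++
                     [seq z * cG (- Posz i)%R | i <- iota 0 (N z)] | z <- L]) => y yr.
have [m ym] : exists m, X (y * cG (m + 1)%R) <> X (y * cG m).
  apply: contrapT => st; apply: yr.
  rewrite -(NP y (N y)) //; apply/esym/steady => m.
  by apply: contrapT => ne; apply: st; exists m.
rewrite cGD mulgA in ym; have [x xL [p yE]] := LP _ ym.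
have yE' : y = zpow (prodl l) p * (x * cG (- m)%R).
  by rewrite mulgA -yE -mulgA -cGD GRing.subrr cG0 mulg1.
exists (x * cG (- m)%R); last by exists p.
apply/flatten_mapP; exists x => //.
have mN : `|m| < N x.
  rewrite ltnNge; apply/negP => Nm; apply: yr.
  by rewrite yE' (zpow_inv_l _ _ sX) NP // abszN.
rewrite mem_cat; apply/orP; have [m0|m0] : (m = - Posz `|m| \/ m = Posz `|m|)%R by lia.
  left; apply/mapP; exists `|m|%N; first by rewrite mem_iota; lia.
  by rewrite {1}m0 GRing.opprK.
right; apply/mapP; exists `|m|%N; first by rewrite mem_iota; lia.
by rewrite {1}m0.
Qed.
End main.

(** * Simple elements make no square turns; the resulting bounds *)

Section bounded_generation.
Context (g : nat) (g2 : 1 < g) (G : groupType) (E : nat -> G).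
Context (sg : surface_group g E).
Local Notation cc := (cc g).
Local Notation sd := (sd g).
Local Notation inC := (inC g).
Local Notation ev := (ev E).
Local Notation cG := (cG g E).
Local Notation prodl := (prodl E).
Local Notation len := (len g2 sg).
Local Notation nf := (nf g2 sg).
Local Notation red := (red g).
Local Notation cyc := (cyc g).
Local Notation lim := (lim g E).
Local Notation quiet := (quiet g E).
Local Notation a := (letter 0).
Implicit Types (b : bool) (x u : fg) (l : seq (bool * fg)) (n m : int) (y : G).
Implicit Types (X : G -> int).

Let EV : forall i, E (linv i) = (E i)^-1. Proof. by case: sg. Qed.

Lemma sda i : sd true (a ^+ i). Proof. exact: (@sideX 0 1). Qed.

Lemma aC i : 0 < i < 4 -> ~ inC true (a ^+ i).
Proof. by move=> i4 [n]; exact: apow_notin. Qed.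

(** The axis of [s] uses the gates of [1] and [a^2], and its translate by [a] those of [a] and
    [a^3]. Right invariance gives [X] the value [X (ev a)] at [a s^p] for all [p], hence the same
    limit at the gates of [a] and [a^3]. A jump of [X] at the gate of [a^2] would make these two
    limits differ. *)
Lemma no_square_turn l X : cyc ((true, a ^+ 2) :: l) ->
  almost_invariant (prodl ((true, a ^+ 2) :: l)) X ->
  (forall y, X (y * prodl ((true, a ^+ 2) :: l)) = X y) -> quiet X 1.
Proof.
move=> cl sX Xr; set L := _ :: l in cl sX Xr *; set s := prodl L in sX Xr *.
have Xz p y : X (y * s ^+ p) = X y.
  by elim: p => [|p IH]; rewrite ?mulg1 // expgSr mulgA Xr IH.
have rL := cyc_red cl; have lL := cyc_last cl.
have off i : i = 1%N \/ i = 3 -> ~ inC true ((a ^+ 2)^-1 * a ^+ i).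
  case=> ->; last by rewrite (expgnDr a 2 1) mulKg; exact: aC.
  move/inCV; rewrite invgM invgK (expgnDr a 1 1) expg1 mulKg.
  exact: (@aC 1).
have ri i : 0 < i < 4 -> red [:: (true, a ^+ i)].
  by move=> i4; apply: red1; [exact: sda | exact: aC].
have gate i : i = 1%N \/ i = 3 -> exists r, lim X (ev (a ^+ i)) r.
  move=> i13; have := @off_axis_quiet _ g2 _ _ sg l X true _ (a ^+ i) [::] cl sX.
  by rewrite /prodl big_seq1; apply; [apply: ri; case: i13 => -> | exact: off].
have [r1 r1P] := gate 1%N (or_introl erefl).
have [r3 r3P] := gate 3 (or_intror erefl).
(* The reduced word used here spells [a s^-(K+1)] and runs through the gate of [a]. *)
have e1 : r1 = X (ev a).
  have [K KP] := off_axis_value g2 sg (a ^+ 1) cl sX.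
  have [l' [iE [_ ci]]] := cyc_invl cl; rewrite -/L in iE ci.
  have rw : red ((true, a ^+ 1) :: pw K (invl L) ++ invl L).
    have := red_pw; move: iE ci; case: (invl L) => // q l1 [qE _] ci rp.
    have := rp g q l1 q l1 K ci (cyc_red ci) erefl.
    case wE : (pw K (q :: l1) ++ q :: l1) => [|q' w] rw; first exact: ri.
    have q'q : q' = q by case: (K) wE => [|k] [].
    apply: (@red_join _ _ [::] _ _ (ri 1%N isT) rw).
    by rewrite q'q qE /= eq_sym.
  have := KP _ r1 rw (off _ (or_introl erefl)). rewrite prodl_cons prodl_cat prodl_pw.
  rewrite (prodl_invl sg) -expgSr => <- //.
    rewrite /= expg1 expVgn -(Xz K.+1 (_ / _)) mulgVK //.
  by rewrite size_cat size_pw size_invl /=; nia.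
(* The word beginning with [a^3] spells [a s^(K+2)]: its first syllable is [a] times the first
   syllable of [s]. *)
have e3 : r3 = X (ev a).
  have [K KP] := off_axis_value g2 sg (a ^+ 3) cl sX.
  have rw : red ((true, a ^+ 3) :: l ++ pw K L ++ L).
    have := @red_pw g _ _ _ _ K cl rL erefl; rewrite -/L.
    case wE : (pw K L ++ L) => [|q' w] rw.
      by move: (congr1 size wE); rewrite size_cat /= addnS.
    have q'q : q'.1 = true by case: (K) wE => [|k] [<-].
    have r3l : red ((true, a ^+ 3) :: l).
      move: rL (ri 3 isT); rewrite /red /= => /andP[/andP[_ ->] sl] /andP[/andP[-> _] _] /=.
      by case: (l) sl.
    rewrite -cat_cons; apply: (@red_join _ _ _ _ _ r3l rw).
    rewrite q'q; move: lL; rewrite -/L /=.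
    by case: (l) => [|p l0] /=; rewrite ?eqxx.
  have := KP _ r3 rw (off _ (or_intror erefl)); rewrite prodl_cons !prodl_cat prodl_pw.
  rewrite -expgSr => <- //; last by rewrite !size_cat size_pw /=; nia.
  have -> : ev (a ^+ 3) = ev a * ev (a ^+ 2) by rewrite -evM // (expgS a 2).
  rewrite -mulgA [ev (a ^+ 2) * _]mulgA -(prodl_cons E (true, a ^+ 2)) -/L -/s -expgS.
  by rewrite Xz.
have [N [v [v' NP]]] := two_limits g2 sg cl sX (ev (a ^+ 2)).
have [M MP] := locally_constant g2 sg cl sX true 1.
(* The correction cancels the jump of [X] at the gate of [a^2]. Only the line of [1] can still carry
   a jump, which [eventually_const] permits. *)
pose f u := (X (ev u) + (v - v') * between u)%R.
have [||r rP] := @eventually_const 0 1 erefl isT f (maxn M 4).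
- move=> u t su tb; rewrite !geq_max => /andP[uM u4] /andP[_ ut4].
  by rewrite /f between_letter // -(mul1g (ev (_ * _))) MP // mul1g.
- move=> u su uC; have [[n un]|ua2] := pselect (exists n, u = a ^+ 2 * zpow (bdry 0 1) n).
    exists (N + `|n|).+1%N => m Nm.
    have ev_a2 k : ev (a ^+ 2 * zpow (bdry 0 1) k) = ev (a ^+ 2) * cG k.
      by rewrite -(ev_cc g2 sg true) -evM.
    have uM k : u * zpow (bdry 0 1) k = a ^+ 2 * zpow (bdry 0 1) (n + k)%R.
      by rewrite un -mulgA zpowD.
    rewrite -(zpow_nat (bdry 0 1) m) -(zpow_natN (bdry 0 1) m) !uM /f !between_a2C.
    rewrite !ev_a2.
    have [p1 _] := NP (absz (n + m)%R) ltac:(lia).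
    have [_ p2] := NP (absz (n - Posz m)%R) ltac:(lia).
    rewrite (_ : Posz (absz (n + m)%R) = n + m)%R in p1; last by lia.
    rewrite (_ : - Posz (absz (n - Posz m)%R) = n - Posz m)%R in p2; last by lia.
    rewrite p1 p2; lia.
  have uC' : ~ inC true u by case=> n un; exact: (uC n).
  have ua : ~ inC true ((a ^+ 2)^-1 * u).
    by case=> n un; apply: ua2; exists n; rewrite -[zpow _ _]un mulVKg.
  have [r' [N' N'P]] : quiet X (ev u).
    have := @off_axis_quiet _ g2 _ _ sg l X true _ u [::] cl sX.
    by rewrite /prodl big_seq1; apply => //; apply: red1.
  have [N'' N''P] := between_const uC (fun n h => ua2 (ex_intro _ n h)).
  exists (maxn N' N'') => m; rewrite geq_max => /andP[m1 m2].
  rewrite /f N''P //; congr (_ + _)%R.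
  rewrite -(zpow_nat (bdry 0 1) m) -(zpow_natN (bdry 0 1) m) !evM //.
  rewrite -[bdry 0 1]/(cc true) !(ev_cc g2 sg true).
  by rewrite !N'P // abszN.
have big i m : i = 1%N \/ i = 3 -> (maxn M 4 + 3 <= `|m|)%N ->
    (X (ev (a ^+ i) * cG m)%g + (v - v') * between (a ^+ i * zpow (bdry 0 1) m)%g = r)%R.
  move=> i13 mM; rewrite -(ev_cc g2 sg true) -evM //; apply: rP.
    by apply: sideM; [exact: sda | exact: (sdcn g true)].
  have := size_fgM (a ^+ i)^-1 (a ^+ i * zpow (cc true) m); rewrite mulKg.
  have -> : size ((a ^+ i)^-1 : fg) = i by rewrite /= /invw size_rev size_map fgw_apow size_nseq.
  have := size_cn g2 true m; rewrite -[zpow (bdry 0 1) m]/(zpow (cc true) m).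
  have : i <= 3 by case: i13 => ->.
  by move: (size _) (size _) => A B; lia.
(* The correction amounts to [v - v'] at the gate of [a] and to 0 at that of [a^3]. As [r1 = r3],
   this gives [v = v'], so [X] itself is eventually constant on the first factor. *)
have l1 : (r1 + (v - v') = r)%R.
  have [N1 N1P] := r1P; set m := Posz (N1 + maxn M 4 + 3).+1.
  rewrite -(big 1%N m (or_introl erefl)); last by lia.
  have -> : between (a ^+ 1 * zpow (bdry 0 1) m) = 1%R by rewrite (between_aC m).
  by rewrite N1P ?GRing.mulr1 //; lia.
have l3 : (r3 = r)%R.
  have [N1 N1P] := r3P; set m := Posz (N1 + maxn M 4 + 3).+1.
  rewrite -(big 3 m (or_intror erefl)); last by lia.
  by rewrite N1P ?between_a3C //; lia.
exists r, (maxn M 4)%N => m mM; rewrite mul1g -(ev_cc g2 sg true) -(rP (zpow (cc true) m)).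
- by rewrite /f (_ : v - v' = 0)%R; lia.
- exact: (sdcn g true).
- exact: leq_trans mM (size_cn _ _ _).
Qed.
(** After conjugation by a power of [c], the powers of [c] on both sides of [a^2] are absorbed by
    the neighbouring syllables, and [no_square_turn] applies. *)
Lemma no_turn x l : cyc ((true, x) :: l) -> turn g 2 x ->
  ~ simple (prodl ((true, x) :: l)).
Proof.
move=> cl [n [m xE]] sp; have ll := cyc_last cl; have rl := cyc_red cl.
have [l1 [r1 p1 e1]] : exists l1, [/\ red ((true, x) :: l1), prodl l1 = cG m * prodl l &
    (last (true, x) l1).1 = (last (true, x) l).1].
  case: l ll rl {cl sp} => [|[b y] l] ll rl; first by rewrite eqxx in ll.
  exists ((b, zpow (cc b) m * y) :: l); split; last by case: (l).
    by have := @red_dcos g [:: (true, x)] b y m 0 l rl; rewrite mulg1.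
  by rewrite -(cG_prodl g2 sg).
have [l2 [r2 p2 e2]] : exists l2, [/\ red ((true, x) :: l2), prodl l2 = prodl l1 * cG n &
    (last (true, x) l2).1 = (last (true, x) l1).1].
  case/lastP: l1 r1 e1 {p1} => [|l1 [b y]] r1 e1; first by rewrite -e1 eqxx in ll.
  exists (rcons l1 (b, y * zpow (cc b) n)); split; last by rewrite !last_rcons.
    by rewrite -rcons_cons; exact: red_rcons_cc.
  by rewrite (prodl_cG g2 sg).
have r3 : red ((true, a ^+ 2) :: l2).
  have -> : a ^+ 2 = zpow (cc true) (- n)%R * x * zpow (cc true) (- m)%R.
    by rewrite xE !zpowN -!mulgA mulKg mulgV mulg1.
  exact: (@red_dcos g [::]).
have c3 : cyc ((true, a ^+ 2) :: l2).
  apply: cycE => //; rewrite -e1 -e2 in ll; move: ll; case: (l2) => //=.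
have sE : prodl ((true, a ^+ 2) :: l2) = (cG n)^-1 * prodl ((true, x) :: l) * (cG n)^-1^-1.
  rewrite invgK !prodl_cons p2 p1 /= xE !evM // !(ev_cc g2 sg true).
  by rewrite -!mulgA mulKg.
have [X [sX Xr Xn]] := simpleJ (cG n)^-1 sp; rewrite -sE in sX Xr Xn.
have [k [L LP]] := not_simple_of_quiet g2 sg c3 sX (no_square_turn c3 sX Xr).
have [y yk yL] := Xn k L; have [z zL [p yE]] := LP y yk.
exact: yL zL yE.
Qed.

(** Rotating the cyclic word, which is a conjugation, puts any syllable first; inverting the word
    turns [a^-2] into [a^2]. *)
Lemma simple_turn_free l : cyc l -> simple (prodl l) -> forall p, p \in l -> lam g p = 0%R.
Proof.
move=> cl sl p pl; have [l1 [l2 lE]] : exists l1 l2, l = l1 ++ p :: l2.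
  by case/splitPr: pl => l1 l2; exists l1, l2.
have [c2 s2] : cyc (p :: l2 ++ l1) /\ simple (prodl (p :: l2 ++ l1)).
  rewrite {}lE in cl sl {pl}; elim: l1 l2 cl sl => [|q l1 IH] l2 cl sl; first by rewrite cats0.
  have -> : l2 ++ q :: l1 = (rcons l2 q) ++ l1 by rewrite cat_rcons.
  apply: IH; first by rewrite -rcons_cons -rcons_cat; exact: cyc_rot.
  rewrite -rcons_cons -rcons_cat prodl_rcons.
  have := simpleJ (ev q.2)^-1 sl; rewrite invgK cat_cons prodl_cons.
  by rewrite mulKg.
case: p c2 s2 {pl lE} => -[] x c2 s2; last by [].
rewrite /lam /turn2 /=; case: asboolP => [t|_]; first by case: (no_turn c2 t s2).
case: asboolP => // t.
have c3 : cyc (invl (rcons (l2 ++ l1) (true, x))).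
  have := cyc_rot c2; case: (rcons _ _) => // q l' /cyc_invl[? [_ []]] //.
have s3 : simple (prodl (invl (rcons (l2 ++ l1) (true, x)))).
  rewrite (prodl_invl sg); apply: simpleV; rewrite prodl_rcons.
  by have := simpleJ (ev x)^-1 s2; rewrite invgK prodl_cons mulKg.
move: c3 s3; rewrite /invl map_rcons rev_rcons => c3 s3.
by case: (no_turn c3 (turnV t) s3).
Qed.
(** A cyclically reduced representative counts at most 1, when it is a single syllable, and 0
    otherwise. Conjugating back costs the defect 3 twice, the contributions of [p] and [p^-1] being
    opposite. *)
Lemma simple_turns2 s : simple s -> `|turns2 g2 sg s| <= 7.
Proof.
move=> ss; have [p [y [sE yP]]] := cyclic_reduction g2 sg s.
have : `|turns2 g2 sg y| <= 1.
  case: yP => [[b [u [su ->]]]|[l cl yE]].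
    have [[n un]|uC] := pselect (inC b u); first by rewrite un ev_cc // turns2_cG0.
    have := turns2_prodl g2 sg (red1 su uC); rewrite {1}/prodl big_seq1 /= => ->.
    by rewrite suml_cons suml_nil GRing.addr0 lam_le.
  have sy : simple (prodl l).
    by have := simpleJ p^-1 ss; rewrite sE invgK -yE !mulgA mulVg mul1g mulgVK.
  rewrite yE (turns2_prodl g2 sg (cyc_red cl)) /suml big_seq big1 // => q.
  exact: simple_turn_free.
have := turns2_quasi g2 sg (p * y) p^-1; have := turns2_quasi g2 sg p y.
rewrite turns2V -sE.
by move: (turns2 _ _ s) (turns2 _ _ (p * y)) (turns2 _ _ p) (turns2 _ _ y) => A B C D; lia.
Qed.

(** Each factor contributes at most 7 and each multiplication a defect of at most 3. *)
Lemma prod_simple_turns2 (s : seq G) : (forall y, y \in s -> simple y) ->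
  `|turns2 g2 sg (\prod_(x <- s) x)| <= 10 * size s.
Proof.
elim: s => [|x s IH] ss; first by rewrite big_nil -[1]/(cG 0%R) turns2_cG0.
rewrite big_cons /=; have := turns2_quasi g2 sg x (\prod_(x <- s) x).
have := simple_turns2 (ss x (mem_head _ _)).
have := IH (fun y ys => ss y (mem_behead (s := x :: s) ys)).
by move: (turns2 _ _ _) (turns2 _ _ (x * _)) (turns2 _ _ x) => A B C; lia.
Qed.

Lemma turns2_unbounded (n : nat) : turns2 g2 sg ((ev (a ^+ 2) * ev (letter 4)) ^+ n) = n.
Proof.
have r : red [:: (true, a ^+ 2); (false, letter 4)].
  apply: (@red_join g _ [::] (false, letter 4) [::]) => //.
    by apply: red1; [exact: sda | exact: aC].
  apply: red1; first by have := sd_letter g2 (i := 4); apply; lia.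
  case=> m /(congr1 (fun u : fg => size u)).
  by rewrite zpow_cc size_bdry_zpow ?slo4 ?srk0 //=; lia.
have c : cyc [:: (true, a ^+ 2); (false, letter 4)] by exact: cycE.
have <- : prodl [:: (true, a ^+ 2); (false, letter 4)] = ev (a ^+ 2) * ev (letter 4).
  by rewrite !prodl_cons /= /prodl big_nil mulg1.
rewrite -prodl_pw turns2_prodl; last first.
  case: n => [//|n]; rewrite -addn1 /pw nseqD flatten_cat /= -/(pw n _).
  exact: red_pw c r _.
elim: n => [|n IH]; first exact: suml_nil.
rewrite /pw /= -/(pw n _) !suml_cons IH /lam /turn2 /= asboolT; last first.
  by exists 0%R, 0%R; rewrite mul1g mulg1.
by lia.
Qed.
End bounded_generation.

(** * The polygon generators are simple *)

Section generators.
Context (g : nat) (g2 : 1 < g) (G : groupType) (E : nat -> G).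
Context (sg : surface_group g E).
Local Notation cc := (cc g).
Local Notation sd := (sd g).
Local Notation inC := (inC g).
Local Notation ev := (ev E).
Local Notation cG := (cG g E).
Local Notation prodl := (prodl E).
Local Notation len := (len g2 sg).
Local Notation nf := (nf g2 sg).
Local Notation red := (red g).
Implicit Types (b : bool) (x u : fg) (l : seq (bool * fg)) (n m : int) (y : G).

Let EV : forall i, E (linv i) = (E i)^-1. Proof. by case: sg. Qed.

Lemma letter_notinC b i : ~ inC b (letter i).
Proof.
case=> m /(congr1 (fun u : fg => size u)).
by rewrite zpow_cc size_bdry_zpow ?slo4 ?srk0 //=; have := srk0 g2 b; nia.
Qed.

Lemma red_replace l b x v : red (rcons l (b, x)) -> sd b v -> ~ inC b v -> red (rcons l (b, v)).
Proof.
case/lastP: l => [|l q] rl sv vC; first exact: red1.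
move: rl; rewrite -![rcons (rcons _ _) _]cats1 !red_catE => /and3P[-> _ ->].
by rewrite andbT; apply: red1.
Qed.

(** Multiplication on the right by an element of a factor affects only the last syllable, so [q]
    survives unless it is that syllable and lies in the same factor. *)
Lemma red_extend q l b n v : red (q :: l) -> sd b v -> (l <> [::] \/ q.1 <> b) ->
  exists l' m, red (q :: l') /\ prodl l * cG n * ev v = prodl l' * cG m.
Proof.
move=> rl sv lq; case/lastP: l rl lq => [|l [b0 x]] rl lq.
  have qb : q.1 != b by apply/eqP; case: lq.
  have [[m vm]|vC] := pselect (inC b v).
    by exists [::], (n + m)%R; rewrite vm ev_cc // -mulgA -cGD.
  exists [:: (b, zpow (cc b) n * v)], 0%R; split; last first.
    by rewrite /prodl big_nil big_seq1 mul1g /= evM // ev_cc // mulg1.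
  apply: (@red_join g q [::]) => //; apply: red1; last by move/inCMl.
  by apply: sdM => //; exact: sdcn.
have [sx _] : sd b0 x /\ ~ inC b0 x.
  move: rl; rewrite -rcons_cons /red all_rcons => /andP[/andP[/andP[sx /asboolP xC] _] _].
  by split.
have [bb|bb] := eqVneq b0 b.
  rewrite {}bb {lq} in rl sx *; have sw : sd b (x * zpow (cc b) n * v).
    by rewrite !sdM // sdcn.
  have e : prodl (rcons l (b, x)) * cG n * ev v = prodl l * ev (x * zpow (cc b) n * v).
    by rewrite prodl_rcons /= !evM // ev_cc // !mulgA.
  have [[m vm]|vC] := pselect (inC b (x * zpow (cc b) n * v)).
    exists l, m; rewrite e vm ev_cc //; split=> //.
    by move: rl; rewrite -rcons_cons -cats1 => /red_cat[].
  exists (rcons l (b, x * zpow (cc b) n * v)), 0%R; rewrite e prodl_rcons mulg1; split=> //.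
  by move: rl; rewrite -!rcons_cons => /red_replace; apply.
have [[m vm]|vC] := pselect (inC b v).
  by exists (rcons l (b0, x)), (n + m)%R; rewrite vm ev_cc // -mulgA -cGD.
exists (rcons (rcons l (b0, x * zpow (cc b0) n)) (b, v)), 0%R; split; last first.
  by rewrite !prodl_rcons /= evM // ev_cc // mulg1 !mulgA.
rewrite -rcons_cons -[rcons (_ :: _) _]cats1 -rcons_cons red_catE.
apply/and3P; split=> //; last exact: red1.
exact: red_rcons_cc.
Qed.

Lemma fgw_letterX q (m : nat) : letter q ^+ m = nseq m q :> seq nat.
Proof.
elim: m => [//|m IH]; rewrite expgS.
have -> : (letter q * letter q ^+ m : fg) = push q (letter q ^+ m : fg) :> seq nat by [].
rewrite IH; case: m {IH} => [//|m] /=.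
by case: eqP => // e; have := linv_neq (esym e).
Qed.

Section dual_curve.
Context (i : nat) (ig : i < 4 * g) (i2 : i %% 4 < 2).
Local Notation b := (side_of i).
Local Notation z := (dual_letter i).

(** The axis of [E i] lies in the tree of one vertex group, which [htree] cuts in two; the rest of
    the group is sorted by the first syllable, stored last. The default [(~~ b, 1)] makes powers of
    [c] count as outside the half-tree. *)
Definition first_side y : int :=
  let q := last (~~ b, 1) (nf y).1 in ((q.1 == b) && htree i z q.2 : bool).

Let htree_cc u n : htree i z (u * zpow (cc b) n) = htree i z u.
Proof.
have h u' : htree i z (u' * bdry (slo b) (srk g b)) = htree i z u'.
  apply: htree_bdry => //; [exact: slo4 | exact: srk0 |].
  by rewrite /slo /srk /side_of; case: ltnP; lia.
rewrite zpow_cc; set k := (if _ then _ else _); elim/int_rect: k => [|k IH|k IH].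
- by rewrite mulg1.
- by rewrite zpow_nat expgSr mulgA h -zpow_nat.
- by rewrite -h -mulgA zpow_natN expgS invgM mulgVK -zpow_natN.
Qed.

(** The syllable [letter i] in the hypothesis is a device: it states that [l] is reduced and does
    not start in the factor [b], without separating the case of empty [l]. *)
Lemma first_sideE u l n : sd b u -> red ((b, letter i) :: l) ->
  first_side (ev u * prodl l * cG n) = htree i z u.
Proof.
move=> su rl; rewrite /first_side nf_cG /=.
have hd : forall q l', red (q :: l') -> last (~~ b, 1) (nf (prodl (q :: l'))).1 = (q.1, rep g q.1 q.2).
  by move=> [b' x] l' rl'; exact: last_nf_prodl.
have [[m um]|uC] := pselect (inC b u); last first.
  rewrite -(prodl_cons E (b, u)) hd /= ?eqxx /=; last first.
    case: l rl => [|q l] rl; first exact: red1.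
    apply: (@red_join g (b, u) [::] q l) => //; first exact: red1.
      exact: (@red_cat g [:: (b, letter i)] _ rl).2.
    by move: rl => /andP[_ /=] /andP[].
  by have [m ->] := repP g b u; rewrite htree_cc.
have -> : htree i z u = false by rewrite um -[zpow _ _]mul1g htree_cc.
rewrite um ev_cc //; case: l rl => [|[b' x] l] rl.
  rewrite /prodl big_nil mulg1 -(mul1g (cG m)) nf_cG nf1 /=.
  by case: (b).
rewrite (cG_prodl g2 sg) hd /=; last first.
  exact/red_cons_cc/(@red_cat g [:: (b, letter i)] _ rl).2.
by move: rl => /andP[_ /=] /andP[/negbTE]; rewrite eq_sym => ->.
Qed.

Lemma first_decomp y : exists u l n, [/\ sd b u, red ((b, letter i) :: l) &
  y = ev u * prodl l * cG n].
Proof.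
have rb : red [:: (b, letter i)].
  by apply: red1; [exact: sd_letter | exact: letter_notinC].
have [l [n [rl _ ->]]] := normal_form g2 sg y.
case: l rl => [|[b' x] l] rl.
  by exists 1, [::], n; rewrite ev1 mul1g; split.
have [bb|bb] := eqVneq b' b.
  rewrite bb {b' bb} in rl *; exists x, l, n; rewrite prodl_cons; split=> //.
    by move: rl => /andP[/andP[/andP[]]].
  case: l rl => [//|q l] rl; apply: (@red_join g _ [::]) => //.
    exact: (@red_cat g [:: (b, x)] _ rl).2.
  by move: rl => /andP[_ /=] /andP[].
exists 1, ((b', x) :: l), n; rewrite ev1 mul1g; split=> //.
by apply: (@red_join g _ [::]) => //=; rewrite eq_sym.
Qed.

(** Only a letter of the factor [b], applied to an element of that factor, can alter the first
    syllable beyond its coset; [htree_letter] then finds the edge at the axis. *)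
Lemma first_side_letter y j : j < 4 * g -> first_side (y * E j) <> first_side y ->
  exists p, (y = zpow (E i) p /\ j = z) \/ (y = zpow (E i) p * (E j)^-1 /\ j = linv z).
Proof.
move=> jg; have [u [l [n [su rl ->]]]] := first_decomp y.
have sj := sd_letter g2 jg.
have zpE p : ev (zpow (letter i) p) = zpow (E i) p by rewrite (ev_zpow EV) ev_letter.
have [lj|lj] := pselect (l <> [::] \/ b <> side_of j).
  have [l' [m [rl' e]]] := red_extend n rl sj lj.
  have -> : ev u * prodl l * cG n * E j = ev u * prodl l' * cG m.
    by rewrite -[_ * cG m]mulgA -e ev_letter !mulgA.
  by rewrite !first_sideE.
have l0 : l = [::] by apply: contrapT => ?; apply: lj; left.
have bj : b = side_of j by apply: contrapT => ?; apply: lj; right.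
rewrite {}l0 -{}bj {lj} in rl sj *.
have r1 : red [:: (b, letter i)] by exact: (@red_cat g [:: (b, letter i)] _ rl).1.
have -> : ev u * prodl [::] * cG n = ev (u * zpow (cc b) n) * prodl [::] * cG 0%R.
  by rewrite /prodl big_nil !mulg1 evM // ev_cc // mulg1.
set v := u * _; have sv : sd b v by apply: sdM => //; exact: sdcn.
have -> : ev v * prodl [::] * cG 0%R * E j = ev (v * letter j) * prodl [::] * cG 0%R.
  by rewrite /prodl big_nil !mulg1 evM // ev_letter.
rewrite !first_sideE // /prodl ?big_nil ?mulg1; last exact: sdM.
have [->//|] := eqVneq (htree i z (v * letter j)) (htree i z v).
move=> /htree_letter[[[p ->] jz]|[[p vE] jz]] _; exists p; [left|right]; split=> //.
by rewrite -(mulgK (letter j) v) vE evM // zpE letterV ev_letter EV.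
Qed.

Lemma first_side_inv y : first_side (E i * y) = first_side y.
Proof.
have [u [l [n [su rl ->]]]] := first_decomp y.
rewrite -(ev_letter E i) !mulgA -evM // !first_sideE //; last first.
  by apply: sdM => //; exact: sd_letter.
by rewrite -{1}[letter i]/(zpow (letter i) 1) htree_zpowM.
Qed.

Lemma first_side_almost : almost_invariant (E i) first_side.
Proof.
split; first exact: first_side_inv.
have [_ _ gen _] := sg; apply: gen => [|x y [L1 L1P] [L2 L2P]|x [L LP]|j jg].
- by exists [::] => y; rewrite mulg1.
- exists (L1 ++ map (fun w => w * x^-1) L2) => w; rewrite mulgA => ne.
  have [e|ne'] := eqVneq (first_side (w * x)) (first_side w); last first.
    by have [w' w'L ?] := L1P _ (elimN eqP ne'); exists w' => //; rewrite mem_cat w'L.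
  have [w' w'L [p wE]] : exists2 x0, x0 \in L2 & exists p, w * x = zpow (E i) p * x0.
    by apply: L2P; rewrite e.
  exists (w' * x^-1); last by exists p; rewrite mulgA -wE mulgK.
  by rewrite mem_cat; apply/orP; right; apply/mapP; exists w'.
- exists (map (fun w => w * x) L) => w ne.
  have [w' w'L [p wE]] : exists2 x0, x0 \in L & exists p, w * x^-1 = zpow (E i) p * x0.
    by apply: LP; rewrite mulgVK => /esym.
  exists (w' * x); last by exists p; rewrite mulgA -wE mulgVK.
  by apply/mapP; exists w'.
- exists [:: 1; (E j)^-1] => y /(first_side_letter jg)[p [] [-> _]].
    by exists 1; [rewrite inE eqxx | exists p; rewrite mulg1].
  by exists (E j)^-1; [rewrite !inE eqxx orbT | exists p].
Qed.

(** The edges where [first_side] jumps carry [z] or [linv z], never [i], whence the right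
    invariance. The powers of [z] lie on one side and those of [linv z] on the other, so one of the
    two families avoids the value [k]. *)
Lemma simple_low : simple (E i).
Proof.
exists first_side; split; first exact: first_side_almost.
  move=> y; apply: contrapT => /(first_side_letter ig)[p []] [_ iz].
    by move: iz; rewrite /dual_letter; case: (i %% 4 =P 0); lia.
  by have := linvP z; rewrite -iz /dual_letter; case: (i %% 4 =P 0); lia.
move=> k L.
have [q [qz qX]] : exists q, (q = z \/ q = linv z) /\
    forall m : nat, first_side (ev (letter q ^+ m.+1)) <> k.
  have h q (m : nat) : (q = z \/ q = linv z) -> first_side (ev (letter q ^+ m.+1)) = (q == z).
    move=> qz; have sq : sd b (letter q).
      rewrite /sd side_letter; have := linvP z; move: qz ig i2; rewrite /slo /srk /side_of /dual_letter.
      by case: (ltnP i 4); case: (i %% 4 =P 0); lia.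
    have qi : q \notin [:: i; linv i].
      by rewrite !inE; have := linvP z; have := linvP i; move: qz; rewrite /dual_letter; case: (i %% 4 =P 0); lia.
    have sqm : sd b (letter q ^+ m.+1) by exact: sideX.
    have r1 : red [:: (b, letter i)].
      by apply: red1; [exact: sd_letter | exact: letter_notinC].
    have := first_sideE 0 sqm r1; rewrite /prodl big_nil !mulg1 => ->.
    by rewrite fgw_letterX /= htree_cons (negbTE qi).
  have [->|k1] := eqVneq k 1%R.
    exists (linv z); split=> [|m]; first by right.
    rewrite h; last by right.
    by case: eqP => // e; have := linv_neq e.
  exists z; split=> [|m]; first by left.
  by rewrite h; [rewrite eqxx => e; move: k1; rewrite -e|left].
apply: contrapT => no.
have /choice[f fP] : forall m : nat, exists w : G, w \in L /\ exists p, ev (letter q ^+ m.+1) = zpow (E i) p * w.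
  move=> m; apply: contrapT => nx; apply: no; exists (ev (letter q ^+ m.+1)) => // x p xL e.
  by apply: nx; exists x; split=> //; exists p.
(* Left multiplication by powers of [letter i] keeps the exponent sum of [q], so distinct powers of
   [q] lie in distinct cosets and a finite list cannot contain them all. *)
have fI : injective f.
  move=> m m'; have [_ [p pE]] := fP m; have [_ [p' pE']] := fP m' => e.
  have : letter q ^+ m.+1 = zpow (letter i) (p - p')%R * letter q ^+ m'.+1.
    have sq : sd b (letter q).
      rewrite /sd side_letter; have := linvP z; move: qz ig i2; rewrite /slo /srk /side_of /dual_letter.
      by case: (ltnP i 4); case: (i %% 4 =P 0); lia.
    apply: (@ev_inj _ g2 _ _ sg b); [exact: sideX | |].
      apply: sdM; last exact: sideX.
      exact: (side_zpow (slo4 _) _ (sd_letter g2 ig)).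
    rewrite evM // (ev_zpow EV) ev_letter pE pE' -e mulgA -zpowD.
    by congr (zpow _ _ * _); lia.
  move=> /(congr1 (fun u : fg => esum q u)); rewrite (esumM g2) -!zpow_nat !(esum_zpow g2).
  rewrite {1 2 3}/esum !big_seq1 eqxx.
  have -> : (i == q) = false.
    by apply/eqP; have := linvP z; have := linvP i; move: qz; rewrite /dual_letter; case: (i %% 4 =P 0); lia.
  have -> : (i == linv q) = false.
    by apply/eqP; have := linvP z; have := linvP q; have := linvP i; move: qz; rewrite /dual_letter; case: (i %% 4 =P 0); lia.
  by lia.
have sub : {subset map f (iota 0 (size L).+1) <= L}.
  by move=> x /mapP[m _ ->]; have [] := fP m.
have := uniq_leq_size _ sub.
by rewrite map_inj_uniq // iota_uniq size_map size_iota ltnn => /(_ isT).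
Qed.
End dual_curve.

Lemma simple_gen i : i < 4 * g -> simple (E i).
Proof.
move=> ig; have [i2|i2] := ltnP (i %% 4) 2; first exact: simple_low.
rewrite -(linvK i) EV; apply/simpleV/simple_low; have := linvP i; lia.
Qed.

Lemma not_bounded_simple (C : nat) : exists y, forall s : seq G,
  (forall w, w \in s -> simple w) -> y = \prod_(x <- s) x -> C < size s.
Proof.
exists ((ev (letter 0 ^+ 2) * ev (letter 4)) ^+ (10 * C).+1)%N => s ss yE.
have := prod_simple_turns2 g2 sg ss; by rewrite -yE turns2_unbounded /=; lia.
Qed.
End generators.

Local Close Scope group_scope.
Import Order.TTheory GRing.Theory Num.Theory.
Import numFieldNormedType.Exports.

Local Open Scope classical_set_scope.
Local Open Scope ring_scope.

(** * Intervals, and paths up to homotopy with fixed ends *)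

Section interval.
Context {R : realType}.

(** Connectedness of the segment. It takes the place of subdivisions and Lebesgue numbers in the
    arguments along paths and homotopies. *)
Lemma locally_constant_prop (a b : R) (P : R -> Prop) :
  (forall t, a <= t <= b -> exists2 e : R, 0 < e & forall s s', a <= s <= b -> a <= s' <= b ->
     `|s - t| < e -> `|s' - t| < e -> P s -> P s') ->
  forall s t, a <= s <= b -> a <= t <= b -> P s -> P t.
Proof.
move=> lc s0 t0 s0I t0I Ps0; pose J t := a <= t <= b.
pose U (Q : R -> Prop) := \bigcup_(z in [set z : R * R | [/\ J z.1, 0 < z.2 &
   forall s, J s -> `|s - z.1| < z.2 -> Q s]]) ball z.1 z.2.
have oU Q : open (U Q) by apply: bigcup_open => z [_ z0 _]; exact: ball_open.
have UQ Q s : J s -> U Q s -> Q s.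
  by move=> Is [z [Iz z0 zQ]] zs; apply: zQ => //; rewrite distrC.
have cov s : J s -> (P s -> U P s) /\ (~ P s -> U (fun s => ~ P s) s).
  move=> Is; have [e e0 eP] := lc s Is.
  split=> Ps; exists (s, e); try exact: ballxx; split=> //= s' Is' ss'.
    by apply: (eP s s') => //; rewrite subrr normr0.
  by move=> Ps'; apply: Ps; apply: (eP s' s) => //; rewrite subrr normr0.
have Jab s : `[a, b]%classic s = J s by rewrite /= in_itv.
have := @segment_connected R a b (`[a, b]%classic `&` P) => h.
suff e : `[a, b]%classic `&` P = `[a, b]%classic.
  by have [] : (`[a, b]%classic `&` P) t0 by rewrite e Jab.
apply: h; first by exists s0; split; rewrite ?Jab.
  exists (U P) => //; apply/seteqP; split=> s []; rewrite Jab => Is.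
    by move=> Ps; split; rewrite ?Jab //; exact: (cov s Is).1.
  by move=> /(UQ _ _ Is); split; rewrite ?Jab.
exists (~` (U (fun s => ~ P s))); first exact: open_closedC.
apply/seteqP; split=> s []; rewrite Jab => Is.
  by move=> Ps; split; rewrite ?Jab // => /(UQ _ _ Is).
by move=> nU; split; rewrite ?Jab //; apply: contrapT => /(cov s Is).2.
Qed.

Definition clamp (a b t : R) : R := Num.max a (Num.min b t).

Lemma clamp_in a b t : a <= b -> a <= clamp a b t <= b.
Proof.
rewrite /clamp => ab; have [bt|bt] := leP b t; first by rewrite (max_r ab) ab lexx.
by case: (leP a t) => ?; rewrite ?lexx; lra.
Qed.

Lemma clamp_id a b t : a <= t <= b -> clamp a b t = t.
Proof. by rewrite /clamp => /andP[at_ tb]; rewrite min_r// max_r. Qed.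

Lemma continuous_clamp a b : continuous (clamp a b).
Proof.
apply: continuous_maxr; first by move=> t; exact: cvg_cst.
by apply: continuous_minr => t; [exact: cvg_cst | exact: cvg_id].
Qed.
End interval.

Lemma continuousT_comp (T U V : topologicalType) (f : T -> U) (h : U -> V) :
  continuous f -> continuous h -> continuous (h \o f).
Proof. by move=> cf ch x; apply: continuous_comp; [exact: cf | exact: ch]. Qed.

Lemma continuous_glue (R : realType) (T U : topologicalType) (u : T -> R) (c : R) (f h : T -> U) :
  continuous u -> continuous f -> continuous h -> (forall x, u x = c -> f x = h x) ->
  continuous (fun x => if u x <= c then f x else h x).
Proof.
move=> cu cf ch fh; apply/continuous_subspace_setT.
apply: within_glue; [exact: closedT | by [] | exact: continuous_subspaceT.. |].
by move=> x _; exact: fh.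
Qed.

Section paths.
Context {R : realType} {X : topologicalType}.
Implicit Types (f h k : R -> X) (p q : R -> R).
Local Notation cat := (@cat_fun R X).
Local Notation rev := (@rev_fun R X).

(** Paths and homotopies are continuous on the whole line or plane, which avoids subspace
    topologies; only the ends at 0 and 1 are held fixed. *)
Definition pheq f h : Prop := exists F : R * R -> X, [/\ continuous F,
  forall t, F (t, 0) = f t, forall t, F (t, 1) = h t &
  forall s, F (0, s) = f 0 /\ F (1, s) = f 1].

Lemma continuous_path_cat f h : continuous f -> continuous h -> f 1 = h 0 -> continuous (cat f h).
Proof.
move=> cf ch fh; apply: continuous_glue.
- by move=> t; exact: cvg_id.
- move=> t; apply: continuous_comp; last exact: cf.
  by apply: cvgM; [exact: cvg_cst | exact: cvg_id].
- move=> t; apply: continuous_comp; last exact: ch.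
  exact: continuous_affine.
- by move=> t ->; rewrite divff// subrr.
Qed.

Lemma continuous_path_rev f : continuous f -> continuous (rev f).
Proof.
move=> cf t; apply: continuous_comp; last exact: cf.
by apply: cvgB; [exact: cvg_cst | exact: cvg_id].
Qed.

Lemma cat0 f h : cat f h 0 = f 0.
Proof. by rewrite /cat_fun ifT ?mulr0// invr_ge0. Qed.
Lemma cat1 f h : cat f h 1 = h 1.
Proof. by rewrite /cat_fun ifF; [congr h; lra | apply/negbTE; rewrite -ltNge; lra]. Qed.
Lemma rev0 f : rev f 0 = f 1. Proof. by rewrite /rev_fun subr0. Qed.
Lemma rev1 f : rev f 1 = f 0. Proof. by rewrite /rev_fun subrr. Qed.

Lemma pheq_ends f h : pheq f h -> f 0 = h 0 /\ f 1 = h 1.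
Proof. by case=> F [_ _ Fh Fe]; rewrite -!Fh; have [] := Fe 1. Qed.

Lemma pheq_square (F : R * R -> X) (a b : R -> R * R) :
  continuous F -> continuous a -> continuous b -> a 0 = b 0 -> a 1 = b 1 ->
  pheq (F \o a) (F \o b).
Proof.
move=> cF ca cb ab0 ab1.
exists (F \o (fun z : R * R => ((1 - z.2) * (a z.1).1 + z.2 * (b z.1).1,
   (1 - z.2) * (a z.1).2 + z.2 * (b z.1).2))); split => /=.
- move=> z; apply: continuous_comp; last exact: cF.
  have c (pr : R * R -> R) : continuous pr -> continuous (fun z : R * R => (1 - z.2) * pr (a z.1) + z.2 * pr (b z.1)).
    move=> cpr {}z; apply: cvgD; apply: cvgM.
    + by apply: cvgB; [exact: cvg_cst | exact: cvg_snd].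
    + apply: (@cvg_comp _ _ _ fst (pr \o a)); first exact: cvg_fst.
      exact: (continuousT_comp ca cpr).
    + exact: cvg_snd.
    + apply: (@cvg_comp _ _ _ fst (pr \o b)); first exact: cvg_fst.
      exact: (continuousT_comp cb cpr).
  by apply: continuous_pair; apply: c => x; [exact: cvg_fst | exact: cvg_snd].
- by move=> t; rewrite subr0 !mul1r !mul0r !addr0; case: (a t).
- by move=> t; rewrite subrr !mul1r !mul0r !add0r; case: (b t).
- move=> s; rewrite -ab0 -ab1 -!mulrDl !subrK !mul1r.
  by case: (a 0); case: (a 1).
Qed.

Lemma pheq_reparam f p q : continuous f -> continuous p -> continuous q ->
  p 0 = q 0 -> p 1 = q 1 -> pheq (f \o p) (f \o q).
Proof.
move=> cf cp cq pq0 pq1.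
have c (r : R -> R) : continuous r -> continuous (fun t => (r t, 0 : R)).
  by move=> cr; apply: continuous_pair => // t; exact: cvg_cst.
apply: (@pheq_square (f \o fst) (fun t => (p t, 0)) (fun t => (q t, 0))).
- by move=> z; apply: continuous_comp; [exact: cvg_fst | exact: cf].
- exact: c.
- exact: c.
- by rewrite pq0.
- by rewrite pq1.
Qed.

Lemma pheq_eq f h : f = h -> continuous f -> pheq f h.
Proof.
by move=> <- cf; apply: (@pheq_reparam f id id) => // t; exact: cvg_id.
Qed.

Lemma pheq_refl f : continuous f -> pheq f f. Proof. exact: pheq_eq. Qed.

Lemma pheq_sym f h : pheq f h -> pheq h f.
Proof.
move=> fh; have [e0 e1] := pheq_ends fh; case: fh => F [cF Ff Fh Fe].
exists (F \o (fun z => (z.1, 1 - z.2))); split=> /=.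
- move=> z; apply: continuous_comp; last exact: cF.
  apply: continuous_pair => {}z; first exact: cvg_fst.
  by apply: cvgB; [exact: cvg_cst | exact: cvg_snd].
- by move=> t; rewrite subr0.
- by move=> t; rewrite subrr.
- by move=> s; rewrite -e0 -e1.
Qed.

Lemma pheq_trans f h k : pheq f h -> pheq h k -> pheq f k.
Proof.
move=> fh; have [e0 e1] := pheq_ends fh; case: fh => F [cF Ff Fh Fe].
case=> K [cK Kh Kk Ke].
have cc (d : R) : continuous (fun z : R * R => (z.1, 2 * z.2 + d)).
  apply: continuous_pair => z; first exact: cvg_fst.
  apply: (@cvg_comp _ _ _ snd (fun t => 2 * t + d)); first exact: cvg_snd.
  exact: continuous_affine.
exists (fun z => if z.2 <= 2^-1 then (F \o (fun z => (z.1, 2 * z.2 + 0))) z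
  else (K \o (fun z => (z.1, 2 * z.2 + (- 1)))) z); split=> /=.
- apply: (@continuous_glue R _ _ snd).
  + by move=> z; exact: cvg_snd.
  + by move=> z; apply: continuous_comp; [exact: cc | exact: cF].
  + by move=> z; apply: continuous_comp; [exact: cc | exact: cK].
  + by move=> [t s] /= ->; rewrite addr0 divff// subrr Fh Kh.
- by move=> t; rewrite ifT ?invr_ge0// mulr0 addr0.
- move=> t; rewrite ifF; last by apply/negbTE; rewrite -ltNge; lra.
  by rewrite (_ : _ + _ = 1) ?Kk//; lra.
- by move=> s; rewrite e0 e1; case: ifP => _; [rewrite -e0 -e1; exact: Fe | exact: Ke].
Qed.

Lemma pheq_cat f f' h h' : f 1 = h 0 -> pheq f f' -> pheq h h' -> pheq (cat f h) (cat f' h').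
Proof.
move=> fh [F [cF Ff Ff' Fe]] [K [cK Kh Kh' Ke]].
have cc (d : R) : continuous (fun z : R * R => (2 * z.1 + d, z.2)).
  apply: continuous_pair => z; last exact: cvg_snd.
  apply: (@cvg_comp _ _ _ fst (fun t => 2 * t + d)); first exact: cvg_fst.
  exact: continuous_affine.
exists (fun z => if z.1 <= 2^-1 then (F \o (fun z => (2 * z.1 + 0, z.2))) z
  else (K \o (fun z => (2 * z.1 + (- 1), z.2))) z); split=> /=.
- apply: (@continuous_glue R _ _ fst).
  + by move=> z; exact: cvg_fst.
  + by move=> z; apply: continuous_comp; [exact: cc | exact: cF].
  + by move=> z; apply: continuous_comp; [exact: cc | exact: cK].
  + move=> [t s] /= ->; rewrite addr0 divff// subrr.
    by rewrite (Fe s).2 (Ke s).1.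
- by move=> t; rewrite /cat_fun addr0 Ff Kh.
- by move=> t; rewrite /cat_fun addr0 Ff' Kh'.
- move=> s; rewrite cat0 cat1; split.
    by rewrite ifT ?invr_ge0// mulr0 addr0 (Fe s).1.
  rewrite ifF; last by apply/negbTE; rewrite -ltNge; lra.
  by rewrite (_ : 2 * 1 + _ = 1) ?(Ke s).2//; lra.
Qed.

Lemma pheq_catA f h k : continuous f -> continuous h -> continuous k ->
  f 1 = h 0 -> h 1 = k 0 -> pheq (cat (cat f h) k) (cat f (cat h k)).
Proof.
move=> cf ch ck fh hk.
have chk : continuous (cat h k) by exact: continuous_path_cat.
have c : continuous (cat f (cat h k)) by apply: continuous_path_cat; rewrite // cat0.
pose p (t : R) : R := Num.min (Num.min (2 * t + 0) (1 * t + 4^-1)) (2^-1 * t + 2^-1).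
have pE t : [\/ t <= 4^-1 /\ p t = 2 * t, 4^-1 < t <= 2^-1 /\ p t = t + 4^-1 |
    2^-1 < t /\ p t = 2^-1 * t + 2^-1].
  rewrite /p; case: (leP (2 * t + 0) (1 * t + 4^-1)) => ?;
    case: (leP _ (2^-1 * t + 2^-1)) => ?;
  first [apply: Or31; split; lra | apply: Or32; split; lra | apply: Or33; split; lra].
have -> : cat (cat f h) k = cat f (cat h k) \o p.
  apply/funext => t; rewrite /cat_fun /=; clear fh hk; case: (pE t) => -[? ->];
  by do !(case: ifP => [|/negbT]; rewrite -?ltNge => ?);
    first [exfalso; lra | congr (f _); lra | congr (h _); lra | congr (k _); lra].
apply: (@pheq_reparam _ p id) => //.
- by do 2?[apply: continuous_minr]; exact: continuous_affine.
- by move=> t; exact: cvg_id.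
- by case: (pE 0) => -[? ->]; lra.
- by case: (pE 1) => -[? ->]; lra.
Qed.

Lemma pheq_1cat f : continuous f -> pheq (cat (cst (f 0)) f) f.
Proof.
move=> cf; pose p (t : R) : R := Num.max (0 * t + 0) (2 * t + (-1)).
have -> : cat (cst (f 0)) f = f \o p.
  apply/funext => t; rewrite /cat_fun /p /Num.max /=.
  by do !(case: ifP => [|/negbT]; rewrite -?ltNge -?leNgt => ?);
    first [exfalso; lra | congr (f _); lra].
apply: (@pheq_reparam _ p id) => //.
- by apply: continuous_maxr; exact: continuous_affine.
- by move=> t; exact: cvg_id.
- rewrite /p /Num.max; by do !(case: ifP => [|/negbT]; rewrite -?ltNge -?leNgt => ?); lra.
- rewrite /p /Num.max; by do !(case: ifP => [|/negbT]; rewrite -?ltNge -?leNgt => ?); lra.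
Qed.

Lemma pheq_cat1 f : continuous f -> pheq (cat f (cst (f 1))) f.
Proof.
move=> cf; pose p (t : R) : R := Num.min (2 * t + 0) (0 * t + 1).
have -> : cat f (cst (f 1)) = f \o p.
  apply/funext => t; rewrite /cat_fun /p /Num.min /=.
  by do !(case: ifP => [|/negbT]; rewrite -?ltNge -?leNgt => ?);
    first [exfalso; lra | congr (f _); lra].
apply: (@pheq_reparam _ p id) => //.
- by apply: continuous_minr; exact: continuous_affine.
- by move=> t; exact: cvg_id.
- rewrite /p /Num.min; by do !(case: ifP => [|/negbT]; rewrite -?ltNge -?leNgt => ?); lra.
- rewrite /p /Num.min; by do !(case: ifP => [|/negbT]; rewrite -?ltNge -?leNgt => ?); lra.
Qed.

Lemma pheq_catV f : continuous f -> pheq (cat f (rev f)) (cst (f 0)).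
Proof.
move=> cf; pose p (t : R) : R := Num.min (2 * t + 0) ((-2) * t + 2).
have -> : cat f (rev f) = f \o p.
  apply/funext => t; rewrite /cat_fun /rev_fun /p /Num.min /=.
  by do !(case: ifP => [|/negbT]; rewrite -?ltNge -?leNgt => ?);
    first [exfalso; lra | congr (f _); lra].
rewrite -[cst (f 0)]/(f \o cst 0).
apply: (@pheq_reparam _ p) => //.
- by apply: continuous_minr; exact: continuous_affine.
- by move=> t; exact: cvg_cst.
- rewrite /p /Num.min; by do !(case: ifP => [|/negbT]; rewrite -?ltNge -?leNgt => ?); rewrite /=; lra.
- rewrite /p /Num.min; by do !(case: ifP => [|/negbT]; rewrite -?ltNge -?leNgt => ?); rewrite /=; lra.
Qed.

Lemma pheq_Vcat f : continuous f -> pheq (cat (rev f) f) (cst (f 1)).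
Proof.
move=> /[dup] cf /continuous_path_rev/pheq_catV; rewrite rev0.
by have -> : rev (rev f) = f by apply/funext => t; rewrite /rev_fun subKr.
Qed.
End paths.

(** * Classes of paths in the fundamental group *)

Section path_classes.
Context {R : realType} {X : topologicalType} (x0 : X).
Local Notation I := (`[0, 1]%classic : set R).
Local Notation cat := (@cat_fun R X).
Local Notation rev := (@rev_fun R X).
Local Notation pi1 := (pi1 R x0).
Local Open Scope quotient_scope.
Implicit Types (f h k : R -> X).

Definition is_loop f : Prop := [/\ continuous f, f 0 = x0 & f 1 = x0].

Definition loop_of f (fl : is_loop f) : loop R x0 :=
  let: And3 cf f0 f1 := fl in Loop (continuous_subspaceT cf) f0 f1.

Lemma loop_ofE f (fl : is_loop f) : loop_of fl = f :> (R -> X).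
Proof. by case: fl. Qed.

Definition pcl f : pi1 :=
  if pselect (is_loop f) is left fl then \pi_pi1 (loop_of fl) else 1%g.

Lemma pclE f (fl : is_loop f) : pcl f = \pi_pi1 (loop_of fl).
Proof.
rewrite /pcl; case: pselect => // fl'; apply/pi1P/homotopic_eq => t _.
by rewrite !loop_ofE.
Qed.

Lemma pheq_continuous f h : pheq f h -> continuous h.
Proof.
case=> F [cF _ Fh _]; have -> : h = F \o (fun t => (t, 1)) by apply/funext => t /=.
apply: continuousT_comp => //; apply: continuous_pair => t; first exact: cvg_id.
exact: cvg_cst.
Qed.

Lemma pcl_pheq f h : is_loop f -> pheq f h -> pcl f = pcl h.
Proof.
move=> fl fh; have [e0 e1] := pheq_ends fh; have [cf f0 f1] := fl.
have hl : is_loop h by split; [exact: pheq_continuous fh | rewrite -e0 | rewrite -e1].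
rewrite (pclE fl) (pclE hl); apply/pi1P; case: fh => F [cF Ff Fh Fe].
exists F; split=> [|t _|t _|s _]; rewrite ?loop_ofE ?Ff ?Fh //.
  exact: continuous_subspaceT.
by rewrite -{1}f0 -f1.
Qed.

Lemma is_loop_cat f h : is_loop f -> is_loop h -> is_loop (cat f h).
Proof.
move=> [cf f0 f1] [ch h0 h1]; split; rewrite ?cat0 ?cat1 //.
by apply: continuous_path_cat => //; rewrite f1 h0.
Qed.

Lemma pcl_cat f h : is_loop f -> is_loop h -> pcl (cat f h) = (pcl f * pcl h)%g.
Proof.
move=> fl hl; rewrite (pclE (is_loop_cat fl hl)) (pclE fl) (pclE hl).
rewrite -[RHS]/(pi1_mul _ _) pi1_mulE; apply/pi1P/homotopic_eq => t _.
by rewrite cat_loopE !loop_ofE.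
Qed.

Lemma pcl_cst : pcl (cst x0) = 1%g.
Proof.
have cl : is_loop (cst x0) by split=> // t; exact: cvg_cst.
by rewrite (pclE cl); apply/pi1P/homotopic_eq => t _; rewrite loop_ofE.
Qed.

Lemma pcl_surj (x : pi1) : exists2 f, is_loop f & x = pcl f.
Proof.
elim/quotW: x => a; have al : is_loop (a \o clamp 0 1).
  split=> /=; rewrite ?clamp_id ?loop0 ?loop1 ?lexx ?ler01 //.
  apply/continuous_subspace_setT; apply: (@within_comp R R X setT I (clamp 0 1) a).
  - exact/continuous_subspaceT/continuous_clamp.
  - by move=> t _; rewrite /= in_itv/= clamp_in.
  - exact: loop_continuous.
exists (a \o clamp 0 1) => //; rewrite (pclE al); apply/pi1P/homotopic_eq => t.
by rewrite /= in_itv/= => It; rewrite loop_ofE /= clamp_id.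
Qed.

Section base_paths.
Context (kap : X -> R -> X) (ck : forall x, continuous (kap x)).
Context (k0 : forall x, kap x 0 = x0) (k1 : forall x, kap x 1 = x).
Context (kx0 : kap x0 = cst x0).

(** Base paths close up any path to a loop. The resulting class is multiplicative for concatenation,
    so the fundamental groupoid is mapped to the group. *)
Definition pG f : pi1 := pcl (cat (kap (f 0)) (cat f (rev (kap (f 1))))).

Let crev x : continuous (rev (kap x)). Proof. exact: continuous_path_rev. Qed.
Let cc f : continuous f -> continuous (cat f (rev (kap (f 1)))).
Proof. by move=> cf; apply: continuous_path_cat; rewrite // rev0 k1. Qed.

Lemma pG_loop f : continuous f -> is_loop (cat (kap (f 0)) (cat f (rev (kap (f 1))))).
Proof.
move=> cf; split; rewrite ?cat0 ?cat1 ?k0 ?rev1 ?k0 //.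
by apply: continuous_path_cat; rewrite ?cat0 ?k1 //; exact: cc.
Qed.

Lemma pG_pheq f h : continuous f -> pheq f h -> pG f = pG h.
Proof.
move=> cf fh; have [e0 e1] := pheq_ends fh.
apply: (pcl_pheq (pG_loop cf)); rewrite -e0 -e1.
apply: pheq_cat; [by rewrite cat0 k1 | exact: pheq_refl |].
by apply: pheq_cat => //; [rewrite rev0 k1 | exact: pheq_refl].
Qed.

Lemma pG_cat f h : continuous f -> continuous h -> f 1 = h 0 ->
  pG (cat f h) = (pG f * pG h)%g.
Proof.
move=> cf ch fh; have fl := pG_loop cf; have hl := pG_loop ch.
rewrite -(pcl_cat fl hl) /pG cat0 cat1; apply/esym/pcl_pheq; first exact: is_loop_cat.
have cfh : continuous (cat f h) by exact: continuous_path_cat.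
set kx := kap (f 0); set kz := rev (kap (h 1)); set ky := kap (h 0).
rewrite fh -/ky in fl *.
have kyc : continuous ky by exact: ck.
have chz : continuous (cat h kz) by exact: cc.
have cyhz : continuous (cat ky (cat h kz)).
  by apply: continuous_path_cat; rewrite // cat0 /ky k1.
have cfy : continuous (cat f (rev ky)) by rewrite /ky -fh; exact: cc.
have kxf : kx 1 = f 0 by rewrite /kx k1.
have fy : f 1 = rev ky 0 by rewrite rev0 fh /ky k1.
have ry : rev ky 1 = ky 0 by rewrite rev1.
have yh : ky 1 = h 0 by rewrite /ky k1.
have hz : h 1 = kz 0 by rewrite /kz rev0 k1.
have cry : continuous (rev ky) by exact: crev.
have ckz : continuous kz by exact: crev.
have ckx : continuous kx by exact: ck.
apply: pheq_trans (_ : pheq (cat kx (cat (cat f (rev ky)) (cat ky (cat h kz)))) _).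
  by apply: pheq_catA; rewrite ?cat0 ?cat1.
apply: pheq_cat; [by rewrite !cat0 | exact: pheq_refl |].
apply: pheq_trans (_ : pheq (cat f (cat (rev ky) (cat ky (cat h kz)))) _).
  by apply: pheq_catA; rewrite ?cat0 ?cat1.
apply: pheq_trans (_ : pheq (cat f (cat h kz)) _); last first.
  exact/pheq_sym/pheq_catA.
apply: pheq_cat; [by rewrite cat0 | exact: pheq_refl |].
apply: pheq_trans (_ : pheq (cat (cat (rev ky) ky) (cat h kz)) _).
  by apply/pheq_sym/pheq_catA; rewrite ?cat0.
apply: pheq_trans (pheq_1cat chz); apply: pheq_cat; last exact: pheq_refl.
  by rewrite cat1 cat0.
by rewrite cat0 -yh; exact: pheq_Vcat.
Qed.

Lemma pG_cst x : pG (cst x) = 1%g.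
Proof.
have cx : continuous (cst x : R -> X) by move=> t; exact: cvg_cst.
rewrite -pcl_cst; apply: (pcl_pheq (pG_loop cx)).
have := pheq_catV (@ck x); rewrite k0 => h; apply: pheq_trans h.
apply: pheq_cat; [by rewrite cat0 k1 | exact: pheq_refl |].
have := pheq_1cat (@crev x); rewrite rev0 k1; exact.
Qed.

Lemma pG_is_loop f : is_loop f -> pG f = pcl f.
Proof.
move=> [cf f0 f1]; apply: (pcl_pheq (pG_loop cf)); rewrite f0 f1 kx0.
apply: pheq_trans (_ : pheq (cat f (cst x0)) _); last first.
  by have := pheq_cat1 cf; rewrite f1.
have cfc : continuous (cat f (cst x0)).
  by apply: continuous_path_cat => // t; exact: cvg_cst.
by have := pheq_1cat cfc; rewrite cat0 f0; exact.
Qed.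

Lemma pG_kap x : pG (kap x) = 1%g.
Proof.
rewrite -pcl_cst; apply: (pcl_pheq (pG_loop (@ck x))); rewrite k0 k1 kx0.
have ckk : continuous (cat (kap x) (rev (kap x))).
  by apply: continuous_path_cat; rewrite ?rev0.
have := pheq_1cat ckk; rewrite cat0 k0 => h; apply: pheq_trans h _.
by have := pheq_catV (@ck x); rewrite k0.
Qed.

Lemma pG_eq f h : continuous f -> continuous h -> (forall t, I t -> f t = h t) -> pG f = pG h.
Proof.
move=> cf ch fh; have cl : continuous (clamp 0 1 : R -> R) by exact: continuous_clamp.
have c k : continuous k -> pG k = pG (k \o clamp 0 1).
  move=> kc; apply: (pG_pheq kc).
  apply: (@pheq_reparam _ _ _ id) => //; first by move=> t; exact: cvg_id.
  by rewrite clamp_id // lexx ler01.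
  by rewrite clamp_id // lexx ler01.
rewrite c // [RHS]c //; congr pG; apply/funext => t /=; apply: fh.
by rewrite /= in_itv/= clamp_in.
Qed.

Definition seg (z z' : R * R) (t : R) : R * R :=
  ((1 - t) * z.1 + t * z'.1, (1 - t) * z.2 + t * z'.2).

Lemma seg0 z z' : seg z z' 0 = z.
Proof. by case: z => a b; rewrite /seg subr0 !mul1r !mul0r !addr0. Qed.
Lemma seg1 z z' : seg z z' 1 = z'.
Proof. by case: z' => a b; rewrite /seg subrr !mul1r !mul0r !add0r. Qed.

Lemma continuous_seg z z' : continuous (seg z z').
Proof.
apply: continuous_pair => t; apply: cvgD; apply: cvgM.
1,5: by apply: cvgB; [exact: cvg_cst | exact: cvg_id].
2,5: exact: cvg_id.
all: exact: cvg_cst.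
Qed.

Section square.
Context (F : R * R -> X) (cF : continuous F).

Definition pGam z z' : pi1 := pG (F \o seg z z').

Let cFs z z' : continuous (F \o seg z z').
Proof. by apply: continuousT_comp => //; exact: continuous_seg. Qed.

(** Paths in the plane with equal ends are homotopic by straight lines, so only the end points
    matter; this yields the cocycle rule [pGamM]. *)
Lemma pG_square (a : R -> R * R) : continuous a -> pG (F \o a) = pGam (a 0) (a 1).
Proof.
move=> ca; apply: pG_pheq; first exact: continuousT_comp.
apply: pheq_square => //; first exact: continuous_seg.
  by rewrite seg0.
by rewrite seg1.
Qed.

Lemma pGamM z z' z'' : (pGam z z' * pGam z' z'')%g = pGam z z''.
Proof.
rewrite -pG_cat //=; last by rewrite /= seg0 seg1.
have cs := @continuous_path_cat _ _ _ _ (@continuous_seg z z') (@continuous_seg z' z'').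
rewrite seg0 seg1 in cs; have := pG_square (cs erefl).
rewrite cat0 cat1 seg0 seg1 => <-; congr pG; apply/funext => t.
by rewrite /= /cat_fun; case: ifP.
Qed.

Lemma pGam1 z : pGam z z = 1%g.
Proof. by apply: (mulgI (pGam z z)); rewrite pGamM mulg1. Qed.

Lemma pGamV z z' : pGam z' z = (pGam z z')^-1%g.
Proof. by apply: (mulgI (pGam z z')); rewrite pGamM mulgV pGam1. Qed.

Lemma pGam_cst z z' : (forall t, I t -> F (seg z z' t) = F z) -> pGam z z' = 1%g.
Proof.
move=> Fz; rewrite /pGam -(pG_cst (F z)); apply: pG_eq => //.
by move=> t; exact: cvg_cst.
Qed.
End square.
End base_paths.
End path_classes.

(** * Polar coordinates and the polygon as a quotient of a rectangle *)

Section polar.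
Context {R : realType} (g : nat) (g0 : (0 < g)%N).
Local Notation P := (@polygon_boundary R g).
Local Notation N := ((4 * g)%:R : R).
Local Notation E := 'rV[R]_2.

(** Radius and rescaled angle: side [k] of the polygon is the interval from [k] to [k + 1] at radius
    1. The disk arises by collapsing radius 0 and gluing the seam at 0 and [N]. *)
Definition rect : set (R * R) := `[0, 1]%classic `*` `[0, N]%classic.

Lemma rectE z : rect z <-> (0 <= z.1 <= 1) /\ (0 <= z.2 <= N).
Proof. by rewrite /rect /= !in_itv/=; split=> [[]|[]]. Qed.

Let N0 : 0 < N. Proof. by rewrite ltr0n; lia. Qed.

Definition polar (z : R * R) : E := z.1 *: P z.2.

Lemma polar0E z : polar z 0 0 = z.1 * cos (2 * pi * z.2 / N).
Proof. by rewrite !mxE /= . Qed.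

Lemma polar1E z : polar z 0 1 = z.1 * sin (2 * pi * z.2 / N).
Proof. by rewrite !mxE /=. Qed.

Lemma polar_disk z : rect z -> unit_disk (polar z).
Proof.
move=> /rectE[z1 z2]; rewrite /unit_disk /= polar0E polar1E !exprMn -mulrDr cos2Dsin2 mulr1.
by rewrite expr_le1 //; case/andP: z1.
Qed.

Lemma cossin_eq (s t : R) : 0 <= s <= 2 * pi -> 0 <= t <= 2 * pi ->
  cos s = cos t -> sin s = sin t -> s = t \/ (s = 0 /\ t = 2 * pi) \/ (s = 2 * pi /\ t = 0).
Proof.
wlog st : s t / s <= t.
  move=> wl s0 t0 cst sst; have [st|ts] := leP s t; first exact: wl.
  by have := wl t s (ltW ts) t0 s0 (esym cst) (esym sst); intuition.
move=> s0 t0 cst sst; have c1 : cos (t - s) = 1 by rewrite cosB cst sst -!expr2 cos2Dsin2.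
have := cos_mulr2n ((t - s) / 2).
rewrite (_ : (t - s) / 2 *+ 2 = t - s) ?c1 => [h|]; last by rewrite -mulr_natr divfK.
have s2 : sin ((t - s) / 2) ^+ 2 = 0 by rewrite sin2cos2; lra.
have [e|ne] := eqVneq s t; first by left.
right; left; have [] : 0 < (t - s) / 2 < pi \/ (t - s) / 2 >= pi.
  have : s < t by rewrite lt_neqAle ne.
  by have [?|?] := ltP ((t - s) / 2) pi; [left|right]; lra.
  by move=> /sin_gt0_pi; move/eqP: s2; rewrite sqrf_eq0 => /eqP ->; rewrite ltxx.
by lra.
Qed.

Lemma polar_inj z z' : rect z -> rect z' -> polar z = polar z' ->
  z.1 = z'.1 /\ (z.1 = 0 \/ z.2 = z'.2 \/ (z.2 = 0 /\ z'.2 = N) \/ (z.2 = N /\ z'.2 = 0)).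
Proof.
move=> /rectE[/andP[z1 _] z2] /rectE[/andP[z1' _] z2'] zz.
have := congr1 (fun p : E => p 0 0) zz; have := congr1 (fun p : E => p 0 1) zz.
rewrite !polar0E !polar1E; set a := 2 * pi * _ / _; set a' := 2 * pi * z'.2 / _ => es ec.
have e1 : z.1 = z'.1.
  have : z.1 ^+ 2 = z'.1 ^+ 2.
    rewrite -[LHS]mulr1 -(cos2Dsin2 a) mulrDr -!exprMn ec es.
    by rewrite !exprMn -mulrDr cos2Dsin2 mulr1.
  by move/eqP; rewrite eqrXn2 // => /eqP.
split=> //; have [->|z0] := eqVneq z.1 0; [by left | right].
have pp := @pi_gt0 R; have aE (u : R) : 2 * pi * u / N = (2 * pi / N) * u by rewrite mulrAC.
have d0 : 0 < 2 * pi / N by rewrite divr_gt0 // mulr_gt0.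
have dN : 2 * pi / N * N = 2 * pi by rewrite divfK // gt_eqF.
have ra (u : R) : 0 <= u <= N -> 0 <= 2 * pi * u / N <= 2 * pi.
  rewrite aE => /andP[u0 uN]; rewrite mulr_ge0 ?(ltW d0) //=.
  by rewrite -[leRHS]dN ler_pM2l.
have inj (u v : R) : 2 * pi * u / N = 2 * pi * v / N -> u = v.
  by rewrite !aE => /mulfI; apply; rewrite gt_eqF.
have t0 : 2 * pi * 0 / N = 0 by rewrite mulr0 mul0r.
have tN : 2 * pi * N / N = 2 * pi by rewrite aE dN.
have := @cossin_eq a a' (ra _ z2) (ra _ z2').
rewrite -e1 in ec es; move: ec es => /(mulfI z0) -> /(mulfI z0) -> /(_ erefl erefl).
case=> [/inj|[[ea ea']|[ea ea']]]; first by left.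
  by right; left; split; apply: inj; rewrite ?t0 ?tN.
by right; right; split; apply: inj; rewrite ?t0 ?tN.
Qed.

Lemma polar_surj p : unit_disk p -> exists2 z, rect z & polar z = p.
Proof.
rewrite /unit_disk /= => p1; set x := p 0 0 in p1 *; set y := p 0 1 in p1 *.
have pp := @pi_gt0 R; set r := Num.sqrt (x ^+ 2 + y ^+ 2).
have s0 : 0 <= x ^+ 2 + y ^+ 2 by rewrite addr_ge0 // sqr_ge0.
have r2 : r ^+ 2 = x ^+ 2 + y ^+ 2 by rewrite sqr_sqrtr.
have r0 : 0 <= r by exact: sqrtr_ge0.
have r1 : r <= 1 by rewrite -(@expr_le1 _ 2) // r2.
have [t [t0 tx ty]] : exists t, [/\ 0 <= t <= 2 * pi, r * cos t = x & r * sin t = y].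
  have [re|rn] := eqVneq r 0.
    exists 0; rewrite re !mul0r lexx mulr_ge0 ?pi_ge0 //; move: r2.
    rewrite re expr0n /= => /esym/eqP; rewrite paddr_eq0 ?sqr_ge0 // !sqrf_eq0.
    by case/andP => /eqP -> /eqP ->.
  have rp : 0 < r by rewrite lt_neqAle eq_sym rn.
  have xr : -1 <= x / r <= 1.
    rewrite ler_pdivlMr // ler_pdivrMr // mulN1r mul1r -ler_norml.
    by rewrite -(@ler_pXn2r _ 2) ?nnegrE // real_normK ?num_real // r2 lerDl sqr_ge0.
  have cx : r * cos (acos (x / r)) = x by rewrite acosK // mulrC divfK.
  have sy : (r * sin (acos (x / r))) ^+ 2 = y ^+ 2.
    by rewrite exprMn sin2cos2 mulrBr mulr1 -exprMn cx r2 addrC addKr.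
  have ac : 0 <= acos (x / r) <= pi by rewrite acos_ge0 ?acos_lepi.
  have ss : 0 <= sin (acos (x / r)) by apply: sin_ge0_pi.
  have [y0|y0] := leP 0 y.
    exists (acos (x / r)); split => //; first by lra.
    apply/eqP; rewrite -(@eqrXn2 _ 2) ?sy // mulr_ge0 //.
  exists (2 * pi - acos (x / r)); split; first by lra.
    rewrite cosB mulr_natl cos2pi sin2pi mul1r mul0r addr0 //.
  rewrite sinB mulr_natl cos2pi sin2pi mul0r mul1r sub0r mulrN.
  apply: oppr_inj; rewrite opprK; apply/eqP; rewrite -(@eqrXn2 _ 2) ?sy ?sqrrN //.
    by rewrite mulr_ge0.
  by rewrite oppr_ge0 ltW.
exists (r, t * N / (2 * pi)).
  apply/rectE; split=> /=; first by rewrite r0.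
  case/andP: t0 => t0 tp; apply/andP; split.
    by rewrite divr_ge0 // mulr_ge0 // ltW.
  by rewrite ler_pdivrMr ?mulr_gt0 // mulrC ler_pM2l.
have tE : 2 * pi * (t * N / (2 * pi)) / N = t.
  by rewrite mulrCA divff ?mulr1 ?mulfK // gt_eqF ?mulr_gt0.
apply/rowP => i; have [->|->] : i = 0 \/ i = 1.
- by case: i => -[|[|//]] ?; [left|right]; apply: val_inj.
- by rewrite polar0E /= tE.
- by rewrite polar1E /= tE.
Qed.

Lemma continuous_polar : continuous polar.
Proof.
have -> : polar = fun z => (z.1 * cos (2 * pi * z.2 / N)) *: delta_mx 0 0 +
    (z.1 * sin (2 * pi * z.2 / N)) *: delta_mx 0 1.
  apply/funext => z; apply/rowP => i; have [->|->] : i = 0 \/ i = 1.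
  - by case: i => -[|[|//]] ?; [left|right]; apply: val_inj.
  - by rewrite polar0E !mxE /= mulr1 mulr0 addr0.
  - by rewrite polar1E !mxE /= mulr1 mulr0 add0r.
have ca : continuous (fun z : R * R => 2 * pi * z.2 / N).
  by move=> z; apply: cvgM; [apply: cvgM; [exact: cvg_cst | exact: cvg_snd] | exact: cvg_cst].
move=> z; apply: cvgD; apply: cvgZr_tmp; apply: cvgM; try exact: cvg_fst.
  exact: (continuousT_comp ca (@continuous_cos R)).
exact: (continuousT_comp ca (@continuous_sin R)).
Qed.
End polar.

Lemma hausdorff_prod (T U : topologicalType) :
  hausdorff_space T -> hausdorff_space U -> hausdorff_space (T * U)%type.
Proof.
move=> hT hU [x s] [y t] xy; congr (_, _).
  apply: hT => A B xA yB.
  have [||[z r] [Az Bz]] := xy (fst @^-1` A) (fst @^-1` B).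
  - by apply: (@cvg_fst _ _ (nbhs x) (nbhs s)).
  - by apply: (@cvg_fst _ _ (nbhs y) (nbhs t)).
  by exists z.
apply: hU => A B xA yB.
have [||[z r] [Az Bz]] := xy (snd @^-1` A) (snd @^-1` B).
- by apply: (@cvg_snd _ _ (nbhs x) (nbhs s)).
- by apply: (@cvg_snd _ _ (nbhs y) (nbhs t)).
by exists r.
Qed.

Lemma compact_quotient_closed (A B : topologicalType) (C D : set A) (p : A -> B) :
  compact C -> hausdorff_space B -> continuous p -> closed D -> closed (p @` (C `&` D)).
Proof.
move=> cC hB cp cD; apply: compact_closed => //; apply: continuous_compact.
  exact: continuous_subspaceT.
exact: compact_closedI.
Qed.

(** A continuous map from a compact set to a Hausdorff space is closed, hence a quotient map onto
    its image. *)
Lemma compact_quotient_continuous (A B Y : topologicalType) (C : set A) (p : A -> B)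
    (h : A -> Y) (k : B -> Y) :
  compact C -> hausdorff_space B -> continuous p -> continuous h ->
  (forall a, C a -> k (p a) = h a) -> {within p @` C, continuous k}.
Proof.
move=> cC hB cp ch kh; apply/continuousP => O oO; apply/open_subspaceP.
exists (~` (p @` (C `&` h @^-1` (~` O)))).
  apply/closed_openC/compact_quotient_closed => //.
  apply: preimage_closed; last exact: open_closedC.
  by move=> a _; exact: ch.
apply/seteqP; split=> b [] /= kb [a Ca ab]; split=> //; last first.
- by exists a.
- move=> [a' [Ca' ha'] a'b]; apply: ha'; rewrite /= -kh // a'b.
  exact: kb.
- by exists a.
apply: contrapT => nO; apply: kb; exists a => //; split=> //=.
by rewrite -kh // ab.
Qed.

Section polygon_quotient.
Context {R : realType} (g : nat) (g0 : (0 < g)%N) (X : topologicalType).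
Context (hX : hausdorff_space X) (hg : has_genus R g X).
Local Notation N := ((4 * g)%:R : R).
Local Notation rect := (@rect R g).
Local Notation I := (`[0, 1]%classic : set R).

Definition crect (z : R * R) : R * R := (clamp 0 1 z.1, clamp 0 N z.2).

Lemma crect_rect z : rect (crect z).
Proof. by apply/rectE; rewrite /= !clamp_in. Qed.

Lemma crect_id z : rect z -> crect z = z.
Proof. by move=> /rectE[z1 z2]; rewrite /crect !clamp_id //; case: (z). Qed.

Lemma continuous_crect : continuous crect.
Proof.
apply: continuous_pair.
  exact: (continuousT_comp (fun z => cvg_fst) (@continuous_clamp R 0 1)).
exact: (continuousT_comp (fun z => cvg_snd) (@continuous_clamp R 0 N)).
Qed.

(** The clamp [crect] makes this continuous on the whole plane, although the map given by
    [has_genus] is only controlled on the disk. *)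
Definition qq : R * R -> X := projT1 (cid hg) \o @polar R g \o crect.

Lemma continuous_qq : continuous qq.
Proof.
rewrite /qq; case: cid => q /= [_ _ oq].
apply/continuous_subspace_setT.
apply: (@within_comp (R * R)%type 'rV[R]_2 X setT (@unit_disk R) (@polar R g \o crect) q).
- apply: continuous_subspaceT; apply: continuousT_comp; first exact: continuous_crect.
  exact: continuous_polar.
- by move=> z _; apply: polar_disk => //; exact: crect_rect.
- by apply/continuousP => V /oq.
Qed.

Lemma qq_surj x : exists2 z, rect z & qq z = x.
Proof.
rewrite /qq; case: cid => q /= [sq _ _].
have : [set: X] x by []. rewrite -sq => -[p pd <-].
have [z rz <-] := polar_surj g0 pd.
by exists z; rewrite //= crect_id.
Qed.

Lemma qq_center u u' : qq (0, u) = qq (0, u').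
Proof.
rewrite /qq /=; apply: (congr1 (projT1 (cid hg))).
by rewrite /polar /crect /= clamp_id ?lexx ?ler01 // !scale0r.
Qed.

Let P0 : @polygon_boundary R g 0 = @polygon_boundary R g N.
Proof.
have N0 : N != 0 by rewrite pnatr_eq0; lia.
apply/rowP => i; rewrite !mxE mulr0 mul0r mulfK //.
by rewrite mulr_natl cos2pi sin2pi cos0 sin0.
Qed.

Lemma qq_seam r : qq (r, 0) = qq (r, N).
Proof.
rewrite /qq /=; apply: (congr1 (projT1 (cid hg))); rewrite /polar /crect /=.
by rewrite !(@clamp_id R 0 N) ?lexx ?ler0n // P0.
Qed.

Let pairE e (s : R) : (e < 4 * g)%N -> (e %% 4 < 2)%N -> 0 <= s <= 1 ->
  side_pairing g (@polygon_boundary R g (e%:R + s)) (@polygon_boundary R g (e%:R + 3 - s)).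
Proof.
move=> eg e2 s1; have [e0|e1] : (e = 4 * (e %/ 4) \/ e = 4 * (e %/ 4) + 1)%N by lia.
  rewrite {}e0 (_ : _ + 3 - s = (4 * (e %/ 4) + 3)%:R - s); last by rewrite natrD.
  by apply: side_pairing_a => //; lia.
rewrite {}e1 (_ : _ + 3 - s = (4 * (e %/ 4) + 4)%:R - s); last by rewrite !natrD; lra.
by apply: side_pairing_b => //; lia.
Qed.

Lemma rect_edge e (s : R) : (e < 4 * g)%N -> 0 <= s <= 1 -> rect (1, e%:R + s).
Proof.
move=> eg s1; apply/rectE; split; rewrite /= ?lexx ?ler01 //.
have : (e.+1)%:R <= N by rewrite ler_nat.
by have := ler0n R e; rewrite -natr1; lra.
Qed.

Lemma edge_flip e (s : R) : e%:R + 3 - s = (e.+2)%:R + (1 - s).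
Proof. by rewrite -[in RHS]addn2 natrD; lra. Qed.

Lemma qq_pair e (s : R) : (e < 4 * g)%N -> (e %% 4 < 2)%N -> 0 <= s <= 1 ->
  qq (1, e%:R + s) = qq (1, e%:R + 3 - s).
Proof.
move=> eg e2 s1; have re : rect (1, e%:R + 3 - s).
  by rewrite edge_flip; apply: rect_edge; [lia | lra].
have rs := rect_edge eg s1; rewrite /qq /=; case: cid => q /= [_ iq _].
rewrite !crect_id // /polar /= !scale1r.
apply/iq; first by have := polar_disk rs; rewrite /polar /= scale1r.
  by have := polar_disk re; rewrite /polar /= scale1r.
by apply: rst_step; exact: pairE.
Qed.

(** The conditions at the centre and at the seam let [Q] descend to the disk; the third makes it
    constant on the equivalence classes generated by the side pairing. *)
Lemma qq_inv (A : Type) (Q : R * R -> A) :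
  (forall u u' : R, 0 <= u <= N -> 0 <= u' <= N -> Q (0, u) = Q (0, u')) ->
  (forall r : R, 0 <= r <= 1 -> Q (r, 0) = Q (r, N)) ->
  (forall e (s : R), (e < 4 * g)%N -> (e %% 4 < 2)%N -> 0 <= s <= 1 ->
     Q (1, e%:R + s) = Q (1, e%:R + 3 - s)) ->
  forall z z', rect z -> rect z' -> qq z = qq z' -> Q z = Q z'.
Proof.
move=> Q0 QN Qp z z' rz rz'; rewrite /qq /=; case: cid => q /= [_ iq _].
rewrite !crect_id //.
pose Q' p := Q (xget z [set w | rect w /\ polar g w = p]).
have Q'E w : rect w -> Q' (polar g w) = Q w.
  move=> rw; rewrite /Q'; case: xgetP => [w' _ [rw' ww']|/(_ w)[]//].
  have [w1 w2] := polar_inj g0 rw' rw ww'.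
  move: w1 w2 rw rw'; case: w {ww'} => r u; case: w' => r' u' /= <- {r}.
  move=> h /rectE[/= r1 u1] /rectE[/= r1' u1'].
  by case: h => [->|[->|[[-> ->]|[-> ->]]]] //; [exact: Q0 | exact: QN | rewrite QN].
move=> /iq h; have {h} := h (polar_disk rz) (polar_disk rz').
move=> h; rewrite -!Q'E //; elim: h => //; last by move=> ? ? ? _ -> _ ->.
have step e (s : R) : (e < 4 * g)%N -> (e %% 4 < 2)%N -> 0 <= s <= 1 ->
    Q' (polygon_boundary g (e%:R + s)) = Q' (polygon_boundary g (e%:R + 3 - s)).
  move=> eg e2 s1; have pE (u : R) : polygon_boundary g u = polar g (1, u).
    by rewrite /polar scale1r.
  rewrite (pE (_ + s)) (pE (_ - s)).
  rewrite !Q'E; [exact: Qp | | exact: rect_edge].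
  by rewrite edge_flip; apply: rect_edge; [lia | lra].
move=> p p' [j s jg s1|j s jg s1].
  rewrite (_ : (4 * j + 3)%:R - s = (4 * j)%:R + 3 - s); last by rewrite natrD.
  by apply: step => //; lia.
rewrite (_ : (4 * j + 4)%:R - s = (4 * j + 1)%:R + 3 - s); last by rewrite !natrD; lra.
by apply: step => //; lia.
Qed.

Lemma compact_rect : compact rect.
Proof. by apply: compact_setX; exact: segment_compact. Qed.

Lemma open_qq (V : set X) :
  (forall z, rect z -> V (qq z) -> \forall z' \near z, rect z' -> V (qq z')) -> open V.
Proof.
move=> Vn; pose O := [set z | rect z /\ V (qq z)]^°. 
have -> : V = ~` (qq @` (rect `&` ~` [set z | rect z -> V (qq z)]^°)).
  apply/seteqP; split=> x.
    by move=> Vx [z [rz nz] zx]; apply: nz; apply: Vn => //; rewrite zx.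
  have [z rz zx] := qq_surj x; move=> /= nx; apply: contrapT => nV; apply: nx.
  exists z => //; split=> // /nbhs_singleton /(_ rz); rewrite zx; exact: nV.
apply/closed_openC/compact_quotient_closed => //; first exact: compact_rect.
  exact: continuous_qq.
by apply: open_closedC; exact: open_interior.
Qed.

Lemma quotient_homotopy (h : R * R -> R -> R * R) :
  continuous (fun w : (R * R) * R => h w.1 w.2) ->
  (forall z z' s, rect z -> rect z' -> I s -> qq z = qq z' -> qq (h z s) = qq (h z' s)) ->
  exists H : X * R -> X, continuous H /\
    forall z s, rect z -> I s -> H (qq z, s) = qq (h z s).
Proof.
move=> ch hq.
have /choice[lift liftP] : forall x, exists z, rect z /\ qq z = x.
  by move=> x; have [z rz zx] := qq_surj x; exists z.
pose k (w : X * R) := qq (h (lift w.1) w.2).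
have kE z s : rect z -> I s -> k (qq z, s) = qq (h z s).
  by move=> rz Is; have [rl lE] := liftP (qq z); apply: hq.
have ck : {within (fun w : (R * R) * R => (qq w.1, w.2)) @` (rect `*` I), continuous k}.
  apply: (@compact_quotient_continuous _ _ _ _ _ (fun w => qq (h w.1 w.2))).
  - by apply: compact_setX; [exact: compact_rect | exact: segment_compact].
  - by apply: hausdorff_prod => //; exact: Rhausdorff.
  - apply: continuous_pair => w; last exact: cvg_snd.
    exact: (continuousT_comp (fun z => cvg_fst) continuous_qq).
  - exact: (continuousT_comp ch continuous_qq).
  - by move=> [z s] [/= rz Is]; exact: kE.
exists (k \o (fun w => (w.1, clamp 0 1 w.2))); split=> [|z s rz Is]; last first.
  rewrite /= clamp_id; first exact: kE.
  by move: Is; rewrite /= in_itv.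
apply/continuous_subspace_setT; apply: within_comp ck.
  apply/continuous_subspaceT/continuous_pair => w; first exact: cvg_fst.
  exact: (continuousT_comp (fun z => cvg_snd) (@continuous_clamp R 0 1)).
move=> [x s] _ /=; have [z rz zx] := qq_surj x.
exists (z, clamp 0 1 s) => /=; last by rewrite zx.
by split=> //=; rewrite in_itv/= clamp_in.
Qed.
End polygon_quotient.

(* Side [e] with [e %% 4 < 2] is glued to side [e + 2], in the opposite direction. *)
Lemma petal_index g k : (k < 4 * g)%N ->
  exists e, [/\ (e < 4 * g)%N, (e %% 4 < 2)%N & k = e \/ k = e.+2].
Proof.
move=> kg; have [k2|k2] := ltnP (k %% 4) 2; first by exists k; split=> //; left.
by exists (k - 2)%N; split; [lia|lia|right; lia].
Qed.

Lemma petal_range g e : (e < 4 * g)%N -> (e %% 4 < 2)%N -> (e.+2 < 4 * g)%N.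
Proof. by lia. Qed.

(** * Functions of the boundary coordinate, side by side *)

Section boundary_coordinate.
Context {R : realType} (g : nat).
Local Notation N := ((4 * g)%:R : R).

Lemma edge_decomp (u : R) : (0 < g)%N -> 0 <= u <= N ->
  exists k s, [/\ (k < 4 * g)%N, 0 <= s <= 1 & u = k%:R + s].
Proof.
move=> g0; have : (0 < 4 * g)%N by lia.
elim: (4 * g)%N => [//|n IH] _ /andP[u0 un].
have [n0|n0] := posnP n.
  by exists 0%N, u; rewrite n0 in un *; split=> //; rewrite ?u0 ?add0r.
have [un'|un'] := leP u n%:R.
  have [|k [s [kn s1 ->]]] := IH n0; first by rewrite u0.
  by exists k, s; split=> //; lia.
exists n, (u - n%:R); split=> //; last by lra.
by move: un; rewrite -natr1; lra.
Qed.

Section bump.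
Context (d : R -> R) (d0 : forall x, x <= 0 -> d x = 0) (d1 : forall x, 1 <= x -> d x = 0).

Lemma shift_edge (j k : nat) (s : R) : 0 <= s <= 1 ->
  d (j%:R + s - k%:R) = if j == k then d s else 0.
Proof.
move=> s1; case: (ltngtP j k) => jk; last by congr d; rewrite jk; lra.
  by apply: d0; have : j.+1%:R <= k%:R :> R; [rewrite ler_nat | rewrite -natr1; lra].
by apply: d1; have : k.+1%:R <= j%:R :> R; [rewrite ler_nat | rewrite -natr1; lra].
Qed.

Definition bump (u : R) : R := \sum_(k < 4 * g) d (u - k%:R).

Lemma bump_edge j s : (j < 4 * g)%N -> 0 <= s <= 1 -> bump (j%:R + s) = d s.
Proof.
move=> jg s1; rewrite /bump (bigD1 (Ordinal jg)) //= shift_edge // eqxx big1 ?addr0 // => k kj.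
rewrite shift_edge // ifF //; apply/negbTE; apply: contraNN kj => /eqP e.
by apply/eqP/val_inj.
Qed.

Lemma continuous_bump : continuous d -> continuous bump.
Proof.
have ca : continuous (fun z : R * R => z.1 + z.2).
  by move=> z; apply: cvgD; [exact: cvg_fst | exact: cvg_snd].
move=> cd; apply: (@continuous_big R 'I_(4 * g) +%R 0 xpredT ca R (index_enum _)
  (fun (k : 'I_(4 * g)) (u : R) => d (u - k%:R))) => k _ u.
 apply: (@cvg_comp _ _ _ (fun u => u - k%:R) d); last exact: cd.
by apply: cvgB; [exact: cvg_id | exact: cvg_cst].
Qed.
End bump.

Definition tent (x : R) : R := Num.max 0 (Num.min x (1 - x)).

Lemma tent_le0 x : x <= 0 -> tent x = 0.
Proof. by move=> x0; rewrite /tent max_l // ge_min x0. Qed.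
Lemma tent_ge1 x : 1 <= x -> tent x = 0.
Proof. by move=> x0; rewrite /tent max_l // ge_min (_ : 1 - x <= 0) ?orbT //; lra. Qed.
Lemma tentE x : 0 <= x <= 1 -> tent x = Num.min x (1 - x).
Proof. by move=> /andP[x0 x1]; rewrite /tent max_r // le_min x0 /=; lra. Qed.
Lemma tentB x : tent (1 - x) = tent x.
Proof. by rewrite /tent subKr minC. Qed.
Lemma continuous_tent : continuous tent.
Proof.
apply: continuous_maxr => [x|]; first exact: cvg_cst.
apply: continuous_minr => x; first exact: cvg_id.
by apply: cvgB; [exact: cvg_cst | exact: cvg_id].
Qed.

(* [s |-> s + to_ends s] pushes [s] to the nearest end of [0, 1] when [s] is not
   in the middle third; [s |-> s + to_middle s] maps the middle half to [1/2]. *)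
Definition to_ends (s : R) : R := clamp 0 1 (3 * s - 1) - clamp 0 1 s.
Definition to_middle (s : R) : R :=
  clamp 0 2^-1 (2 * s) + clamp 0 2^-1 (2 * s - 3 / 2) - clamp 0 1 s.

Lemma clampP a b (x : R) : a <= b ->
  [\/ x <= a /\ clamp a b x = a, a <= x <= b /\ clamp a b x = x | b <= x /\ clamp a b x = b].
Proof.
move=> ab; have [xa|ax] := leP x a.
  by apply: Or31; rewrite /clamp max_l // ge_min xa orbT.
have [xb|bx] := leP x b.
  have axb : a <= x <= b by lra.
  by apply: Or32; split; [rewrite andbT ltW | exact: clamp_id axb].
by apply: Or33; split; rewrite ?ltW // /clamp min_l ?max_r // ltW.
Qed.

Let half0 : 0 <= 2^-1 :> R. Proof. by rewrite invr_ge0. Qed.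

Lemma to_ends0 x : x <= 0 -> to_ends x = 0.
Proof.
rewrite /to_ends => x0.
by case: (clampP (3 * x - 1) ler01) => -[? ->]; case: (clampP x ler01) => -[? ->]; lra.
Qed.
Lemma to_ends1 x : 1 <= x -> to_ends x = 0.
Proof.
rewrite /to_ends => x0.
by case: (clampP (3 * x - 1) ler01) => -[? ->]; case: (clampP x ler01) => -[? ->]; lra.
Qed.
Lemma to_middle0 x : x <= 0 -> to_middle x = 0.
Proof.
rewrite /to_middle => x0; case: (clampP (2 * x) half0) => -[? ->];
by case: (clampP (2 * x - 3 / 2) half0) => -[? ->]; case: (clampP x ler01) => -[? ->]; lra.
Qed.
Lemma to_middle1 x : 1 <= x -> to_middle x = 0.
Proof.
rewrite /to_middle => x0; case: (clampP (2 * x) half0) => -[? ->];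
by case: (clampP (2 * x - 3 / 2) half0) => -[? ->]; case: (clampP x ler01) => -[? ->]; lra.
Qed.
Lemma clampB a b (x : R) : a <= b -> clamp a b (a + b - x) = a + b - clamp a b x.
Proof.
move=> ab; case: (clampP x ab) => -[? ->]; case: (clampP (a + b - x) ab) => -[? ->]; lra.
Qed.

Lemma to_endsB x : to_ends (1 - x) = - to_ends x.
Proof.
have := clampB (3 * x - 1) ler01; have := clampB x ler01; rewrite /to_ends add0r => ->.
by rewrite (_ : 1 - (3 * x - 1) = 3 * (1 - x) - 1) => [->|]; lra.
Qed.

Lemma to_middleB x : to_middle (1 - x) = - to_middle x.
Proof.
have := clampB (2 * x - 3 / 2) half0; have := clampB (2 * x) half0; have := clampB x ler01.
rewrite /to_middle !add0r => ->.
rewrite (_ : 2^-1 - 2 * x = 2 * (1 - x) - 3 / 2); last by lra.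
rewrite (_ : 2^-1 - (2 * x - 3 / 2) = 2 * (1 - x)); last by lra.
by move=> -> ->; lra.
Qed.

Lemma to_ends_in x : 0 <= x <= 1 -> 0 <= x + to_ends x <= 1.
Proof.
rewrite /to_ends => x0.
by case: (clampP (3 * x - 1) ler01) => -[? ->]; case: (clampP x ler01) => -[? ->]; lra.
Qed.
Lemma to_middle_in x : 0 <= x <= 1 -> 0 <= x + to_middle x <= 1.
Proof.
rewrite /to_middle => x0; case: (clampP (2 * x) half0) => -[? ->];
by case: (clampP (2 * x - 3 / 2) half0) => -[? ->]; case: (clampP x ler01) => -[? ->]; lra.
Qed.
Lemma to_endsE x : 0 <= x <= 1 -> tent x < 3^-1 -> x + to_ends x = 0 \/ x + to_ends x = 1.
Proof.
move=> x0; rewrite tentE // gt_min /to_ends => /orP[] xx.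
  by left; case: (clampP (3 * x - 1) ler01) => -[? ->]; case: (clampP x ler01) => -[? ->]; lra.
by right; case: (clampP (3 * x - 1) ler01) => -[? ->]; case: (clampP x ler01) => -[? ->]; lra.
Qed.
Lemma to_middleE x : 0 <= x <= 1 -> 4^-1 < tent x -> x + to_middle x = 2^-1.
Proof.
move=> x0; rewrite tentE // lt_min /to_middle => /andP[xx xx'].
case: (clampP (2 * x) half0) => -[? ->];
by case: (clampP (2 * x - 3 / 2) half0) => -[? ->]; case: (clampP x ler01) => -[? ->]; lra.
Qed.

Lemma continuous_clamp_affine a b c e : continuous (fun s : R => clamp a b (c * s + e)).
Proof. exact: (continuousT_comp (@continuous_affine R c e) (@continuous_clamp R a b)). Qed.

Lemma continuous_to_ends : continuous to_ends.
Proof.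
move=> s; apply: cvgB; last exact: continuous_clamp.
exact: continuous_clamp_affine.
Qed.

Lemma continuous_to_middle : continuous to_middle.
Proof.
move=> s; apply: cvgB; last exact: continuous_clamp.
apply: cvgD; last exact: continuous_clamp_affine.
have := @continuous_clamp_affine 0 2^-1 2 0 s.
by under [X in continuous_at _ X -> _]eq_fun do rewrite addr0.
Qed.
End boundary_coordinate.

(** * The edges of the polygon generate the fundamental group *)

Section polygon_group.
Context {R : realType} (g : nat) (g0 : (0 < g)%N) (X : topologicalType).
Context (hX : hausdorff_space X) (hg : has_genus R g X) (x0 : X).
Local Notation N := ((4 * g)%:R : R).
Local Notation rect := (@rect R g).
Local Notation I := (`[0, 1]%classic : set R).
Local Notation qq := (qq hg).
Local Notation pi1 := (pi1 R x0).

Definition lift (x : X) : R * R := projT1 (cid2 (qq_surj g0 hg x)).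
Lemma lift_rect x : rect (lift x). Proof. by rewrite /lift; case: cid2. Qed.
Lemma liftK x : qq (lift x) = x. Proof. by rewrite /lift; case: cid2. Qed.

Definition kap (x : X) : R -> X := qq \o seg (lift x0) (lift x).

Let cq : continuous qq. Proof. exact: continuous_qq. Qed.

Lemma continuous_kap x : continuous (kap x).
Proof. by apply: continuousT_comp => //; exact: continuous_seg. Qed.
Lemma kap0 x : kap x 0 = x0. Proof. by rewrite /kap /= seg0 liftK. Qed.
Lemma kap1 x : kap x 1 = x. Proof. by rewrite /kap /= seg1 liftK. Qed.
Lemma kapx0 : kap x0 = cst x0.
Proof.
apply/funext => t; rewrite /kap /= -[RHS]liftK; congr (qq _); case: (lift x0) => a b.
by rewrite /seg -!mulrDl subrK !mul1r.
Qed.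

Local Notation pG := (pG x0 kap).
Local Notation Gam := (pGam x0 kap qq).

Lemma GamM z z' z'' : (Gam z z' * Gam z' z'')%g = Gam z z''.
Proof. exact: (pGamM continuous_kap kap0 kap1 cq). Qed.
Lemma GamV z z' : Gam z' z = (Gam z z')^-1%g.
Proof. exact: (pGamV continuous_kap kap0 kap1 cq). Qed.
Lemma Gam1 z : Gam z z = 1%g.
Proof. exact: (pGam1 continuous_kap kap0 kap1 cq). Qed.
Lemma Gam_lift x : Gam (lift x0) (lift x) = 1%g.
Proof. exact: (pG_kap continuous_kap kap0 kap1 kapx0 x). Qed.

Lemma Gam_eq z w z' w' : (forall t, I t -> qq (seg z w t) = qq (seg z' w' t)) ->
  Gam z w = Gam z' w'.
Proof.
have c u v : continuous (qq \o seg u v) by apply: continuousT_comp => //; exact: continuous_seg.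
by move=> h; apply: (pG_eq continuous_kap kap0 kap1).
Qed.

Definition edge (k : nat) : pi1 :=
  if (k < 4 * g)%N then Gam (1, k%:R) (1, k.+1%:R) else 1%g.

Lemma Gam_pair e (s t : R) : (e < 4 * g)%N -> (e %% 4 < 2)%N -> 0 <= s <= 1 -> 0 <= t <= 1 ->
  Gam (1, e%:R + s) (1, e%:R + t) = Gam (1, e%:R + 3 - s) (1, e%:R + 3 - t).
Proof.
move=> eg e2 s1 t1; apply: Gam_eq => r; rewrite /= in_itv/= => r1.
have := @qq_pair _ _ g0 _ hg e ((1 - r) * s + r * t) eg e2 => h.
rewrite /seg /= (_ : (1 - r) * 1 + r * 1 = 1); last by lra.
rewrite (_ : (1 - r) * (e%:R + s) + r * (e%:R + t) = e%:R + ((1 - r) * s + r * t)); last by lra.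
rewrite h; first by congr (qq (_, _)); lra.
by nra.
Qed.

Lemma edge_linv k : edge (linv k) = (edge k)^-1%g.
Proof.
rewrite /edge; have := linvP k; have [kg|kg] := ltnP k (4 * g); last first.
  by move=> h; rewrite ifF ?invg1 //; lia.
move=> h; rewrite ifT; last by lia.
rewrite -GamV; have h1 e : (e < 4 * g)%N -> (e %% 4 < 2)%N ->
    Gam (1, (e.+2)%:R) (1, (e.+3)%:R) = Gam (1, e.+1%:R) (1, e%:R).
  move=> eg e2; have := @Gam_pair e 1 0 eg e2; rewrite !lexx !ler01 => /(_ isT isT).
  have -> : e%:R + 3 - 1 = e.+2%:R :> R by rewrite -[in RHS]addn2 natrD; lra.
  have -> : e%:R + 3 - 0 = e.+3%:R :> R by rewrite -[in RHS]addn3 natrD; lra.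
  by rewrite natr1 addr0.
have [k2|k2] := ltnP (k %% 4) 2.
  by rewrite /linv k2 addn2; exact: h1.
rewrite /linv ifF; last by lia.
have ke : k = (k - 2).+2 by lia.
have := h1 (k - 2)%N; rewrite -ke => e.
by rewrite [RHS]GamV e -?GamV //; lia.
Qed.

Lemma Gam_seam : Gam (1, 0) (0, 0) = Gam (1, N) (0, N).
Proof.
apply: Gam_eq => t _; rewrite /seg /= !mulr0 !addr0 (qq_seam g0).
by rewrite -mulrDl subrK mul1r.
Qed.

(** The circuit around the boundary is deformed through the centre: inwards along one copy of the
    seam and outwards along the other, which has the same image. *)
Lemma prod_edge : (\prod_(k <- iota 0 (4 * g)) edge k = 1)%g.
Proof.
have h n : (n <= 4 * g)%N -> (\prod_(k <- iota 0 n) edge k)%g = Gam (1, 0%:R) (1, n%:R).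
  elim: n => [|n IH] ng; first by rewrite big_nil Gam1.
  rewrite -[in LHS]addn1 iotaD big_cat big_seq1 add0n IH; last exact: ltnW.
  by rewrite /edge ng /= GamM.
rewrite h // -(GamM _ (0, 0)) -(GamM (0, 0) (0, N)).
have -> : Gam (0, 0) (0, N) = 1%g.
  rewrite -(Gam1 (0, 0)); apply: Gam_eq => t _; rewrite /seg /= !mulr0 !addr0.
  exact: qq_center.
by rewrite mul1g Gam_seam GamM Gam1.
Qed.

Section generation.
Context (P : pi1 -> Prop) (P1 : P 1%g) (PM : forall x y, P x -> P y -> P (x * y)%g).
Context (PV : forall x, P x -> P x^-1%g) (PE : forall k, (k < 4 * g)%N -> P (edge k)).
Local Notation v := ((1, 0) : R * R).

Lemma P_corner k : (k <= 4 * g)%N -> P (Gam v (1, k%:R)).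
Proof.
elim: k => [|k IH] kg; first by rewrite Gam1.
rewrite -(GamM _ (1, k%:R)); apply: PM; first exact/IH/ltnW.
by have := PE kg; rewrite /edge kg.
Qed.

Lemma P_fiber z z' : rect z -> rect z' -> qq z = qq z' -> P (Gam v z * (Gam v z')^-1)%g.
Proof.
(* The right coset of [Gam v z] modulo [P] is an invariant of [z] to which [qq_inv] applies. *)
move=> rz rz' zz; pose Q z w := P (w * (Gam v z)^-1)%g.
suff e : Q z = Q z' by have : Q z (Gam v z); [rewrite /Q mulgV | rewrite e].
have conv a b : P (Gam v a * (Gam v b)^-1)%g -> Q a = Q b.
  move=> ab; apply/funext => w; apply/propext; rewrite /Q; split=> h.
    by have := PM h ab; rewrite mulgA mulgVK.
  by have := PM h (PV ab); rewrite invgM invgK mulgA mulgVK.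
apply: (qq_inv g0) zz => //.
- move=> u u' _ _; apply: conv; rewrite -(GamM v (0, u) (0, u')).
  have -> : Gam (0, u) (0, u') = 1%g; last by rewrite mulg1 mulgV.
  rewrite -(Gam1 (0, u)); apply: Gam_eq => t _; rewrite /seg /= !mulr0 !addr0.
  exact: qq_center.
- move=> r _; apply: conv.
  have -> : Gam v (r, N) = Gam v (r, 0); last by rewrite mulgV.
  rewrite -(GamM v (0, 0) (r, 0)) -(GamM v (0, 0) (r, N)); congr (_ * _)%g.
  rewrite -(GamM (0, 0) (0, N)).
  have -> : Gam (0, 0) (0, N) = 1%g.
    rewrite -(Gam1 (0, 0)); apply: Gam_eq => t _; rewrite /seg /= !mulr0 !addr0.
    exact: qq_center.
  rewrite mul1g; apply: Gam_eq => t _; rewrite /seg /= !mulr0 !addr0 (qq_seam g0).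
  by rewrite -mulrDl subrK mul1r.
- move=> e s eg e2 s1; apply: conv.
  have e3 : (e + 3 <= 4 * g)%N by lia.
  have := @Gam_pair e 0 s eg e2; rewrite lexx ler01 => /(_ isT s1).
  rewrite addr0 subr0 -natrD => h.
  rewrite -(GamM v (1, e%:R) (1, _ + s)) h -(GamM v (1, (e + 3)%:R) (1, _ - s)) invgM.
  rewrite mulgA mulgK; apply: PM; first by apply: P_corner; lia.
  exact/PV/P_corner.
Qed.

Lemma P_Gam z z' : rect z -> rect z' -> P (Gam z z').
Proof.
have vr : rect v by apply/rectE; rewrite /= lexx ler01 lexx ler0n.
have lv x : Gam v (lift x) = Gam v (lift x0).
  by rewrite -(GamM _ (lift x0) (lift x)) Gam_lift mulg1.
have Pc : P (Gam v (lift x0)).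
  rewrite -(lv (qq v)) -[Gam _ _]invgK; apply: PV.
  have := P_fiber vr (lift_rect (qq v)); rewrite liftK Gam1 mul1g; exact.
have Pv w : rect w -> P (Gam v w).
  move=> rw; have := P_fiber rw (lift_rect (qq w)); rewrite liftK lv => /(_ erefl) h.
  by have := PM h Pc; rewrite mulgVK.
by move=> rz rz'; rewrite -(GamM _ v) GamV; apply: PM; [apply: PV|]; exact: Pv.
Qed.

(** If the homotopy from the identity to [phi] contracts [f] to a point, [f] is the track of its
    start followed by the reversed track of its end. Tracks are images of segments and lie in [P] by
    [P_Gam]. *)
Lemma P_contract (phi : R * R -> R * R) (f : R -> X) c : continuous phi ->
  (forall z, rect z -> rect (phi z)) ->
  (forall z z' s, rect z -> rect z' -> I s -> qq z = qq z' ->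
     qq (seg z (phi z) s) = qq (seg z' (phi z') s)) ->
  continuous f -> (forall t z, I t -> rect z -> qq z = f t -> qq (phi z) = c) -> P (pG f).
Proof.
move=> cphi rphi iphi cf fc.
have ch : continuous (fun w : (R * R) * R => seg w.1 (phi w.1) w.2).
  apply: continuous_pair => w; apply: cvgD; apply: cvgM.
  - by apply: cvgB; [exact: cvg_cst | exact: cvg_snd].
  - exact: (continuousT_comp (fun z => cvg_fst) (fun z => cvg_fst)).
  - exact: cvg_snd.
  - exact: (continuousT_comp (continuousT_comp (fun z => cvg_fst) cphi) (fun z => cvg_fst)).
  - by apply: cvgB; [exact: cvg_cst | exact: cvg_snd].
  - exact: (continuousT_comp (fun z => cvg_fst) (fun z => cvg_snd)).
  - exact: cvg_snd.
  - exact: (continuousT_comp (continuousT_comp (fun z => cvg_fst) cphi) (fun z => cvg_snd)).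
have [H [cH HE]] := @quotient_homotopy _ _ g0 _ hX hg (fun z s => seg z (phi z) s) ch iphi.
  have I0 : I 0 by rewrite /= in_itv/= lexx ler01.
  have I1 : I 1 by rewrite /= in_itv/= lexx ler01.
  pose F (z : R * R) := H (f z.1, z.2).
  have cF : continuous F.
    apply: continuousT_comp cH; apply: continuous_pair => z; last exact: cvg_snd.
    exact: (continuousT_comp (fun z => cvg_fst) cf).
  have Ff t : F (t, 0) = f t.
    by rewrite /F /= -{1}(liftK (f t)) HE; [rewrite seg0 liftK | exact: lift_rect |].
  have F1 t : I t -> F (t, 1) = c.
    move=> It; rewrite /F /= -{1}(liftK (f t)) HE; [|exact: lift_rect|by []].
    by rewrite seg1; apply: (fc t) => //; [exact: lift_rect | exact: liftK].
  have Ptrack t : P (pGam x0 kap F (t, 0) (t, 1)).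
    have -> : pGam x0 kap F (t, 0) (t, 1) = Gam (lift (f t)) (phi (lift (f t))).
      apply: (pG_eq continuous_kap kap0 kap1).
      - by apply: continuousT_comp => //; exact: continuous_seg.
      - by apply: continuousT_comp => //; exact: continuous_seg.
      move=> s Is; rewrite /F /= -mulrDl subrK mul1r mulr0 add0r mulr1.
      by rewrite -{1}(liftK (f t)) HE //; exact: lift_rect.
    by apply: P_Gam; [exact: lift_rect | exact/rphi/lift_rect].
  have -> : pG f = pGam x0 kap F (0, 0) (1, 0).
    have -> : f = F \o (fun t => (t, 0)) by apply/funext => t /=.
    have ca : continuous (fun t : R => (t, 0 : R)).
      by apply: continuous_pair => t; [exact: cvg_id | exact: cvg_cst].
    by rewrite (pG_square continuous_kap kap0 kap1 cF ca).
  have M := pGamM continuous_kap kap0 kap1 cF.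
  rewrite -(M _ (0, 1)) -(M (0, 1) (1, 1)) (pGamV continuous_kap kap0 kap1 cF (1, 0) (1, 1)).
  rewrite (@pGam_cst _ _ _ _ continuous_kap kap0 kap1 _ cF (0, 1) (1, 1)) ?mul1g; last first.
    move=> t It; have -> : seg (0, 1) (1, 1) t = (t, 1 : R) by rewrite /seg /=; congr (_, _); lra.
    by rewrite !F1.
  by apply: PM; [|apply: PV]; exact: Ptrack.
Qed.
End generation.
End polygon_group.

Section generation.
Context {R : realType} (g : nat) (g0 : (0 < g)%N) (X : topologicalType).
Context (hX : hausdorff_space X) (hg : has_genus R g X) (x0 : X).
Local Notation N := ((4 * g)%:R : R).
Local Notation rect := (@rect R g).
Local Notation I := (`[0, 1]%classic : set R).
Local Notation qq := (qq hg).
Local Notation pi1 := (pi1 R x0).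
Local Notation lift := (lift g0 hg).
Local Notation kap := (kap g0 hg x0).
Local Notation pG := (pG x0 kap).

Section petal_map.
Context (r d : R -> R) (cr : continuous r) (cd : continuous d) (r0 : r 0 = 0) (r1 : r 1 = 1).
Context (rI : forall p, 0 <= p <= 1 -> 0 <= r p <= 1).
Context (d0 : forall x, x <= 0 -> d x = 0) (d1 : forall x, 1 <= x -> d x = 0).
Context (dB : forall x, d (1 - x) = - d x) (dI : forall x, 0 <= x <= 1 -> 0 <= x + d x <= 1).

Definition petal_map (z : R * R) : R * R := (r z.1, z.2 + bump g d z.2).

Lemma petal_edge p k s : (k < 4 * g)%N -> 0 <= s <= 1 ->
  petal_map (p, k%:R + s) = (r p, k%:R + (s + d s)).
Proof. by move=> kg s1; rewrite /petal_map /= bump_edge // addrA. Qed.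

Lemma seg_petal p k s t : (k < 4 * g)%N -> 0 <= s <= 1 ->
  seg (p, k%:R + s) (petal_map (p, k%:R + s)) t =
  ((1 - t) * p + t * r p, k%:R + (s + t * d s)).
Proof. by move=> kg s1; rewrite petal_edge // /seg /=; congr (_, _); lra. Qed.

Lemma petal_rect z : rect z -> rect (petal_map z).
Proof.
case: z => p u /rectE[/= p1 u1]; have [k [s [kg s1 ->]]] := edge_decomp g0 u1.
rewrite petal_edge //; have := @rect_edge R g k _ kg (dI s1) => /rectE[_ /= h].
by apply/rectE; split=> //=; exact: rI.
Qed.

Lemma petal_compat z z' t : rect z -> rect z' -> I t -> qq z = qq z' ->
  qq (seg z (petal_map z) t) = qq (seg z' (petal_map z') t).
Proof.
rewrite /= in_itv/= => rz rz' t1; have g4 : (0 < 4 * g)%N by lia.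
have N1 : N = (4 * g).-1%:R + 1 by rewrite natr1 prednK.
pose Q z := qq (seg z (petal_map z) t); rewrite -/(Q z) -/(Q z').
apply: (qq_inv g0) => //.
- move=> u u' u1 u1'; have [k [s [kg s1 ->]]] := edge_decomp g0 u1.
  have [k' [s' [kg' s1' ->]]] := edge_decomp g0 u1'.
  by rewrite /Q !seg_petal // r0 !mulr0 addr0; exact: qq_center.
- move=> p p1; rewrite /Q; have := @seg_petal p 0 0 t g4.
  rewrite lexx ler01 d0 // mulr0 !addr0 => -> //.
  rewrite N1 seg_petal ?prednK ?ler01 ?lexx //.
  by rewrite d1 // mulr0 addr0 -N1 -(qq_seam g0).
- move=> e s eg e2 s1; rewrite /Q edge_flip seg_petal // seg_petal; [|lia|lra].
  rewrite dB r1 (_ : (1 - t) * 1 + t * 1 = 1); last by lra.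
  rewrite qq_pair // ?edge_flip; first by congr (qq (_, _)); lra.
  have := dI s1; nra.
Qed.

Lemma continuous_petal : continuous petal_map.
Proof.
apply: continuous_pair.
  exact: (continuousT_comp (fun z => cvg_fst) cr).
move=> z; apply: cvgD; first exact: cvg_snd.
exact: (continuousT_comp (fun z => cvg_snd) (continuous_bump cd)).
Qed.

Context (P : pi1 -> Prop) (P1 : P 1%g) (PM : forall x y, P x -> P y -> P (x * y)%g).
Context (PV : forall x, P x -> P x^-1%g).
Context (PE : forall k, (k < 4 * g)%N -> P (edge g0 hg x0 k)).

Lemma P_local_of (Q : R * R -> bool) c x :
  (forall z z', rect z -> rect z' -> qq z = qq z' -> Q z = Q z') ->
  (forall z, Q z -> \forall z' \near z, Q z') ->
  (forall z, rect z -> Q z -> qq (petal_map z) = c) -> Q (lift x) ->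
  exists V : set X, [/\ open V, V x &
    forall f : R -> X, continuous f -> (forall t, I t -> V (f t)) -> P (pG f)].
Proof.
move=> Qs Qo Qc Qx; exists [set y | Q (lift y)]; split=> //=.
  apply: (open_qq g0 hX (hg := hg)) => z rz /=.
  have e w : rect w -> Q (lift (qq w)) = Q w.
    by move=> rw; apply: Qs => //; [exact: lift_rect | exact: liftK].
  rewrite e // => /Qo zn; near=> z' => rz'; rewrite e //.
  by near: z'.
move=> f cf fV; apply: (P_contract hX P1 PM PV PE (phi := petal_map) (c := c)) => //.
- exact: continuous_petal.
- exact: petal_rect.
- by move=> z z' s; exact: petal_compat.
- move=> t z It rz zf; apply: Qc => //.
  by rewrite (Qs z (lift (f t))) ?fV ?liftK //; exact: lift_rect.
Unshelve. all: by end_near. Qed.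
End petal_map.

Lemma qq_corner k : (k <= 4 * g)%N -> qq (1, k%:R) = qq (1, 0).
Proof.
have s0 : 0 <= (0 : R) <= 1 by rewrite lexx ler01.
have s1 : 0 <= (1 : R) <= 1 by rewrite lexx ler01.
have p0 e : (e < 4 * g)%N -> (e %% 4 < 2)%N -> qq (1, e%:R) = qq (1, (e + 3)%:R).
  move=> eg e2; have := qq_pair g0 hg eg e2 s0.
  by rewrite addr0 subr0 natrD.
have p1 e : (e < 4 * g)%N -> (e %% 4 < 2)%N -> qq (1, (e + 1)%:R) = qq (1, (e + 2)%:R).
  move=> eg e2; have := qq_pair g0 hg eg e2 s1; rewrite !natrD => ->.
  by congr (qq (_, _)); lra.
have blk j : (j < g)%N -> [/\ qq (1, (4 * j + 1)%:R) = qq (1, (4 * j)%:R),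
    qq (1, (4 * j + 2)%:R) = qq (1, (4 * j)%:R), qq (1, (4 * j + 3)%:R) = qq (1, (4 * j)%:R) &
    qq (1, (4 * j + 4)%:R) = qq (1, (4 * j)%:R)].
  move=> jg; have a := p0 (4 * j)%N; have b := p1 (4 * j)%N.
  have c := p0 (4 * j + 1)%N; have e := p1 (4 * j + 1)%N.
  have {}a := a ltac:(lia) ltac:(lia); have {}b := b ltac:(lia) ltac:(lia).
  have {}c : qq (1, (4 * j + 1)%:R) = qq (1, (4 * j + 4)%:R).
    by rewrite c -?addnA //; lia.
  have {}e : qq (1, (4 * j + 2)%:R) = qq (1, (4 * j + 3)%:R).
    by have := e ltac:(lia) ltac:(lia); rewrite -!addnA.
  by split; [rewrite b e -a | rewrite e -a | rewrite -a | rewrite -c b e -a].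
have h j : (j <= g)%N -> qq (1, (4 * j)%:R) = qq (1, 0).
  elim: j => [|j IH] jg; first by rewrite muln0.
  by have [_ _ _ e] := blk j jg; rewrite -(IH (ltnW jg)) -e mulnS addnC.
move=> kg; have [k4|k4] := eqVneq (k %% 4)%N 0%N.
  have -> : k = (4 * (k %/ 4))%N by lia.
  by apply: h; lia.
have jg : (k %/ 4 < g)%N by lia.
have [b1 b2 b3 _] := blk _ jg; rewrite -(h (k %/ 4)%N (ltnW jg)).
have [e|[e|e]] : (k = 4 * (k %/ 4) + 1 \/ k = 4 * (k %/ 4) + 2 \/ k = 4 * (k %/ 4) + 3)%N by lia.
- by rewrite {1}e.
- by rewrite {1}e.
- by rewrite {1}e.
Qed.
(** The map [rs0] collapses the radii up to 3/4 to the centre, and [rs1] pushes those from 1/2 on to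
    the boundary. *)
Let rs0 (p : R) : R := Num.max 0 (4 * p + -3).
Let rs1 (p : R) : R := Num.min 1 (2 * p + 0).

Let rs0P : [/\ continuous rs0, rs0 0 = 0, rs0 1 = 1 & forall p, 0 <= p <= 1 -> 0 <= rs0 p <= 1].
Proof.
split; rewrite /rs0; last by move=> p p1; case: (leP 0 (4 * p + -3)) => ?; lra.
- by apply: continuous_maxr => [t|]; [exact: cvg_cst | exact: continuous_affine].
- by case: (leP 0 (4 * 0 + -3)) => ?; lra.
- by case: (leP 0 (4 * 1 + -3)) => ?; lra.
Qed.

Let rs1P : [/\ continuous rs1, rs1 0 = 0, rs1 1 = 1 & forall p, 0 <= p <= 1 -> 0 <= rs1 p <= 1].
Proof.
split; rewrite /rs1; last by move=> p p1; case: (leP 1 (2 * p + 0)) => ?; lra.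
- by apply: continuous_minr => [t|]; [exact: cvg_cst | exact: continuous_affine].
- by case: (leP 1 (2 * 0 + 0)) => ?; lra.
- by case: (leP 1 (2 * 1 + 0)) => ?; lra.
Qed.

Let nearQ (h k : R * R -> R) a b z : continuous h -> continuous k -> (a < h z) && (k z < b) ->
  \forall z' \near z, (a < h z') && (k z' < b).
Proof.
move=> ch ck /andP[hz kz].
have h1 : \forall z' \near z, a < h z' by exact: (cvgr_gt (h z) (ch z)).
have h2 : \forall z' \near z, k z' < b by exact: (cvgr_lt (k z) (ck z)).
near=> z'; apply/andP; split; [by near: z' | by near: z'].
Unshelve. all: by end_near. Qed.

Context (P : pi1 -> Prop) (P1 : P 1%g) (PM : forall x y, P x -> P y -> P (x * y)%g).
Context (PV : forall x, P x -> P x^-1%g).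
Context (PE : forall k, (k < 4 * g)%N -> P (edge g0 hg x0 k)).

Let g4 : (0 < 4 * g)%N. Proof. by rewrite muln_gt0 g0. Qed.
Let gN : ((4 * g).-1 < 4 * g)%N. Proof. by rewrite prednK. Qed.
Let N1 : N = (4 * g).-1%:R + 1. Proof. by rewrite natr1 prednK. Qed.

Let flip_petal j e : (j %% 4 < 2)%N -> (e %% 4 < 2)%N ->
  ((j.+2 == e) || (j.+2 == e.+2)) = ((j == e) || (j == e.+2)).
Proof. by lia. Qed.

(** Three kinds of contractible sets cover the surface: the inner disk, the surroundings of the
    single polygon vertex, and the middles of the paired sides. They overlap because 1/2 < 3/4 for
    radii and 1/4 < 1/3 for the distance to the nearest corner. *)
Lemma P_local x : exists V : set X, [/\ open V, V x &
    forall f : R -> X, continuous f -> (forall t, I t -> V (f t)) -> P (pG f)].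
Proof.
have [c0 r00 r01 r0I] := rs0P; have [c1 r10 r11 r1I] := rs1P.
have cfst : continuous (fst : R * R -> R) by move=> z; exact: cvg_fst.
have csnd : continuous (snd : R * R -> R) by move=> z; exact: cvg_snd.
have /rectE[l1 l2] := lift_rect g0 hg x.
have [x34|x34] := ltP (lift x).1 (3 / 4).
  apply: (@P_local_of rs0 (fun=> 0) c0 _ r00 r01 r0I _ _ _ _ P P1 PM PV PE (fun z => z.1 < 3 / 4) (qq (0, 0))) => //.
  - by move=> s; exact: cvg_cst.
  - by move=> s; rewrite oppr0.
  - by move=> s; rewrite addr0.
  - by move=> z z' rz rz'; apply: (qq_inv g0 (Q := fun z => z.1 < 3 / 4)).
  - by move=> z z34; exact: (cvgr_lt z.1 (cfst z)).
  - move=> z _ z34; rewrite /petal_map (_ : rs0 z.1 = 0); first exact: qq_center.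
    by rewrite /rs0 max_l //; lra.
have [k [s [kg s1 ks]]] := edge_decomp g0 l2.
have r1E (p : R) : 2^-1 < p -> rs1 p = 1 by move=> p2; rewrite /rs1 min_l //; lra.
have zdec z : rect z -> exists k s, [/\ (k < 4 * g)%N, 0 <= s <= 1 & z = (z.1, k%:R + s)].
  move=> /rectE[_ /(edge_decomp g0)[k' [s' [kg' s1' e]]]]; exists k', s'.
  by rewrite -e; split=> //; case: (z).
have i0 : 0 <= (0 : R) <= 1 by rewrite lexx ler01.
have i1 : 0 <= (1 : R) <= 1 by rewrite lexx ler01.
have t0 : tent (0 : R) = 0 by exact: tent_le0.
have t1 : tent (1 : R) = 0 by exact: tent_ge1.
have b0 : bump g tent (0 : R) = 0.
  by have := bump_edge (@tent_le0 R) (@tent_ge1 R) g4 i0; rewrite addr0 t0.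
have bN : bump g tent N = 0.
  by have := bump_edge (@tent_le0 R) (@tent_ge1 R) gN i1; rewrite -N1 t1.
have half : 2^-1 < (lift x).1 by lra.
have [ts|ts] := ltP (tent s) 3^-1.
  pose Q (z : R * R) := (2^-1 < z.1) && (bump g tent z.2 < 3^-1).
  apply: (@P_local_of rs1 to_ends c1 (@continuous_to_ends R) r10 r11 r1I (@to_ends0 R) (@to_ends1 R)
    (@to_endsB R) (@to_ends_in R) P P1 PM PV PE Q (qq (1, 0))).
  - move=> z z'; apply: (qq_inv g0 (Q := Q)); rewrite /Q /=.
    + by move=> u u' _ _; rewrite ltNge invr_ge0 ler0n.
    + by move=> p _; rewrite b0 bN.
    + move=> e t eg e2 et; congr (_ && (_ < _)); rewrite edge_flip.
      have bE := bump_edge (@tent_le0 R) (@tent_ge1 R).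
      by rewrite (bE g _ t eg et) (bE g _ (1 - t) (petal_range eg e2)) ?tentB //; lra.
  - move=> z; apply: (nearQ (h := fst) (k := fun z => bump g tent z.2)) => //.
    exact: (continuousT_comp csnd (continuous_bump (@continuous_tent R))).
  - move=> z /zdec[k' [s' [kg' s1' ->]]] /andP[/= z1].
    rewrite (bump_edge (@tent_le0 R) (@tent_ge1 R)) // => ts'.
    rewrite (petal_edge _ (@to_ends0 R) (@to_ends1 R)) // r1E //.
    have [->|->] := to_endsE s1' ts'; first by rewrite addr0 qq_corner // ltnW.
    by rewrite natr1 qq_corner.
  - by rewrite /Q half /= ks (bump_edge (@tent_le0 R) (@tent_ge1 R)).
have [e [eg e2 ek]] := petal_index kg.
pose m u : R := tent (u - e%:R) + tent (u - e.+2%:R).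
have mE j (t : R) : 0 <= t <= 1 -> m (j%:R + t) = if (j == e) || (j == e.+2) then tent t else 0.
  move=> tI; rewrite /m !(shift_edge (@tent_le0 R) (@tent_ge1 R)) //.
  case: (j =P e) => [->|_] /=; last by rewrite add0r.
  by rewrite ifF ?addr0 // ltn_eqF.
have cm : continuous m.
  have ct (a : R) : continuous (fun u : R => tent (u - a)).
    by have := continuousT_comp (@continuous_affine R 1 (- a)) (@continuous_tent R);
       rewrite /comp; under eq_fun do rewrite mul1r.
  by move=> u; apply: cvgD; exact: ct.
pose Q (z : R * R) := (2^-1 < z.1) && (- m z.2 < - 4^-1).
apply: (@P_local_of rs1 to_middle c1 (@continuous_to_middle R) r10 r11 r1I (@to_middle0 R) (@to_middle1 R)
    (@to_middleB R) (@to_middle_in R) P P1 PM PV PE Q (qq (1, e%:R + 2^-1))).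
- move=> z z'; apply: (qq_inv g0 (Q := Q)); rewrite /Q /=.
  + by move=> u u' _ _; rewrite ltNge invr_ge0 ler0n.
  + have m0 : m 0 = 0 by have := mE 0%N 0 i0; rewrite addr0 t0 => ->; case: ifP.
    have mN : m N = 0 by have := mE (4 * g).-1 1 i1; rewrite -N1 t1 => ->; case: ifP.
    by move=> p _; rewrite m0 mN.
  + move=> j t jg j2 jt; congr (_ && (- _ < _)); rewrite edge_flip !mE //; last by lra.
    by rewrite tentB flip_petal.
- move=> z; apply: (nearQ (h := fst) (k := fun z => - m z.2)) => //.
  by move=> w; apply: cvgN; exact: (continuousT_comp csnd cm).
- move=> z /zdec[k' [s' [kg' s1' ->]]] /andP[/= z1]; rewrite ltrN2 mE //.
  case: ifP => [ke ts'|_]; last by rewrite ltNge invr_ge0 ler0n.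
  rewrite (petal_edge _ (@to_middle0 R) (@to_middle1 R)) // r1E // to_middleE //.
  case/orP: ke => /eqP -> //; rewrite (qq_pair g0 hg (e := e)) //; last by lra.
  by rewrite edge_flip; congr (qq (_, _)); lra.
- rewrite /Q half /= ks ltrN2 mE // ifT; first by lra.
  by case: ek => ->; rewrite eqxx ?orbT.
Qed.

Theorem edge_generation y : P y.
Proof.
have ck x : continuous (kap x) by exact: continuous_kap.
have k0 x : kap x 0 = x0 by exact: kap0.
have k1 x : kap x 1 = x by exact: kap1.
have kx : kap x0 = cst x0 by exact: kapx0.
have [f fl ->] := pcl_surj y; rewrite -(pG_is_loop ck k0 k1 kx fl); have [cf _ _] := fl.
pose F := f \o (fst : R * R -> R).
have cF : continuous F by apply: continuousT_comp cf => z; exact: cvg_fst.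
pose G a b := pGam x0 kap F (a, 0) (b, 0).
have GM a b c : (G a b * G b c)%g = G a c by exact: (pGamM ck k0 k1 cF).
have segE (a b t : R) : F (seg (a, 0) (b, 0) t) = f ((1 - t) * a + t * b) by [].
suff -> : pG f = G 0 1.
  apply: (@locally_constant_prop R 0 1 (fun t => P (G 0 t)) _ 0); rewrite ?lexx ?ler01 //; last first.
    by rewrite /G (pGam1 ck k0 k1 cF).
  move=> t It; have [V [oV Vt VP]] := P_local (f t).
  have : nbhs t (f @^-1` V) by apply: cf; apply: open_nbhs_nbhs.
  move=> /nbhs_ballP[e /= e0 eV]; exists e => // s s' Is Is' st st' Ps.
  rewrite -(GM 0 s s'); apply: PM => //.
  have -> : G s s' = pG (F \o seg (s, 0) (s', 0) \o clamp 0 1).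
    have cs : continuous (F \o seg (s, 0) (s', 0)).
      by apply: continuousT_comp cF; exact: continuous_seg.
    apply: (pG_eq ck k0 k1) => //.
      by apply: continuousT_comp cs; exact: continuous_clamp.
    by move=> r; rewrite /= in_itv/= => r1; rewrite clamp_id.
  apply: VP.
    apply: continuousT_comp; first exact: continuous_clamp.
    by apply: continuousT_comp cF; exact: continuous_seg.
  move=> r _; rewrite /= segE; apply: eV; have := @clamp_in R 0 1 r ler01.
  set c := clamp _ _ _; move: st st'; rewrite /ball /= !ltr_distlC => s1 s2 c1.
  case/andP: c1 => c0 c1; have [ss|ss] := leP s s'.
    have h1 : 0 <= c * (s' - s) by rewrite mulr_ge0 // subr_ge0.
    have h2 : c * (s' - s) <= s' - s by rewrite ler_piMl // subr_ge0.
    by lra.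
  have h1 : 0 <= c * (s - s') by rewrite mulr_ge0 // subr_ge0 ltW.
  have h2 : c * (s - s') <= s - s' by rewrite ler_piMl // subr_ge0 ltW.
  by lra.
rewrite /G /pGam; apply: (pG_eq ck k0 k1) => //.
  by apply: continuousT_comp cF; exact: continuous_seg.
by move=> t _; rewrite /= segE mulr0 mulr1 add0r.
Qed.
End generation.

(** * Parallel transport of flat sections along paths *)

(* [Fl V w] says that [w] is a flat section over the open set [V] of a covering
   of [X] all of whose fibres are identified with [W]. *)
Section transport.
Context {R : realType} {X : topologicalType} {W : Type} (Fl : set X -> (X -> W) -> Prop).
Context (FlE : forall x, exists V : set X, [/\ open V, V x &
  forall y w1, V y -> exists w, Fl V w /\ w y = w1]).
Context (FlU : forall V w V' w', Fl V w -> Fl V' w' ->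
  open [set y | [/\ V y, V' y & w y = w' y]] /\ open [set y | [/\ V y, V' y & w y <> w' y]]).
Implicit Types (a b : R -> X) (u v : R -> W) (V : set X).

(** A lift of the path [a] to the covering, recorded by its values in the fibre [W]. *)
Definition sec a (al be : R) u : Prop := forall t, al <= t <= be ->
  exists V w (e : R), [/\ Fl V w, 0 < e &
    forall s, al <= s <= be -> `|s - t| < e -> V (a s) /\ u s = w (a s)].

Lemma near_path a t (O : set X) : continuous a -> open O -> O (a t) ->
  exists2 e : R, 0 < e & forall s, `|s - t| < e -> O (a s).
Proof.
move=> ca oO Ot; have : nbhs t (a @^-1` O) by apply: ca; apply: open_nbhs_nbhs.
move=> /nbhs_ballP[e /= e0 eO]; exists e => // s st; apply: eO.
by rewrite /ball /= distrC.
Qed.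

Lemma sec_sub a al be al' be' u : sec a al be u -> al <= al' -> be' <= be -> sec a al' be' u.
Proof.
move=> su aa bb t t1; have [|V [w [e [Vw e0 h]]]] := su t; first by lra.
by exists V, w, e; split=> // s s1; apply: h; lra.
Qed.

Lemma sec_eq a b al be u v : (forall t, al <= t <= be -> a t = b t /\ u t = v t) ->
  sec a al be u -> sec b al be v.
Proof.
move=> h su t t1; have [V [w [e [Vw e0 he]]]] := su t t1; exists V, w, e; split=> // s s1 st.
by have [<- <-] := h s s1; exact: he.
Qed.

Lemma sec_reparam a (p : R -> R) al be al' be' u : continuous p ->
  (forall t, al' <= t <= be' -> al <= p t <= be) -> sec a al be u ->
  sec (a \o p) al' be' (u \o p).
Proof.
move=> cp pI su t t1; have [V [w [e [Vw e0 he]]]] := su (p t) (pI t t1).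
have : nbhs t (p @^-1` ball (p t) e) by apply: cp; exact: nbhsx_ballx.
move=> /nbhs_ballP[d /= d0 dp]; exists V, w, d; split=> // s s1 st /=.
by apply: he; [exact: pI | rewrite distrC; apply: dp; rewrite /ball /= distrC].
Qed.

Lemma sec_chart a al be V w : Fl V w -> (forall t, al <= t <= be -> V (a t)) ->
  sec a al be (w \o a).
Proof. by move=> Vw aV t t1; exists V, w, 1; split=> // s s1 _; split=> //; exact: aV. Qed.

Lemma sec_uniq a al be u v : continuous a -> sec a al be u -> sec a al be v ->
  forall s t, al <= s <= be -> al <= t <= be -> u s = v s -> u t = v t.
Proof.
move=> ca su sv; apply: (@locally_constant_prop R al be (fun t => u t = v t)) => t t1.
have [V [w [e [Vw e0 he]]]] := su t t1; have [V' [w' [e' [Vw' e0' he']]]] := sv t t1.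
have dist0 (d : R) : 0 < d -> `|t - t| < d by rewrite subrr normr0.
have [ o1 o2] := FlU Vw Vw'; have [Vt ut] := he t t1 (dist0 _ e0).
have [Vt' vt] := he' t t1 (dist0 _ e0').
have [ww|ww] := pselect (w (a t) = w' (a t)).
  have [d d0 dO] := near_path ca o1 (And3 Vt Vt' ww).
  exists (Num.min e' (Num.min e d)); first by rewrite !lt_min e0 e0'.
  move=> s s' s1 s1'; rewrite !lt_min => _ /and3P[se' se sd] _.
  have [_ _ h] := dO s' sd; rewrite (he s' s1' se).2 (he' s' s1' se').2.
  exact: h.
have [d d0 dO] := near_path ca o2 (And3 Vt Vt' ww).
exists (Num.min e' (Num.min e d)); first by rewrite !lt_min e0 e0'.
move=> s s' s1 s1'; rewrite !lt_min => /and3P[se' se sd] _ h.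
have [_ _ []] := dO s sd.
by rewrite -(he s s1 se).2 -(he' s s1 se').2.
Qed.

Lemma sec_follow a al be u V w s t : continuous a -> sec a al be u -> Fl V w ->
  (forall r, al <= r <= be -> V (a r)) -> al <= s <= be -> al <= t <= be ->
  u s = w (a s) -> u t = w (a t).
Proof.
move=> ca su Vw aV s1 t1 us.
exact: (sec_uniq ca su (sec_chart Vw aV) s1 t1).
Qed.

Lemma sec_glue a al be ga u v : continuous a -> al <= be -> be <= ga ->
  sec a al be u -> sec a be ga v -> u be = v be ->
  sec a al ga (fun t => if t <= be then u t else v t).
Proof.
move=> ca ab bg su sv uv t t1; have [tb|bt|tb] := ltgtP t be.
- have [|V [w [e [Vw e0 he]]]] := su t; first by lra.
  exists V, w, (Num.min e (be - t)); split=> //; first by rewrite lt_min e0 subr_gt0.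
  move=> s s1; rewrite lt_min => /andP[se]; rewrite ltr_norml => sb.
  by rewrite ifT; [apply: he => //; lra | lra].
- have [|V [w [e [Vw e0 he]]]] := sv t; first by lra.
  exists V, w, (Num.min e (t - be)); split=> //; first by rewrite lt_min e0 subr_gt0.
  move=> s s1; rewrite lt_min => /andP[se]; rewrite ltr_norml => sb.
  rewrite ifF; first by apply: he => //; lra.
  by apply/negbTE; rewrite -ltNge; lra.
- have b1 : al <= be <= be by rewrite ab lexx.
  have b2 : be <= be <= ga by rewrite bg lexx.
  rewrite {}tb {t t1}; have [V [w [e [Vw e0 he]]]] := su be b1.
  have [V' [w' [e' [Vw' e0' he']]]] := sv be b2.
  have dist0 (d : R) : 0 < d -> `|be - be| < d by rewrite subrr normr0.
  have [Vb ub] := he be b1 (dist0 _ e0); have [Vb' vb] := he' be b2 (dist0 _ e0').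
  have ww : w (a be) = w' (a be) by rewrite -ub -vb.
  have [d d0 dO] := near_path ca (FlU Vw Vw').1 (And3 Vb Vb' ww).
  exists V, w, (Num.min e' (Num.min e d)); split=> //; first by rewrite !lt_min e0 e0'.
  move=> s s1; rewrite !lt_min => /and3P[se' se sd].
  case: ifPn => sb; first by apply: he => //; lra.
  have [Vs _ ->] := dO s sd; split=> //; apply: (he' s _ se').2.
  by move: sb; rewrite -ltNge; lra.
Qed.

Lemma sec_exist a al be w0 : continuous a -> al <= be -> exists u, sec a al be u /\ u al = w0.
Proof.
move=> ca ab; have aI : al <= al <= be by rewrite lexx.
apply: (@locally_constant_prop R al be (fun T => exists u, sec a al T u /\ u al = w0) _ al);
  rewrite ?lexx ?ab //; last first.
  have [V [_ Va]] := FlE (a al); move=> /(_ _ w0 Va)[w [Vw <-]].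
  exists (w \o a); split=> //; apply: (sec_chart Vw) => t; rewrite -eq_le => /eqP <- //.
move=> t t1; have [V [oV Vt VE]] := FlE (a t).
have [e e0 eV] := near_path ca oV Vt; exists e => // s s' s1 s1' st st' [u [su u0]].
have [ss|ss] := leP s' s.
  by exists u; split=> //; apply: sec_sub su _ _.
have [w [Vw ws]] := VE _ (u s) (eV s st).
exists (fun t => if t <= s then u t else (w \o a) t); split; last first.
  by rewrite ifT //; case/andP: s1.
apply: sec_glue => //; [by case/andP: s1 | exact: ltW |].
apply: (sec_chart Vw) => r r1; apply: eV.
by move: st st'; rewrite !ltr_norml; lra.
Qed.

Definition trans a (w w' : W) : Prop := exists u, [/\ sec a 0 1 u, u 0 = w & u 1 = w'].

Let i0 : 0 <= (0 : R) <= 1. Proof. by rewrite lexx ler01. Qed.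
Let i1 : 0 <= (1 : R) <= 1. Proof. by rewrite lexx ler01. Qed.

Lemma trans_total a w : continuous a -> exists w', trans a w w'.
Proof.
by move=> ca; have [u [su u0]] := sec_exist w ca ler01; exists (u 1), u.
Qed.

Lemma trans_fun a w w1 w2 : continuous a -> trans a w w1 -> trans a w w2 -> w1 = w2.
Proof.
move=> ca [u [su u0 <-]] [v [sv v0 <-]].
by apply: (sec_uniq ca su sv i0 i1); rewrite u0 v0.
Qed.

Lemma trans_eq a b w w' : (forall t, 0 <= t <= 1 -> a t = b t) -> trans a w w' -> trans b w w'.
Proof. by move=> ab [u [su u0 u1]]; exists u; split=> //; apply: sec_eq su => t t1; split=> //; exact: ab. Qed.

Lemma trans_rev a w w' : trans a w w' -> trans (rev_fun a) w' w.
Proof.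
move=> [u [su u0 u1]]; exists (fun t => u (1 - t)); split; rewrite ?subr0 ?subrr //.
apply: (sec_reparam (p := fun t => 1 - t)) su => [t|t t1]; last by lra.
by apply: cvgB; [exact: cvg_cst | exact: cvg_id].
Qed.

Lemma trans_cat a b w w1 w2 : continuous a -> continuous b -> a 1 = b 0 ->
  trans a w w1 -> trans b w1 w2 -> trans (cat_fun a b) w w2.
Proof.
move=> ca cb ab [u [su u0 u1]] [v [sv v0 v1]].
exists (fun t => if t <= 2^-1 then (u \o (fun t => 2 * t + 0)) t else (v \o (fun t => 2 * t + (-1))) t).
split; last first.
- rewrite ifF; first by rewrite /= -v1; congr v; lra.
  by apply/negbTE; rewrite -ltNge; lra.
- by rewrite ifT ?invr_ge0 //= mulr0 addr0.
apply: sec_glue.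
- exact: continuous_path_cat.
- by rewrite invr_ge0.
- lra.
- apply: (@sec_eq (a \o (fun t => 2 * t + 0)) _ _ _ (u \o (fun t => 2 * t + 0))).
    by move=> t /andP[_ t2]; rewrite /cat_fun t2 /= addr0.
  by apply: sec_reparam su => [|t t1]; [exact: continuous_affine | lra].
- apply: (@sec_eq (b \o (fun t => 2 * t + (-1))) _ _ _ (v \o (fun t => 2 * t + (-1)))).
    move=> t t1; split=> //=; rewrite /cat_fun; case: ifPn => // t2.
    have -> : t = 2^-1 by lra.
    by rewrite divff // subrr ab.
  by apply: sec_reparam sv => [|t t1]; [exact: continuous_affine | lra].
- by rewrite /= divff // addr0 subrr u1 v0.
Qed.

Lemma trans_cst x w : trans (cst x) w w.
Proof.
have [V [_ Vx /(_ _ w Vx)[w' [Vw wx]]]] := FlE x.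
by exists (w' \o cst x); split=> //; apply: (sec_chart Vw).
Qed.

(** For fixed [s0], the property [D t] says that all lifts with parameter near [s0] follow one flat
    section at [t]. It propagates from [t = 0] to [t = 1], where it shows that the end of the lift
    is locally constant in [s]. *)
Lemma sec_homotopy (F : R * R -> X) (u : R -> R -> W) x1 w0 : continuous F ->
  (forall s, 0 <= s <= 1 -> F (0, s) = F (0, 0) /\ F (1, s) = x1) ->
  (forall s, 0 <= s <= 1 -> sec (fun t => F (t, s)) 0 1 (u s) /\ u s 0 = w0) ->
  u 0 1 = u 1 1.
Proof.
move=> cF Fe su; have cs s : continuous (fun t => F (t, s)).
  apply: (continuousT_comp _ cF); apply: continuous_pair => t; first exact: cvg_id.
  exact: cvg_cst.
have ct t : continuous (fun s => F (t, s)).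
  apply: (continuousT_comp _ cF); apply: continuous_pair => s; first exact: cvg_cst.
  exact: cvg_id.
apply/esym; apply: (@locally_constant_prop R 0 1 (fun s => u s 1 = u 0 1) _ 0 1 i0 i1 erefl).
move=> s0 s0I; pose D t := exists V w (e : R), [/\ Fl V w, 0 < e &
  forall s, 0 <= s <= 1 -> `|s - s0| < e -> V (F (t, s)) /\ u s t = w (F (t, s))].
have dist0 (d : R) : 0 < d -> `|s0 - s0| < d by rewrite subrr normr0.
suff [V [w [e [Vw e0 he]]]] : D 1.
  exists e => // s s' s1 s1' se se'.
  by rewrite (he s s1 se).2 (he s' s1' se').2 (Fe s s1).2 (Fe s' s1').2.
apply: (@locally_constant_prop R 0 1 D _ 0 1 i0 i1); last first.
  have [V [_ Vx /(_ _ w0 Vx)[w [Vw wx]]]] := FlE (F (0, 0)).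
  exists V, w, 1; split=> // s s1 _.
  by rewrite (su s s1).2 (Fe s s1).1.
move=> t t1; have [V [oV Vt VE]] := FlE (F (t, s0)).
have : nbhs (t, s0) (F @^-1` V) by apply: cF; apply: open_nbhs_nbhs.
move=> /nbhs_ballP[e /= e0 eV]; exists e => // r r' r1 r1' rt rt' [V1 [w1 [d [Vw1 d0 hd]]]].
have box q s : `|q - t| < e -> `|s - s0| < e -> V (F (q, s)).
  by move=> qt ss; apply: eV; split; rewrite /ball /= distrC.
have [Vr ur] := hd s0 s0I (dist0 _ d0).
have [w [Vw ws]] := VE _ (w1 (F (r, s0))) (box _ _ rt (dist0 _ e0)).
have [h h0 hO] := near_path (ct r) (FlU Vw Vw1).1 (And3 (box _ _ rt (dist0 _ e0)) Vr ws).
exists V, w, (Num.min h (Num.min e d)); split=> //; first by rewrite !lt_min h0 e0.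
move=> s s1; rewrite !lt_min => /and3P[sh se sd]; split; first exact: box.
have [_ _ wr] := hO s sh; have us : u s r = w (F (r, s)) by rewrite wr; exact: (hd s s1 sd).2.
have cover q : Num.min r r' <= q <= Num.max r r' -> `|q - t| < e.
  by move: rt rt'; rewrite !ltr_norml; case: (leP r r') => ?; lra.
apply: (@sec_follow (fun t => F (t, s)) (Num.min r r') (Num.max r r') (u s) V w r r') => //.
- by apply: sec_sub (su s s1).1 _ _; case: (leP r r') => ?; lra.
- by move=> q /cover qt; exact: box.
- by case: (leP r r') => ?; lra.
- by case: (leP r r') => ?; lra.
Qed.

Lemma trans_pheq a b w w' : continuous a -> pheq a b -> trans a w w' -> trans b w w'.
Proof.
move=> ca [F [cF Fa Fb Fe]] tw.
have /choice[u uP] : forall s, exists u, sec (fun t => F (t, s)) 0 1 u /\ u 0 = w.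
  move=> s; apply: sec_exist => //; apply: (continuousT_comp _ cF).
  by apply: continuous_pair => t; [exact: cvg_id | exact: cvg_cst].
have e : u 0 1 = u 1 1.
  apply: (@sec_homotopy F u (a 1) w cF) => s _; last exact: uP.
  by rewrite !(Fe _).1 (Fe s).2.
have ta : trans a w (u 0 1).
  exists (u 0); have [su ->] := uP 0; split=> //; apply: sec_eq su => t _.
  by rewrite Fa.
rewrite (trans_fun ca tw ta) e; exists (u 1); have [su ->] := uP 1; split=> //.
by apply: sec_eq su => t _; rewrite Fb.
Qed.

Lemma trans_pcl x0 a b w w' : is_loop x0 a -> is_loop x0 b -> pcl x0 a = pcl x0 b ->
  trans a w w' -> trans b w w'.
Proof.
move=> al bl; rewrite (pclE al) (pclE bl) => /pi1P[F [cF Fa Fb Fe]] tw.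
have [ca a0 a1] := al; have [cb b0 b1] := bl.
have cc : continuous (clamp 0 1 : R -> R) by exact: continuous_clamp.
have cin t : `[0, 1]%classic (clamp 0 1 t : R) by rewrite /= in_itv/= clamp_in.
have ph : pheq (a \o clamp 0 1) (b \o clamp 0 1).
  exists (F \o (fun z => (clamp 0 1 z.1, clamp 0 1 z.2))).
  have c0 : clamp 0 1 (0 : R) = 0 by rewrite clamp_id.
  have c1 : clamp 0 1 (1 : R) = 1 by rewrite clamp_id.
  split=> [|t|t|s] /=; rewrite ?c0 ?c1.
  - apply/continuous_subspace_setT; apply: (within_comp _ _ cF) => [|z _]; last by split; exact: cin.
    apply: continuous_subspaceT; apply: continuous_pair.
      exact: (continuousT_comp (fun z => cvg_fst) cc).
    exact: (continuousT_comp (fun z => cvg_snd) cc).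
  - by rewrite Fa // loop_ofE.
  - by rewrite Fb // loop_ofE.
  - by rewrite a0 a1; exact: Fe.
apply: (@trans_eq (b \o clamp 0 1)); first by move=> t t1; rewrite /= clamp_id.
apply: trans_pheq ph _; first exact: continuousT_comp.
by apply: trans_eq tw => t t1; rewrite /= clamp_id.
Qed.
End transport.

(** * The covering of the polygon quotient given by permutations of a fibre *)

Section corners.
Context {R : realType} (g : nat).
Local Notation N := ((4 * g)%:R : R).

Lemma ltn_natr1 j k : (j < k)%N -> j%:R + 1 <= k%:R :> R.
Proof. by rewrite natr1 ler_nat. Qed.

(** With this rule the midpoint of side [e] goes to corner [e] and that of the paired side to corner
    [e + 3]; these corners correspond under the gluing. *)
Definition past_middle (j : nat) (x : R) : bool :=
  if (j %% 4 < 2)%N then 2^-1 < x else 2^-1 <= x.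

(* The index of the corner nearest to [u]; the midpoint of a side is attributed
   to a corner in a way compatible with the side pairing. *)
Definition nearest_corner (u : R) : nat := (\sum_(j < 4 * g) past_middle j (u - j%:R))%N.

Lemma nearest_corner_le u : (nearest_corner u <= 4 * g)%N.
Proof.
rewrite /nearest_corner -[X in (_ <= X)%N]card_ord -sum1_card; apply: leq_sum => j _.
exact: leq_b1.
Qed.

Lemma sum_step (b : bool) k n : (k < n)%N ->
  (\sum_(j < n) (if j < k then true else if j == k :> nat then b else false) = k + b)%N.
Proof.
suff -> m : (\sum_(j < m) (if j < k then true else if j == k :> nat then b else false) =
  minn k m + (k < m) * b)%N by move=> kn; rewrite (minn_idPl (ltnW kn)) kn mul1n.
elim: m => [|m IH]; first by rewrite big_ord0 minn0.
rewrite big_ord_recr IH /= ltnS.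
by case: (ltngtP m k) => mk; case: (b) => /=; lia.
Qed.

Lemma nearest_corner_edge k (s : R) : (k < 4 * g)%N -> 0 <= s <= 1 ->
  nearest_corner (k%:R + s) = (k + past_middle k s)%N.
Proof.
move=> kg s1; rewrite -(sum_step _ kg) /nearest_corner; apply: eq_bigr => j _; congr (nat_of_bool _).
rewrite /past_middle; case: (ltngtP (j : nat) k) => jk.
- by have h := ltn_natr1 jk; case: ifP => _; apply/idP; lra.
- have h := ltn_natr1 jk.
  by case: ifP => _; apply/negbTE; rewrite -?leNgt -?ltNge; lra.
- by rewrite jk (_ : k%:R + s - k%:R = s) //; lra.
Qed.

Lemma nearest_corner_nat k : (k <= 4 * g)%N -> (0 < g)%N -> nearest_corner (k%:R : R) = k.
Proof.
move=> kg g0; have [kg'|kg'] := ltnP k (4 * g).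
  have := @nearest_corner_edge k 0 kg'; rewrite lexx ler01 addr0 => -> //.
  have -> : past_middle k (0 : R) = false.
    by rewrite /past_middle; case: ifP => _; apply/negbTE; rewrite -?leNgt -?ltNge ?invr_ge0 ?invr_gt0.
  by rewrite addn0.
have -> : k = (4 * g).-1.+1 by lia.
have := @nearest_corner_edge (4 * g).-1 1; rewrite lexx ler01 natr1 => -> //; last by lia.
have -> : past_middle (4 * g).-1 (1 : R) = true.
  by rewrite /past_middle; case: ifP => _; apply/idP; lra.
by rewrite addn1.
Qed.

Lemma nearest_corner_near (u : R) n : (0 < g)%N -> 0 <= u <= N -> `|u - n%:R| < 2^-1 -> nearest_corner u = n.
Proof.
move=> g0 u1; have [k [s [kg s1 ->]]] := edge_decomp g0 u1.
rewrite ltr_norml => ku; rewrite nearest_corner_edge //.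
have kn : (k < n.+1)%N by rewrite -(ltr_nat R) -(natr1 n); lra.
have nk : (n < k.+2)%N by rewrite -(ltr_nat R) -addn2 natrD; lra.
have [e|e] : n = k \/ n = k.+1 by lia.
  rewrite e in ku *; rewrite /past_middle.
  have -> : (2^-1 < s) = false by apply/negbTE; rewrite -leNgt; lra.
  have -> : (2^-1 <= s) = false by apply/negbTE; rewrite -ltNge; lra.
  by case: ifP; rewrite addn0.
rewrite e -(natr1 k) in ku *; rewrite /past_middle.
have -> : 2^-1 < s by lra.
have -> : 2^-1 <= s by lra.
by case: ifP; rewrite addn1.
Qed.
End corners.

Section monodromy.
Context {R : realType} (g : nat) (g0 : (0 < g)%N) (X : topologicalType).
Context (hX : hausdorff_space X) (hg : has_genus R g X) (x0 : X).
Local Notation N := ((4 * g)%:R : R).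
Local Notation rect := (@rect R g).
Local Notation qq := (qq hg).
Local Notation pi1 := (pi1 R x0).
Local Notation lift := (lift g0 hg).
Local Notation kap := (kap g0 hg x0).
Context (W : Type) (Rk : nat -> W -> W).
Context (RK : forall i w, (i < 4 * g)%N -> Rk (linv i) (Rk i w) = w).
Context (Rrel : forall w, foldl (fun w i => Rk i w) w (iota 0 (4 * g)) = w).

(** Transport around the boundary from corner 0 to corner [k], and from there through the rest of
    the turn; the relation makes the two inverse to each other. *)
Definition go k w := foldl (fun w i => Rk i w) w (iota 0 k).
Definition back k w := foldl (fun w i => Rk i w) w (iota k (4 * g - k)).

Lemma goS k w : go k.+1 w = Rk k (go k w).
Proof. by rewrite /go -[k.+1]addn1 iotaD foldl_cat. Qed.

Lemma goK k w : (k <= 4 * g)%N -> back k (go k w) = w.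
Proof.
move=> kg; rewrite /back /go -foldl_cat -[RHS]Rrel.
by have := iotaD 0 k (4 * g - k); rewrite add0n subnKC // => ->.
Qed.

Lemma backK k w : (k <= 4 * g)%N -> go k (back k w) = w.
Proof.
move=> kg; suff inj : injective (back k) by apply: inj; rewrite goK.
rewrite /back; have : all (fun i => i < 4 * g)%N (iota k (4 * g - k)).
  by apply/allP => i; rewrite mem_iota; lia.
elim: (iota _ _) => [_ u v //|i s IH] /= /andP[ig sg] u v /(IH sg) e.
by rewrite -(RK u ig) e RK.
Qed.

(* Points of the open face are compared in a trivialization of the face, points
   of the boundary in a trivialization at their nearest corner. *)
Definition frame (z : R * R) : nat := if z.1 < 1 then 0 else nearest_corner g z.2.

Lemma frame_le z : (frame z <= 4 * g)%N.
Proof. by rewrite /frame; case: ifP => _ //; exact: nearest_corner_le. Qed.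

Definition flat (V : set X) (w : X -> W) : Prop := open V /\ forall z, rect z -> V (qq z) -> \forall z' \near z, rect z' -> V (qq z') ->
    back (frame z') (w (qq z')) = back (frame z) (w (qq z)).

Let back_inj z : injective (back (frame z)).
Proof. by apply: (can_inj (g := go (frame z))) => w; rewrite backK // frame_le. Qed.

Let near_qq (V : set X) z : open V -> V (qq z) -> \forall z' \near z, V (qq z').
Proof. by move=> oV Vz; apply: continuous_qq; apply: open_nbhs_nbhs. Qed.

Lemma flat_agree (V : set X) w (V' : set X) w' : flat V w -> flat V' w' ->
  open [set y | [/\ V y, V' y & w y = w' y]] /\ open [set y | [/\ V y, V' y & w y <> w' y]].
Proof.
move=> [oV Vw] [oV' Vw']; split; apply: (open_qq g0 hX (hg := hg)) => z rz [Vz Vz' ww];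
have n1 := near_qq oV Vz; have n2 := near_qq oV' Vz';
have n3 := Vw z rz Vz; have n4 := Vw' z rz Vz'.
  near=> z' => rz'; have v : V (qq z') by near: z'. have v' : V' (qq z') by near: z'.
  split=> //; apply: (@back_inj z').
  have -> : back (frame z') (w (qq z')) = back (frame z) (w (qq z)).
    by move: rz' v; near: z'.
  by rewrite ww; apply/esym; move: rz' v'; near: z'.
near=> z' => rz'; have v : V (qq z') by near: z'. have v' : V' (qq z') by near: z'.
split=> // e; apply: ww; apply: (@back_inj z).
have <- : back (frame z') (w (qq z')) = back (frame z) (w (qq z)).
  by move: rz' v; near: z'.
by rewrite e; move: rz' v'; near: z'.
Unshelve. all: by end_near. Qed.

(** [Q] is a neighbourhood compatible with the gluing and [j] a locally constant choice of corner
    whose frame is used there. The third hypothesis says that the section with constant value [w0]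
    in that frame is well defined on the quotient. *)
Lemma flat_chart (Q : R * R -> bool) (j : R * R -> nat) x :
  (forall z, (j z <= 4 * g)%N) ->
  (forall z, rect z -> Q z -> \forall z' \near z, rect z' -> Q z' /\ j z' = j z) ->
  (forall z z', rect z -> rect z' -> qq z = qq z' ->
    (Q z, fun w0 => if Q z then go (frame z) (back (j z) w0) else w0) =
    (Q z', fun w0 => if Q z' then go (frame z') (back (j z') w0) else w0)) ->
  Q (lift x) -> exists V : set X, [/\ open V, V x &
    forall y w1, V y -> exists w, flat V w /\ w y = w1].
Proof.
move=> j4 Qo Qs Qx; pose V := [set y | Q (lift y)].
have Qe z : rect z -> Q (lift (qq z)) = Q z /\ (Q z -> forall w0,
    go (frame (lift (qq z))) (back (j (lift (qq z))) w0) = go (frame z) (back (j z) w0)).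
  move=> rz; have := Qs (lift (qq z)) z (lift_rect _ _ _) rz (liftK _ _ _).
  move=> e; have e1 := congr1 fst e; have e2 := congr1 snd e.
  split=> // qz w0; have := congr1 (fun f => f w0) e2.
  by move: e1 => /= ->; rewrite qz.
have oV : open V.
  apply: (open_qq g0 hX (hg := hg)) => z rz; rewrite /V /= (Qe z rz).1 => Qz.
  have := Qo z rz Qz => n1; near=> z' => rz'; rewrite (Qe z' rz').1.
  suff [] : Q z' /\ j z' = j z by [].
  by move: rz'; near: z'.
exists V; split=> // y w1 Vy; pose w0 := go (j (lift y)) (back (frame (lift y)) w1).
exists (fun y' => go (frame (lift y')) (back (j (lift y')) w0)); split; last first.
  by rewrite /w0 goK // backK // frame_le.
split=> // z rz Vz; have Qz : Q z by rewrite -(Qe z rz).1.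
have := Qo z rz Qz => n1; near=> z' => rz' Vz'.
have [Qz' jz] : Q z' /\ j z' = j z by move: rz'; near: z'.
by rewrite (Qe z rz).2 // (Qe z' rz').2 // !goK ?frame_le // jz.
Unshelve. all: by end_near. Qed.

Let back0 w : back 0 w = w.
Proof. by rewrite /back subn0 Rrel. Qed.

Let backN w : back (4 * g) w = w.
Proof. by rewrite /back subnn. Qed.

Let natE n : (n <= 4 * g)%N -> nearest_corner g (n%:R : R) = n.
Proof. by move=> ng; exact: nearest_corner_nat. Qed.

Let pm1 e (t : R) : (e %% 4 < 2)%N -> past_middle e t = (2^-1 < t).
Proof. by rewrite /past_middle => ->. Qed.
Let pm2 e (t : R) : (e %% 4 < 2)%N -> past_middle e.+2 t = (2^-1 <= t).
Proof. by move=> e2; rewrite /past_middle ifF //; lia. Qed.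
Let edge_neq m e : (m %% 4 < 2)%N -> (e %% 4 < 2)%N -> (m == e.+2) = false.
Proof. by lia. Qed.
Let linv2 e : (e %% 4 < 2)%N -> linv e.+2 = e.
Proof. by move=> e2; have := linvP e.+2; rewrite /linv; case: ifP; lia. Qed.

(** Charts are given on the open face, near corners and near midpoints of sides. The boundary
    relation enters at the seam, the rule for inverse letters at the midpoints. *)
Lemma flat_charts x : exists V : set X, [/\ open V, V x &
    forall y w1, V y -> exists w, flat V w /\ w y = w1].
Proof.
have cfst : continuous (fst : R * R -> R) by move=> z; exact: cvg_fst.
have csnd : continuous (snd : R * R -> R) by move=> z; exact: cvg_snd.
have /rectE[l1 l2] := lift_rect g0 hg x.
have c0 : nearest_corner g (0 : R) = 0%N by exact: (@natE 0).
have cN : nearest_corner g N = (4 * g)%N by exact: natE.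
have [x1|x1] := ltP (lift x).1 1.
  apply: (flat_chart (Q := fun z => z.1 < 1) (j := fun=> 0%N)) => //.
    move=> z _ z1; have n1 : \forall z' \near z, z'.1 < 1 by exact: (cvgr_lt z.1 (cfst z)).
    by near=> z' => _; split=> //; near: z'.
  move=> z z'; apply: (qq_inv g0 (Q := fun z => (z.1 < 1, fun w0 => if z.1 < 1
    then go (frame z) (back 0 w0) else w0))) => [u u' _ _|p _|e s _ _ _] /=.
  - by rewrite /frame /= ltr01.
  - by congr (_, _); apply/funext => w0; case: ifP => // p1; rewrite /frame /= p1.
  - by rewrite ltxx.
have p1 : 0 < (lift x).1 by lra.
have [k [s [kg s1 ks]]] := edge_decomp g0 l2.
have [sh|sh] := eqVneq s 2^-1; last first.
  pose Q (z : R * R) := (0 < z.1) && (`|z.2 - (nearest_corner g z.2)%:R| < 2^-1).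
  apply: (flat_chart (Q := Q) (j := fun z => nearest_corner g z.2)).
  - by move=> z; exact: nearest_corner_le.
  - move=> z rz /andP[z1 z2].
    have n1 : \forall z' \near z, 0 < z'.1 by exact: (cvgr_gt z.1 (cfst z)).
    have n2 : \forall z' \near z, `|z'.2 - (nearest_corner g z.2)%:R| < 2^-1.
      have ch : continuous (fun z' : R * R => `|z'.2 - (nearest_corner g z.2)%:R|).
        move=> w; apply: (continuous_comp (f := fun z' : R * R => z'.2 - (nearest_corner g z.2)%:R)).
          by apply: cvgB; [exact: cvg_snd | exact: cvg_cst].
        exact: norm_continuous.
      exact: (cvgr_lt _ (ch z)).
    near=> z' => /rectE[_ r2].
    have h1 : 0 < z'.1 by near: z'.
    have h2 : `|z'.2 - (nearest_corner g z.2)%:R| < 2^-1 by near: z'.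
    have e := nearest_corner_near g0 r2 h2.
    by rewrite /Q e h1 h2.
  - move=> z z'; apply: (qq_inv g0 (Q := fun z => (Q z, fun w0 => if Q z
      then go (frame z) (back (nearest_corner g z.2) w0) else w0))) => [u u' _ _|p _|e t eg e2 t1].
    + by rewrite /Q /= ltxx.
    + rewrite /Q /= c0 cN !subrr; congr (_, _); apply/funext => w0; case: ifP => // _.
      rewrite /frame /= c0 cN back0 backN; case: ifP => _ //.
      by rewrite -[in RHS](backN w0) backK.
    + have eE := @nearest_corner_edge R g e t eg t1.
      have e2g := petal_range eg e2.
      have e2E := @nearest_corner_edge R g e.+2 (1 - t) e2g.
      have -> : Q (1, e%:R + t) = Q (1, e%:R + 3 - t).
        rewrite /Q /= edge_flip e2E ?eE; last by lra.
        rewrite pm1 // pm2 //; congr (_ && (_ < _)); have [h|h] := ltP 2^-1 t.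
          rewrite (_ : (2^-1 <= 1 - t) = false); last by apply/negbTE; rewrite -ltNge; lra.
          by rewrite addn0 addn1 -(natr1 e) distrC; congr `|_|; lra.
        rewrite (_ : 2^-1 <= 1 - t); last by lra.
        by rewrite addn0 addn1 -(natr1 e.+2) -[in RHS]normrN; congr `|_|; lra.
      congr (_, _); apply/funext => w0; case: ifP => // _.
      by rewrite /frame /= ltxx !backK // nearest_corner_le.
  - rewrite /Q p1 ks /= nearest_corner_edge // /past_middle.
    have [h|h] := ltP s 2^-1.
      rewrite (_ : (2^-1 < s) = false); last by apply/negbTE; rewrite -leNgt; lra.
      by case: ifP => _; rewrite addn0 ltr_norml; lra.
    have h' : 2^-1 < s by rewrite lt_neqAle eq_sym sh.
    by rewrite h'; case: ifP => _; rewrite addn1 -(natr1 k) ltr_norml; lra.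
have [e [eg e2 ek]] := petal_index kg.
pose Q (z : R * R) := (0 < z.1) && ((e%:R < z.2 < e%:R + 1) || (e%:R + 2 < z.2 < e%:R + 3)).
(* Past the midpoint the frame changes from corner [e] to [e + 1] on side [e], and from [e + 3] to
   [e + 2] on the paired side. Both changes amount to [Rk e], since side [e + 2] carries the inverse
   letter. *)
pose j (z : R * R) := if z.2 < e%:R + 1 then e else e.+3.
have e3g : (e.+3 <= 4 * g)%N := petal_range eg e2.
have e2E : e.+2%:R = e%:R + 2 :> R by rewrite -addn2 natrD.
have QE m (t : R) : 0 <= t <= 1 -> Q (1, m%:R + t) = ((m == e) || (m == e.+2)) && (0 < t < 1).
  move=> t1; rewrite /Q /= ltr01 /=.
  have [me|me|->] := ltngtP m e.
  - have h := @ltn_natr1 R _ _ me; rewrite (_ : (m == e.+2) = false) /=; last exact: ltn_eqF (ltn_trans me (leqnSn _)).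
    by apply/negbTE; rewrite negb_or !negb_and -!leNgt; apply/andP; split; apply/orP; left; lra.
  - have h := @ltn_natr1 R _ _ me; rewrite /=; have [me'|me'|->] := ltngtP m e.+2.
    + have h' := @ltn_natr1 R _ _ me'; rewrite e2E in h'; apply/negbTE; rewrite negb_or !negb_and -!leNgt.
      by apply/andP; split; apply/orP; [right|left]; lra.
    + have h' := @ltn_natr1 R _ _ me'; rewrite e2E in h'; apply/negbTE; rewrite negb_or !negb_and -!leNgt.
      by apply/andP; split; apply/orP; right; lra.
    + rewrite e2E (_ : (e%:R < e%:R + 2 + t < e%:R + 1) = false) /=.
        by apply/andP/andP => -[? ?]; split; lra.
      by apply/negbTE; rewrite negb_and -!leNgt; apply/orP; right; lra.
  - rewrite /= (_ : (e%:R + 2 < e%:R + t < e%:R + 3) = false) ?orbF.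
      by apply/andP/andP => -[? ?]; split; lra.
    by apply/negbTE; rewrite negb_and -!leNgt; apply/orP; left; lra.
apply: (flat_chart (Q := Q) (j := j)).
- by move=> z; rewrite /j; case: ifP => _ //; exact: ltnW.
- move=> z rz /andP[z1 z2].
  have n1 : \forall z' \near z, 0 < z'.1 by exact: (cvgr_gt z.1 (cfst z)).
  case/orP: z2 => /andP[z2 z3].
    have n2 : \forall z' \near z, e%:R < z'.2 by exact: (cvgr_gt z.2 (csnd z)).
    have n3 : \forall z' \near z, z'.2 < e%:R + 1 by exact: (cvgr_lt z.2 (csnd z)).
    near=> z' => _; have h1 : 0 < z'.1 by near: z'.
    have h2 : e%:R < z'.2 by near: z'. have h3 : z'.2 < e%:R + 1 by near: z'.
    by rewrite /Q /j h1 h2 h3 z3.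
  have n2 : \forall z' \near z, e%:R + 2 < z'.2 by exact: (cvgr_gt z.2 (csnd z)).
  have n3 : \forall z' \near z, z'.2 < e%:R + 3 by exact: (cvgr_lt z.2 (csnd z)).
  near=> z' => _; have h1 : 0 < z'.1 by near: z'.
  have h2 : e%:R + 2 < z'.2 by near: z'. have h3 : z'.2 < e%:R + 3 by near: z'.
  rewrite /Q /j h1 h2 h3 orbT; split=> //.
  rewrite ifF; last by apply/negbTE; rewrite -leNgt; lra.
  by rewrite ifF //; apply/negbTE; rewrite -leNgt; lra.
- move=> z z'; apply: (qq_inv g0 (Q := fun z => (Q z, fun w0 => if Q z
      then go (frame z) (back (j z) w0) else w0))) => [u u' _ _|p _|m t mg m2 t1].
  + by rewrite /Q /= ltxx.
  + have e0 := ler0n R e; have eN : e%:R + 3 <= N.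
      by rewrite -natrD ler_nat addn3.
    have -> : Q (p, 0) = false.
      by apply/negbTE; rewrite /Q /= negb_and negb_or !negb_and -!leNgt; apply/orP; right; apply/andP; split; apply/orP; left; lra.
    have -> : Q (p, N) = false; last by [].
    by apply/negbTE; rewrite /Q /= negb_and negb_or !negb_and -!leNgt; apply/orP; right; apply/andP; split; apply/orP; right; lra.
  + have t1' : 0 <= 1 - t <= 1 by lra.
    rewrite edge_flip !QE //; rewrite (edge_neq m2 e2) [m.+2 == e]eq_sym (edge_neq e2 m2) orbF /= !eqSS.
    have -> : (0 < 1 - t < 1) = (0 < t < 1) by apply/andP/andP => -[? ?]; split; lra.
    congr (_, _); apply/funext => w0; case: ifP => // /andP[/eqP -> /andP[t0 t2]].
    have e2g := petal_range eg e2.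
    rewrite /frame /= ltxx !nearest_corner_edge // /j /=.
    rewrite ifT; last by lra.
    rewrite ifF; last by apply/negbTE; rewrite -leNgt -addn2 natrD; lra.
    rewrite pm1 // pm2 //; have [h|h] := ltP 2^-1 t.
      rewrite (_ : (2^-1 <= 1 - t) = false); last by apply/negbTE; rewrite -ltNge; lra.
      rewrite addn0 addn1 goS backK; last exact: ltnW.
      have := backK w0 e3g; rewrite goS => wE.
      by rewrite -{1}wE -{1}(linv2 e2) RK.
    rewrite (_ : 2^-1 <= 1 - t); last by lra.
    by rewrite addn0 addn1 !backK // ltnW.
- rewrite /Q p1 ks sh /=; case: ek => ->; first by apply/orP; left; lra.
  by apply/orP; right; rewrite e2E; lra.
Unshelve. all: by end_near. Qed.

Local Notation sec := (sec flat).
Local Notation trans := (trans flat).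

Let i0 : 0 <= (0 : R) <= 1. Proof. by rewrite lexx ler01. Qed.
Let i1 : 0 <= (1 : R) <= 1. Proof. by rewrite lexx ler01. Qed.

Lemma trans_face (zeta : R -> R * R) w : continuous zeta ->
  (forall t, 0 <= t <= 1 -> rect (zeta t)) ->
  trans (qq \o zeta) (go (frame (zeta 0)) w) (go (frame (zeta 1)) w).
Proof.
move=> cz rz; exists (fun t => go (frame (zeta t)) w); split=> // t t1.
have [V [oV Vt VE]] := flat_charts (qq (zeta t)).
have [w' [fw we]] := VE _ (go (frame (zeta t)) w) Vt.
have [_ /(_ _ (rz t t1) Vt) fz] := fw.
have n1 : \forall s \near t, V (qq (zeta s)).
  exact: (cz t _ (near_qq oV Vt)).
have n2 : \forall s \near t, rect (zeta s) -> V (qq (zeta s)) ->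
    back (frame (zeta s)) (w' (qq (zeta s))) = back (frame (zeta t)) (w' (qq (zeta t))).
  exact: (cz t _ fz).
have /nbhs_ballP[e /= e0 eV] : nbhs t [set s | V (qq (zeta s)) /\ (rect (zeta s) -> V (qq (zeta s)) ->
    back (frame (zeta s)) (w' (qq (zeta s))) = back (frame (zeta t)) (w' (qq (zeta t))))].
  by apply: filterS2 n1 n2 => s.
exists V, w', e; split=> // s s1 st.
have [Vs h] : [set s | V (qq (zeta s)) /\ (rect (zeta s) -> V (qq (zeta s)) ->
    back (frame (zeta s)) (w' (qq (zeta s))) = back (frame (zeta t)) (w' (qq (zeta t))))] s.
  by apply: eV; rewrite /ball /= distrC.
split=> //; apply: (@back_inj (zeta s)); rewrite h //; last exact: rz.
by rewrite we !goK // frame_le.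
Qed.

Local Notation v0 := (qq (1, 0)).

Let ck x : continuous (kap x). Proof. exact: continuous_kap. Qed.

(** Loops are conjugated by the base path to the polygon vertex, where the sides are loops and where
    the fibre is read. *)
Definition holonomy (w : W) (x : pi1) (w' : W) : Prop := exists f w1 w2,
  [/\ is_loop x0 f, x = pcl x0 f, trans (rev_fun (kap v0)) w w1, trans f w1 w2 &
      trans (kap v0) w2 w'].

Let cr : continuous (rev_fun (kap v0)). Proof. exact: continuous_path_rev. Qed.

Let kk w w1 : trans (rev_fun (kap v0)) w w1 -> trans (kap v0) w1 w.
Proof.
move=> h0; apply: (trans_eq _ (trans_rev h0)) => t _.
by rewrite /rev_fun subKr.
Qed.

Lemma holonomy_total w x : exists w', holonomy w x w'.
Proof.
have [f fl ->] := pcl_surj x; have [cf _ _] := fl.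
have [w1 h1] := trans_total flat_charts flat_agree w cr.
have [w2 h2] := trans_total flat_charts flat_agree w1 cf.
have [w3 h3] := trans_total flat_charts flat_agree w2 (@ck v0).
by exists w3, f, w1, w2.
Qed.

Lemma holonomy_fun w x w' w'' : holonomy w x w' -> holonomy w x w'' -> w' = w''.
Proof.
move=> [f [w1 [w2 [fl -> h1 h2 h3]]]] [f' [w1' [w2' [fl' e h1' h2' h3']]]].
have [cf' _ _] := fl'; rewrite -(trans_fun flat_agree cr h1 h1') in h2'.
have h := trans_pcl flat_charts flat_agree fl fl' e h2.
rewrite -(trans_fun flat_agree cf' h h2') in h3'.
exact (trans_fun flat_agree (@ck v0) h3 h3').
Qed.

Lemma holonomy1 w : holonomy w 1%g w.
Proof.
have [w1 h1] := trans_total flat_charts flat_agree w cr.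
exists (cst x0), w1, w1; split=> //; last exact: kk.
- by split=> // t; exact: cvg_cst.
- by rewrite pcl_cst.
- exact: trans_cst flat_charts _ _.
Qed.

Lemma holonomyM w x w' y w'' : holonomy w x w' -> holonomy w' y w'' -> holonomy w (x * y)%g w''.
Proof.
move=> [f [w1 [w2 [fl -> h1 h2 h3]]]] [f' [w1' [w2' [fl' -> h1' h2' h3']]]].
have [[cf f0 f1] [cf' f0' f1']] := (fl, fl').
have e : w2 = w1'.
  have h : trans (rev_fun (kap v0)) w' w2 by exact: trans_rev.
  exact (trans_fun flat_agree cr h h1').
exists (cat_fun f f'), w1, w2'; split=> //; first exact: is_loop_cat.
  by rewrite pcl_cat.
apply: (trans_cat flat_agree cf cf' _ h2); first by rewrite f1 f0'.
by rewrite e.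
Qed.

(** Along side [k] the nearest corner changes from [k] to [k + 1], so the transport is [go k.+1]
    after the inverse of [go k]. *)
Lemma holonomy_edge w k : (k < 4 * g)%N -> holonomy w (edge g0 hg x0 k) (Rk k w).
Proof.
move=> kg; pose e := qq \o seg (1, k%:R) (1, k.+1%:R).
have ce : continuous e.
  by apply: continuousT_comp; [exact: continuous_seg | exact: continuous_qq].
have e0 : e 0 = v0 by rewrite /e /= seg0 qq_corner // ltnW.
have e1 : e 1 = v0 by rewrite /e /= seg1 qq_corner.
have te : trans e w (Rk k w).
  have rz t : 0 <= t <= 1 -> rect (seg (1, k%:R) (1, k.+1%:R) t).
    move=> t1; have := @rect_edge R g k t kg t1; congr (rect (_, _)); first by rewrite /=; lra.
    by rewrite /= -natr1; lra.
  have := trans_face (back k w) (@continuous_seg R (1, k%:R) (1, k.+1%:R)) rz.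
  rewrite seg0 seg1 /frame /= ltxx !natE //; last exact: ltnW.
  by rewrite goS backK // ltnW.
have [w1 h1] := trans_total flat_charts flat_agree w cr.
have [w2 h2] := trans_total flat_charts flat_agree (Rk k w) cr.
have cer : continuous (cat_fun e (rev_fun (kap v0))).
  by apply: continuous_path_cat => //; rewrite rev0 kap1.
exists (cat_fun (kap v0) (cat_fun e (rev_fun (kap v0)))), w1, w2; split=> //; last exact: kk.
- have := pG_loop (@ck) (@kap0 _ _ g0 _ hg x0) (@kap1 _ _ g0 _ hg x0) ce.
  by rewrite e0 e1.
- by rewrite /edge kg /pGam /pG -/e e0 e1.
- apply: (trans_cat flat_agree (@ck v0) cer _ (kk h1)); first by rewrite kap1 cat0.
  by apply: (trans_cat flat_agree ce cr _ te h2); rewrite rev0 kap1.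
Qed.

Theorem monodromy : exists act : W -> pi1 -> W, [/\ forall w, act w 1%g = w,
  forall w x y, act w (x * y)%g = act (act w x) y &
  forall w i, (i < 4 * g)%N -> act w (edge g0 hg x0 i) = Rk i w].
Proof.
have /choice[act actP] : forall wx : W * pi1, exists w', holonomy wx.1 wx.2 w'.
  by move=> wx; exact: holonomy_total.
exists (fun w x => act (w, x)); split=> [w|w x y|w i ig].
- exact: holonomy_fun (actP (w, _)) (holonomy1 w).
- apply: holonomy_fun (actP (w, _)) _.
  exact: holonomyM (actP (w, x)) (actP (_, y)).
- exact: holonomy_fun (actP (w, _)) (holonomy_edge w ig).
Qed.
End monodromy.

Local Close Scope ring_scope.
Local Open Scope group_scope.

(** * Products of simple elements and the mapping class group *)

Section simple_products.
Context (G : groupType).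
Implicit Types (s : seq G) (n : nat) (x y : G).

Definition simple_product n y : Prop := exists s,
  [/\ (size s <= n)%N, forall x, x \in s -> simple x & y = \prod_(x <- s) x].

Lemma simple_product_le n m y : (n <= m)%N -> simple_product n y -> simple_product m y.
Proof. by move=> nm [s [sn ss yE]]; exists s; split=> //; exact: leq_trans nm. Qed.

Lemma simple_product1 : simple_product 0 1.
Proof. by exists [::]; rewrite big_nil. Qed.

Lemma simple_productM n m x y : simple_product n x -> simple_product m y ->
  simple_product (n + m) (x * y).
Proof.
move=> [s [sn ss ->]] [t [tm ts ->]]; exists (s ++ t); rewrite size_cat big_cat leq_add //.
by split=> // z; rewrite mem_cat => /orP[]; [exact: ss | exact: ts].
Qed.

Lemma simple_product_simple x : simple x -> simple_product 1 x.
Proof. by move=> sx; exists [:: x]; rewrite big_seq1; split=> // y; rewrite inE => /eqP ->. Qed.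

Lemma simple_productV n x : simple_product n x -> simple_product n x^-1.
Proof.
move=> [s [sn ss ->]]; apply: simple_product_le sn _; elim: s ss => [|x0 s IH] ss.
  by rewrite big_nil invg1; exact: simple_product1.
rewrite big_cons invgM /= -addn1; apply: simple_productM.
  by apply: IH => y ys; apply: ss; rewrite inE ys orbT.
by apply/simple_product_simple/simpleV/ss; rewrite mem_head.
Qed.

Lemma simple_product_morph (f h : G -> G) n x :
  {morph f : x y / x * y} -> {morph h : x y / x * y} -> cancel f h -> cancel h f ->
  simple_product n x -> simple_product n (f x).
Proof.
move=> fM hM fK hK [s [sn ss ->]]; apply: simple_product_le sn _; elim: s ss => [|x0 s IH] ss.
  have f1 : f 1 = 1 by apply: (mulgI (f 1)); rewrite -fM !mulg1.
  by rewrite big_nil f1; exact: simple_product1.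
rewrite big_cons fM /= -add1n; apply: simple_productM.
  by apply/simple_product_simple/(simple_morph fM hM fK hK)/ss; rewrite mem_head.
by apply: IH => y ys; apply: ss; rewrite inE ys orbT.
Qed.

Lemma simple_product_prod n s : (forall x, x \in s -> simple_product n x) ->
  simple_product (n * size s) (\prod_(x <- s) x).
Proof.
elim: s => [|x s IH] ss; first by rewrite big_nil muln0; exact: simple_product1.
rewrite big_cons /= mulnS; apply: simple_productM; first by apply: ss; rewrite mem_head.
by apply: IH => y ys; apply: ss; rewrite inE ys orbT.
Qed.
End simple_products.

Section induced_map.
Context {R : realType} {X : topologicalType} (x0 : X).
Local Notation pi1 := (pi1 R x0).

Let rep (x : pi1) : R -> X := projT1 (cid2 (pcl_surj x)).
Let repP x : is_loop x0 (rep x). Proof. by rewrite /rep; case: cid2. Qed.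
Let repK x : pcl x0 (rep x) = x. Proof. by rewrite /rep; case: cid2. Qed.

Definition induced (h : X -> X) (x : pi1) : pi1 := pcl x0 (h \o rep x).

Lemma is_loop_comp (h : X -> X) (f : R -> X) :
  continuous h -> h x0 = x0 -> is_loop x0 f -> is_loop x0 (h \o f).
Proof. by move=> ch hx [cf f0 f1]; split; rewrite /= ?f0 ?f1 //; exact: continuousT_comp. Qed.

Lemma inducedE (h : X -> X) f : continuous h -> h x0 = x0 -> is_loop x0 f ->
  induced h (pcl x0 f) = pcl x0 (h \o f).
Proof.
move=> ch hx fl; rewrite /induced; set r := rep _.
have rl : is_loop x0 r by exact: repP.
have : pcl x0 r = pcl x0 f by exact: repK.
rewrite (pclE rl) (pclE fl) => /pi1P[F [cF F0 F1 Fe]].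
rewrite (pclE (is_loop_comp ch hx rl)) (pclE (is_loop_comp ch hx fl)); apply/pi1P.
exists (h \o F); split=> [|t It|t It|s Is] /=.
- by apply: (@within_comp _ _ _ _ setT F h) => //; exact: continuous_subspaceT.
- by rewrite F0 // !loop_ofE.
- by rewrite F1 // !loop_ofE.
- by have [-> ->] := Fe s Is.
Qed.

Lemma inducedM (h : X -> X) : continuous h -> h x0 = x0 -> {morph induced h : x y / x * y}.
Proof.
move=> ch hx x y; have [f fl ->] := pcl_surj x; have [f' fl' ->] := pcl_surj y.
rewrite -pcl_cat // !inducedE //; last exact: is_loop_cat.
rewrite -pcl_cat; [|exact: is_loop_comp..]; congr (pcl x0).
by apply/funext => t; rewrite /cat_fun /=; case: ifP.
Qed.

Lemma inducedK (h k : X -> X) : continuous h -> h x0 = x0 -> continuous k -> k x0 = x0 ->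
  cancel h k -> cancel (induced h) (induced k).
Proof.
move=> ch hx ck kx hK x; have [f fl ->] := pcl_surj x.
rewrite inducedE // inducedE //; last exact: is_loop_comp.
by congr (pcl x0); apply/funext => t /=; rewrite hK.
Qed.
End induced_map.

Lemma Mod_act_induced (R : realType) (M : closed_oriented_surface R) (x0 : M)
  (m : Mod x0) (x : pi1 R x0) : Mod_act m x = induced (repr m) x.
Proof.
have [f fl ->] := pcl_surj x; rewrite inducedE //; last 2 first.
- by have [] := pdiffeo_smooth (repr m).
- exact: pdiffeo_fix.
rewrite -{1}[m]reprK (pclE fl) Mod_actE.
have hl : is_loop x0 (repr m \o f).
  by apply: is_loop_comp => //; [have [] := pdiffeo_smooth (repr m) | exact: pdiffeo_fix].
by rewrite (pclE hl); apply/pi1P/homotopic_eq => t _; rewrite push_loopE /= !loop_ofE.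
Qed.

Lemma simple_product_Mod (R : realType) (M : closed_oriented_surface R) (x0 : M)
  (m : Mod x0) n (x : pi1 R x0) : simple_product n x -> simple_product n (Mod_act m x).
Proof.
rewrite Mod_act_induced; set f := repr m.
have cf : continuous f by have [] := pdiffeo_smooth f.
have ch : continuous (pdiffeo_inv f) by have [] := pdiffeo_inv_smooth f.
have fx : f x0 = x0 by exact: pdiffeo_fix.
have hx : pdiffeo_inv f x0 = x0 by have := pdiffeoK f x0; rewrite fx.
apply: (@simple_product_morph _ (induced f) (induced (pdiffeo_inv f))).
- exact: inducedM.
- exact: inducedM.
- by apply: inducedK => //; exact: pdiffeoK.
- by apply: inducedK => //; exact: pdiffeoVK.
Qed.

Lemma polygon_surface_group (R : realType) (g : nat) (g0 : (0 < g)%N) (X : topologicalType)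
    (hX : hausdorff_space X) (hg : has_genus R g X) (x0 : X) :
  surface_group g (edge g0 hg x0).
Proof.
split.
- exact: edge_linv.
- exact: prod_edge.
- move=> P P1 PM PV PE; exact: (edge_generation hX P1 PM PV PE).
- move=> W Rk RK Rrel; exact: (monodromy g0 hX hg x0 RK Rrel).
Qed.

Theorem theorem1p1 (R : realType) (g : nat) (Sigma : closed_oriented_surface R)
    (x0 : Sigma) (S : set (pi1 R x0)) :
  (2 <= g)%N ->
  has_genus R g Sigma ->
  generates S ->
  (exists2 F : set (pi1 R x0),
     finite_set F & S `<=` \bigcup_(x in F) Mod_orbit x) ->
  infinite_diameter (cayley_graph S).
Proof.
move=> g2 hg _ [F Ffin SF] /finite_diameter_cayleyP[C HC].
have g0 : (0 < g)%N by exact: ltnW.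
have sg := polygon_surface_group g0 (surface_hausdorff (c := Sigma)) hg x0.
have /choice[n nP] : forall x : pi1 R x0, exists n, simple_product n x.
  have [_ _ gen _] := sg; apply: gen => [|x y [n nx] [m my]|x [n nx]|i ig].
  - by exists 0%N; exact: simple_product1.
  - by exists (n + m)%N; exact: simple_productM.
  - by exists n; exact: simple_productV.
  - exists 1%N; exact/simple_product_simple/(simple_gen g2 sg).
(* [l] bounds the number of simple factors for the orbit representatives, hence on the whole of [S],
   because mapping classes act by automorphisms. *)
have /finite_seqP[t tF] := Ffin; pose l := \max_(x <- t) n x.
have Sl x : S x -> simple_product l x.
  move=> /SF[y Fy [m _ <-]]; apply: simple_product_Mod.
  by apply: simple_product_le (nP y); apply: leq_bigmax_seq => //; move: Fy; rewrite tF.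
have [y yP] := not_bounded_simple g2 sg (l * C).
have [s [sC sS yE]] := HC y.
have [t' [t'C t's yE']] : simple_product (l * size s) y.
  rewrite yE; apply: simple_product_prod => x /sS[|] Sx; first exact: Sl.
  by rewrite -[x]invgK; apply/simple_productV/Sl.
have := yP t' t's yE'; rewrite ltnNge => /negP; apply.
by apply: leq_trans t'C _; rewrite leq_mul2l sC orbT.
Qed.
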